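(* Let $q$ be an odd prime power, let the type be one of $A,A^{*},B,C,D$, and put $d=q-1$. Let $\mathbb K$ be a finite Galois extension of $\mathbb C(u)$ such that $\mathbb K Y_{q-1,n}$ and $\mathbb K Z_{q-1,n}$ are split. Then the specialization maps $$d_{\phi_q}:\mathrm{Irr}(\mathbb K Y_{q-1,n})\to \mathrm{Irr}(\mathcal H(G,U)),\qquad d_{\phi_1}:\mathrm{Irr}(\mathbb K Y_{q-1,n})\to \mathrm{Irr}(N_{q-1,n}),$$ $$d_{\tau_1}:\mathrm{Irr}(\mathbb K Z_{q-1,n})\to \mathrm{Irr}(N_{q-1,n}),\qquad d_{\tau_0}:\mathrm{Irr}(\mathbb K Z_{q-1,n})\to \mathrm{Irr}(S_{q-1,n})$$ are well defined bijections. In particular $d_{\tau_0}\circ d_{\tau_1}^{-1}\circ d_{\phi_1}\circ d_{\phi_q}^{-1}$ is a bijection from $\mathrm{Irr}(\mathcal H(G,U))$ to $\mathrm{Irr}(S_{q-1,n})$.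
   Context: Type data ($n\ge 2$). The Weyl group $W$ acts on the lattice $\bigoplus_{j=1}^n\mathbb Z H_j$; to each simple root $a_i$ ($i=1,\dots,l$) is attached a simple reflection $s_{a_i}\in W$ and a distinguished lattice element $H_{a_i}$. - Types $A$, $A^{*}$ (groups $GL_n$, $SL_n$): $W=\mathbb S_n$ permutes the $H_j$; $l=n-1$; the simple reflections are the transpositions $(i,i+1)$, with distinguished element $H_i-H_{i+1}$. - Types $B$, $C$: $W=W_n$ is the group of $n\times n$ signed permutation matrices acting on the $H_j$ by signed permutations; $l=n$; the reflection of $a_1$ is $\mathrm{Diag}(-1,1,\dots,1)$, with $H_{a_1}=2H_1$ in type $B$ and $H_{a_1}=H_1$ in type $C$; the other simple reflections are the $(i,i+1)$, $1\le i\le n-1$, with distinguished element $\pm(H_i-H_{i+1})$ (the sign is irrelevant). - Type $D$: $W=W_n'\subset W_n$, the signed permutation matrices with an even number of entries $-1$; $l=n$; the reflection of $a_1$ is $\mathrm{Diag}(-1,1,\dots,1)(1,2)\mathrm{Diag}(-1,1,\dots,1)$ with $H_{a_1}=H_1+H_2$; the others are the $(i,i+1)$ as in type $B$. Let $m_{ij}$ be the order of $s_{a_i}s_{a_j}$. For $d$ even and $H=\sum c_jH_j$ put $t_H=\prod t_j^{c_j}$, $h_i=t_{H_{a_i}}^{d/2}$, $e_i=\frac1d\sum_{j=1}^d t_{H_{a_i}}^j$. All objects below have generators $t_j$ ($1\le j\le n$), $\xi_i$ ($1\le i\le l$) and the common relations: (1) $t_jt_k=t_kt_j$; (2) $t_j^d=1$;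 (3) $\xi_it_j=t_{s_{a_i}(H_j)}\xi_i$; (5) braid relations $\xi_i\xi_j\cdots=\xi_j\xi_i\cdots$ ($m_{ij}$ factors each side). In addition: - $Y_{d,n}$ is the $\mathbb C[u^{\pm1}]$-algebra with $\xi_i^2=u h_i+(1-u)e_i\xi_i$; - $Z_{d,n}$ is the $\mathbb C[u]$-algebra with $\xi_i^2=u h_i+(1-u)$; - $N_{d,n}$ is the group with $\xi_i^2=h_i$; - $S_{d,n}$ is the group with $\xi_i^2=1$. In type $A^{*}$ the torus generated by the $t_j$ (isomorphic to $C_d^n$) is replaced by the subgroup of diagonal matrices of determinant one with entries in $C_d$ (the $d$-th roots of unity), on which the $\xi_i$ act by the corresponding permutations. For $q$ an odd prime power, $\mathcal H(G,U)$ is the Yokonuma–Hecke algebra of the Chevalley group $G$ of the given type over $\mathbb F_q$ ($U$ the unipotent radical of a Borel subgroup); it is identified through its presentation with the specialization $\mathbb C\otimes_{u\mapsto q^{-1}}Y_{q-1,n}$. Specializations: $\mathbb K Y=\mathbb K\otimes Y$, $\mathbb K Z=\mathbb K\otimes Z$. $\phi_q,\phi_1$ are ring homomorphisms to $\mathbb C$ from the integral closure of $\mathbb C[u^{\pm1}]$ in $\mathbb K$ extending $u\mapsto q^{-1}$, $u\mapsto 1$; $\tau_1,\tau_0$ are ring homomorphisms to $\mathbb C$ from the integral closure of $\mathbb C[u]$ in $\mathbb K$ extending $u\mapsto1$, $u\mapsto 0$. For such a specialization $\theta$ and an irreducible character $\chi$, $d_\theta(\chi)=\theta\circ\chi$,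 viewed as a character of the specialized algebra ($Y$ at $u=1$ and $Z$ at $u=1$ are $\mathbb C[N_{d,n}]$; $Z$ at $u=0$ is $\mathbb C[S_{d,n}]$). $\mathrm{Irr}$ denotes the set of irreducible characters. *)

(* Defs.v *)
From HB Require Import structures.
From mathcomp Require Import all_boot all_order all_algebra.
From mathcomp Require Import all_field generic_quotient.
From mathcomp Require Import boolp classical_sets functions reals.
From mathcomp Require Import complex.

Set Implicit Arguments.
Unset Strict Implicit.
Unset Printing Implicit Defensive.

Import Order.TTheory GRing.Theory Num.Theory.
Local Open Scope ring_scope.
Local Open Scope quotient_scope.

(* Associative unital algebras over a commutative ring, as rings with a central
   ring morphism from the scalars.  The zero ring is allowed, unlike in the
   library's algType, because a presentation by generators and relations cannot
   rule it out a priori. *)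
HB.mixin Record isPzAlgebra (R : comNzRingType) A of GRing.PzRing A := {
  alg_cst : {rmorphism R -> A};
  alg_cstC : forall (a : R) (x : A), alg_cst a * x = x * alg_cst a
}.

#[short(type="pzAlgType")]
HB.structure Definition PzAlgebra (R : comNzRingType) :=
  {A of isPzAlgebra R A & GRing.PzRing A}.

(* Algebras given by generators and relations: formal expressions in the
   generators X with coefficients in R, modulo the least congruence that
   contains the relations and makes them an R-algebra. *)

Inductive aterm (R X : Type) : Type :=
  | AVar of X
  | ACst of R
  | AAdd of aterm R X & aterm R X
  | AMul of aterm R X & aterm R X.
Arguments AVar {R X}.
Arguments ACst {R X}.

HB.instance Definition _ R X := gen_eqMixin (aterm R X).
HB.instance Definition _ R X := gen_choiceMixin (aterm R X).

Section PresentedAlgebra.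
Variables (R : comNzRingType) (X : Type).
Notation term := (aterm R X).
Variable rel : term -> term -> Prop.

Inductive acong : term -> term -> Prop :=
  | acong_rel s t : rel s t -> acong s t
  | acong_refl t : acong t t
  | acong_sym s t : acong s t -> acong t s
  | acong_trans s t r : acong s t -> acong t r -> acong s r
  | acong_add s s' t t' :
      acong s s' -> acong t t' -> acong (AAdd s t) (AAdd s' t')
  | acong_mul s s' t t' :
      acong s s' -> acong t t' -> acong (AMul s t) (AMul s' t')
  | acong_addA r s t : acong (AAdd r (AAdd s t)) (AAdd (AAdd r s) t)
  | acong_addC s t : acong (AAdd s t) (AAdd t s)
  | acong_add0 t : acong (AAdd (ACst 0) t) t
  | acong_addN t : acong (AAdd (AMul (ACst (-1)) t) t) (ACst 0)
  | acong_mulA r s t : acong (AMul r (AMul s t)) (AMul (AMul r s) t)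
  | acong_mul1l t : acong (AMul (ACst 1) t) t
  | acong_mulDl r s t :
      acong (AMul (AAdd r s) t) (AAdd (AMul r t) (AMul s t))
  | acong_mulDr r s t :
      acong (AMul r (AAdd s t)) (AAdd (AMul r s) (AMul r t))
  | acong_cstD a b : acong (ACst (a + b)) (AAdd (ACst a) (ACst b))
  | acong_cstM a b : acong (ACst (a * b)) (AMul (ACst a) (ACst b))
  | acong_cstC a t : acong (AMul (ACst a) t) (AMul t (ACst a)).

Definition acongb (s t : term) : bool := `[< acong s t >].

Lemma acongb_refl : reflexive acongb.
Proof. by move=> t; apply/asboolP; exact: acong_refl. Qed.

Lemma acongb_sym : symmetric acongb.
Proof.
by move=> s t; apply/asboolP/asboolP => /acong_sym.
Qed.

Lemma acongb_trans : transitive acongb.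
Proof.
move=> t s r /asboolP st /asboolP tr; apply/asboolP.
exact: acong_trans st tr.
Qed.

Canonical acong_equiv :=
  EquivRel acongb acongb_refl acongb_sym acongb_trans.

Definition palg : Type := {eq_quot acong_equiv}.

HB.instance Definition _ := Choice.on palg.
HB.instance Definition _ := EqQuotient.on palg.

Definition pi_alg (t : term) : palg := \pi_palg t.

Lemma pi_algP s t : reflect (pi_alg s = pi_alg t) `[< acong s t >].
Proof. by apply: (iffP idP) => [?|/eqquotP//]; apply/eqquotP. Qed.

Lemma pi_alg_eq s t : acong s t -> pi_alg s = pi_alg t.
Proof. by move=> /asboolP/pi_algP. Qed.

Lemma pi_alg_repr (x : palg) : pi_alg (repr x) = x.
Proof. by rewrite /pi_alg reprK. Qed.

Lemma acong_repr t : acong (repr (pi_alg t)) t.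
Proof. by apply/asboolP/pi_algP; rewrite pi_alg_repr. Qed.

Definition palg_add (x y : palg) := pi_alg (AAdd (repr x) (repr y)).
Definition palg_mul (x y : palg) := pi_alg (AMul (repr x) (repr y)).
Definition palg_cst (a : R) : palg := pi_alg (ACst a).
Definition palg_opp (x : palg) := palg_mul (palg_cst (-1)) x.
Definition palg_gen (x : X) : palg := pi_alg (AVar x).

Lemma pi_algD s t : pi_alg (AAdd s t) = palg_add (pi_alg s) (pi_alg t).
Proof.
by apply/esym/pi_alg_eq/acong_add; exact: acong_repr.
Qed.

Lemma pi_algM s t : pi_alg (AMul s t) = palg_mul (pi_alg s) (pi_alg t).
Proof.
by apply/esym/pi_alg_eq/acong_mul; exact: acong_repr.
Qed.

Lemma palg_ind (P : palg -> Prop) : (forall t, P (pi_alg t)) -> forall x, P x.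
Proof. by move=> Ppi x; rewrite -(pi_alg_repr x). Qed.

Lemma palg_addA : associative palg_add.
Proof.
elim/palg_ind=> r; elim/palg_ind=> s; elim/palg_ind=> t.
by rewrite -!pi_algD; apply/pi_alg_eq/acong_addA.
Qed.

Lemma palg_addC : commutative palg_add.
Proof.
elim/palg_ind=> s; elim/palg_ind=> t.
by rewrite -!pi_algD; apply/pi_alg_eq/acong_addC.
Qed.

Lemma palg_add0 : left_id (palg_cst 0) palg_add.
Proof. by elim/palg_ind=> t; rewrite -pi_algD; apply/pi_alg_eq/acong_add0. Qed.

Lemma palg_addN : left_inverse (palg_cst 0) palg_opp palg_add.
Proof.
elim/palg_ind=> t; rewrite /palg_opp -pi_algM -pi_algD.
exact/pi_alg_eq/acong_addN.
Qed.

HB.instance Definition _ :=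
  GRing.isZmodule.Build palg palg_addA palg_addC palg_add0 palg_addN.

Lemma palg_mulA : associative palg_mul.
Proof.
elim/palg_ind=> r; elim/palg_ind=> s; elim/palg_ind=> t.
by rewrite -!pi_algM; apply/pi_alg_eq/acong_mulA.
Qed.

Lemma palg_cstC a : forall x, palg_mul (palg_cst a) x = palg_mul x (palg_cst a).
Proof. by elim/palg_ind=> t; rewrite -!pi_algM; apply/pi_alg_eq/acong_cstC. Qed.

Lemma palg_mul1l : left_id (palg_cst 1) palg_mul.
Proof. by elim/palg_ind=> t; rewrite -pi_algM; apply/pi_alg_eq/acong_mul1l. Qed.

Lemma palg_mul1r : right_id (palg_cst 1) palg_mul.
Proof. by move=> x; rewrite -palg_cstC palg_mul1l. Qed.

Lemma palg_mulDl : left_distributive palg_mul palg_add.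
Proof.
elim/palg_ind=> r; elim/palg_ind=> s; elim/palg_ind=> t.
by rewrite -!(pi_algM, pi_algD); apply/pi_alg_eq/acong_mulDl.
Qed.

Lemma palg_mulDr : right_distributive palg_mul palg_add.
Proof.
elim/palg_ind=> r; elim/palg_ind=> s; elim/palg_ind=> t.
by rewrite -!(pi_algM, pi_algD); apply/pi_alg_eq/acong_mulDr.
Qed.

HB.instance Definition _ :=
  GRing.Zmodule_isPzRing.Build palg palg_mulA palg_mul1l palg_mul1r
    palg_mulDl palg_mulDr.

Fact palg_cst_zmod : zmod_morphism palg_cst.
Proof.
move=> a b; apply: (addIr (palg_cst b)); rewrite subrK -[_ + _]pi_algD.
by rewrite -[in RHS](subrK b a); apply/esym/pi_alg_eq/acong_cstD.
Qed.

Fact palg_cst_monoid : monoid_morphism palg_cst.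
Proof.
by split=> // a b; rewrite -[RHS]pi_algM; apply/pi_alg_eq/acong_cstM.
Qed.

HB.instance Definition _ :=
  GRing.isZmodMorphism.Build R palg palg_cst palg_cst_zmod.
HB.instance Definition _ :=
  GRing.isMonoidMorphism.Build R palg palg_cst palg_cst_monoid.
HB.instance Definition _ := isPzAlgebra.Build R palg palg_cstC.

(* The map out of the presented algebra extending f on the generators and g on
   the scalars; by palg_lift_rmorphism it is the ring morphism given by the
   universal property as soon as f and g respect the relations. *)
Fixpoint aeval (B : pzRingType) (g : R -> B) (f : X -> B) (t : term) : B :=
  match t with
  | AVar x => f x
  | ACst a => g a
  | AAdd s t => aeval g f s + aeval g f t
  | AMul s t => aeval g f s * aeval g f t
  end.

Definition palg_lift (B : pzRingType) (g : R -> B) (f : X -> B) (x : palg) : B :=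
  aeval g f (repr x).

Section Lift.
Variables (B : pzRingType) (g : {rmorphism R -> B}) (f : X -> B).
Hypothesis gC : forall a b, g a * b = b * g a.
Hypothesis fR : forall s t, rel s t -> aeval g f s = aeval g f t.

Lemma aeval_cong s t : acong s t -> aeval g f s = aeval g f t.
Proof.
elim=> //=.
- by move=> r s' t' _ -> _ ->.
- by move=> ? ? ? ? _ -> _ ->.
- by move=> ? ? ? ? _ -> _ ->.
- by move=> *; rewrite addrA.
- by move=> *; rewrite addrC.
- by move=> *; rewrite rmorph0 add0r.
- by move=> *; rewrite rmorphN1 mulN1r addNr rmorph0.
- by move=> *; rewrite mulrA.
- by move=> *; rewrite rmorph1 mul1r.
- by move=> *; rewrite mulrDl.
- by move=> *; rewrite mulrDr.
- by move=> *; rewrite rmorphD.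
- by move=> *; rewrite rmorphM.
Qed.

Lemma palg_lift_pi t : palg_lift g f (pi_alg t) = aeval g f t.
Proof. exact/aeval_cong/acong_repr. Qed.

Lemma palg_lift_gen x : palg_lift g f (palg_gen x) = f x.
Proof. by rewrite palg_lift_pi. Qed.

Lemma palg_lift_zmod_morphism : zmod_morphism (palg_lift g f).
Proof.
elim/palg_ind=> s; elim/palg_ind=> t; rewrite [- _]/(palg_opp _) /palg_opp -pi_algM.
by rewrite -[_ + _]pi_algD !palg_lift_pi /= rmorphN1 mulN1r.
Qed.

Lemma palg_lift_monoid_morphism : monoid_morphism (palg_lift g f).
Proof.
split; first by rewrite palg_lift_pi /= rmorph1.
by elim/palg_ind=> s; elim/palg_ind=> t; rewrite -[_ * _]pi_algM !palg_lift_pi.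
Qed.

End Lift.

End PresentedAlgebra.

(* Extension of scalars S (x)_R A along f : R -> S, presented as the universal
   S-algebra receiving a ring morphism from A that extends f on the scalars. *)
Section BaseChange.
Variables (R S : comNzRingType) (f : {rmorphism R -> S}) (A : pzAlgType R).

Inductive base_change_rel : aterm S A -> aterm S A -> Prop :=
  | BcAdd x y : base_change_rel (AVar (x + y)) (AAdd (AVar x) (AVar y))
  | BcMul x y : base_change_rel (AVar (x * y)) (AMul (AVar x) (AVar y))
  | BcCst a :
      base_change_rel (AVar (alg_cst a)) (ACst (f a)).

Definition base_change := palg base_change_rel.
HB.instance Definition _ := PzAlgebra.on base_change.

(* x |-> 1 (x) x *)
Definition to_base_change : A -> base_change := @palg_gen S A base_change_rel.

End BaseChange.

Section PresentedGroup.
Variable X : Type.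

Inductive gterm : Type :=
  | GVar of X
  | GOne
  | GMul of gterm & gterm
  | GInv of gterm.

HB.instance Definition _ := gen_eqMixin gterm.
HB.instance Definition _ := gen_choiceMixin gterm.

Variable rel : gterm -> gterm -> Prop.

Inductive gcong : gterm -> gterm -> Prop :=
  | gcong_rel s t : rel s t -> gcong s t
  | gcong_refl t : gcong t t
  | gcong_sym s t : gcong s t -> gcong t s
  | gcong_trans s t r : gcong s t -> gcong t r -> gcong s r
  | gcong_mul s s' t t' :
      gcong s s' -> gcong t t' -> gcong (GMul s t) (GMul s' t')
  | gcong_inv s t : gcong s t -> gcong (GInv s) (GInv t)
  | gcong_mulA r s t : gcong (GMul r (GMul s t)) (GMul (GMul r s) t)
  | gcong_mul1l t : gcong (GMul GOne t) t
  | gcong_mul1r t : gcong (GMul t GOne) t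
  | gcong_mulV t : gcong (GMul (GInv t) t) GOne
  | gcong_mulVr t : gcong (GMul t (GInv t)) GOne.

Definition gcongb (s t : gterm) : bool := `[< gcong s t >].

Lemma gcongb_refl : reflexive gcongb.
Proof. by move=> t; apply/asboolP; exact: gcong_refl. Qed.

Lemma gcongb_sym : symmetric gcongb.
Proof. by move=> s t; apply/asboolP/asboolP => /gcong_sym. Qed.

Lemma gcongb_trans : transitive gcongb.
Proof.
move=> t s r /asboolP st /asboolP tr; apply/asboolP.
exact: gcong_trans st tr.
Qed.

Canonical gcong_equiv :=
  EquivRel gcongb gcongb_refl gcongb_sym gcongb_trans.

Definition pgrp : Type := {eq_quot gcong_equiv}.

HB.instance Definition _ := Choice.on pgrp.
HB.instance Definition _ := EqQuotient.on pgrp.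

Definition pi_grp (t : gterm) : pgrp := \pi_pgrp t.

Lemma pi_grp_eq s t : gcong s t -> pi_grp s = pi_grp t.
Proof. by move=> st; apply/eqquotP/asboolP. Qed.

Lemma pi_grp_repr (x : pgrp) : pi_grp (repr x) = x.
Proof. by rewrite /pi_grp reprK. Qed.

Lemma gcong_repr t : gcong (repr (pi_grp t)) t.
Proof.
have /eqquotP/asboolP := pi_grp_repr (pi_grp t); exact.
Qed.

Definition pgrp_mul (x y : pgrp) := pi_grp (GMul (repr x) (repr y)).
Definition pgrp_inv (x : pgrp) := pi_grp (GInv (repr x)).
Definition pgrp_one := pi_grp GOne.
Definition pgrp_gen (x : X) : pgrp := pi_grp (GVar x).

Lemma pi_grpM s t : pi_grp (GMul s t) = pgrp_mul (pi_grp s) (pi_grp t).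
Proof. by apply/esym/pi_grp_eq/gcong_mul; exact: gcong_repr. Qed.

Lemma pi_grpV s : pi_grp (GInv s) = pgrp_inv (pi_grp s).
Proof. by apply/esym/pi_grp_eq/gcong_inv; exact: gcong_repr. Qed.

Lemma pgrp_ind (P : pgrp -> Prop) : (forall t, P (pi_grp t)) -> forall x, P x.
Proof. by move=> Ppi x; rewrite -(pi_grp_repr x). Qed.

Lemma pgrp_mulA : associative pgrp_mul.
Proof.
elim/pgrp_ind=> r; elim/pgrp_ind=> s; elim/pgrp_ind=> t.
by rewrite -!pi_grpM; apply/pi_grp_eq/gcong_mulA.
Qed.

Lemma pgrp_mul1l : left_id pgrp_one pgrp_mul.
Proof. by elim/pgrp_ind=> t; rewrite -pi_grpM; apply/pi_grp_eq/gcong_mul1l. Qed.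

Lemma pgrp_mul1r : right_id pgrp_one pgrp_mul.
Proof. by elim/pgrp_ind=> t; rewrite -pi_grpM; apply/pi_grp_eq/gcong_mul1r. Qed.

Lemma pgrp_mulVl : left_inverse pgrp_one pgrp_inv pgrp_mul.
Proof.
by elim/pgrp_ind=> t; rewrite -pi_grpV -pi_grpM; apply/pi_grp_eq/gcong_mulV.
Qed.

Lemma pgrp_mulVr : right_inverse pgrp_one pgrp_inv pgrp_mul.
Proof.
by elim/pgrp_ind=> t; rewrite -pi_grpV -pi_grpM; apply/pi_grp_eq/gcong_mulVr.
Qed.

HB.instance Definition _ :=
  isGroup.Build pgrp pgrp_mulA pgrp_mul1l pgrp_mul1r pgrp_mulVl pgrp_mulVr.

End PresentedGroup.
Arguments GOne {X}.
Arguments GVar {X}.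

(* The group algebra F[G], presented as the universal F-algebra receiving a
   monoid morphism from G (the library's group rings require G finite). *)
Section GroupAlgebra.
Variables (F : fieldType) (G : groupType).

Inductive group_algebra_rel : aterm F G -> aterm F G -> Prop :=
  | GaMul x y : group_algebra_rel (AVar (x * y)%g) (AMul (AVar x) (AVar y))
  | GaOne : group_algebra_rel (AVar 1%g) (ACst 1).

Definition group_algebra := palg group_algebra_rel.
HB.instance Definition _ := PzAlgebra.on group_algebra.

Definition to_group_algebra : G -> group_algebra :=
  @palg_gen F G group_algebra_rel.

End GroupAlgebra.
Arguments to_group_algebra F {G}.

(* Representations act on row vectors, as everywhere in the library. *)
Section Characters.
Variables (K : fieldType) (A : pzAlgType K).

Definition irreducible_repr m (rho : {rmorphism A -> 'M[K]_m.+1}) : Prop :=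
  (forall a, rho (alg_cst a) = a%:M) /\
  forall U : 'M[K]_m.+1, (forall a, stablemx U (rho a)) -> U = 0 \/ row_full U.

Definition Irr : set (A -> K) := fun chi =>
  exists m (rho : {rmorphism A -> 'M[K]_m.+1}),
    irreducible_repr rho /\ chi = (fun a => \tr (rho a)).

Definition split_algebra : Prop :=
  forall m (rho : {rmorphism A -> 'M[K]_m.+1}), irreducible_repr rho ->
  forall B : 'M[K]_m.+1, (forall a, rho a *m B = B *m rho a) -> is_scalar_mx B.

End Characters.
Arguments Irr {K} A _.

Section IntegralClosure.
Variables (R : comNzRingType) (K : fieldType) (j : {rmorphism R -> K}).

Definition integralb : {pred K} := fun x => `[< integralOver j x >].

Fact integralb_subring : subring_closed integralb.
Proof.
split.
- by apply/asboolP; exact: integral1.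
- by move=> x y /asboolP hx /asboolP hy; apply/asboolP; exact: integral_sub.
- by move=> x y /asboolP hx /asboolP hy; apply/asboolP; exact: integral_mul.
Qed.

HB.instance Definition _ := GRing.isSubringClosed.Build K integralb
  integralb_subring.

Definition integral_closure : Type := {x : K | x \in integralb}.
HB.instance Definition _ := SubChoice.on integral_closure.
HB.instance Definition _ :=
  [SubChoice_isSubComNzRing of integral_closure by <:].

Lemma integral_base (a : R) : j a \in integralb.
Proof. by apply/asboolP; exact: integral_id. Qed.

Definition to_integral_closure (a : R) : integral_closure :=
  Sub (j a) (integral_base a).

End IntegralClosure.

Section Laurent.
Variable F : fieldType.
Notation Fu := {fraction {poly F}}.
Local Notation "p %:F" := (@FracField.tofrac {poly F} p).

Definition laurentb : {pred Fu} := fun x =>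
  `[< exists p (m : nat), x * ('X%:F) ^+ m = p%:F >].

Lemma tofracX_neq0 m : ('X%:F : Fu) ^+ m != 0.
Proof. by rewrite expf_neq0 // tofrac_eq0 polyX_eq0. Qed.

Fact laurentb_subring : subring_closed laurentb.
Proof.
split.
- by apply/asboolP; exists 1, 0%N; rewrite expr0 mulr1 tofrac1.
- move=> x y /asboolP[p [m hp]] /asboolP[p' [m' hp']]; apply/asboolP.
  exists (p * 'X ^+ m' - p' * 'X ^+ m), (m + m')%N.
  rewrite tofracB !tofracM !tofracXn -hp -hp' exprD mulrBl mulrA; congr (_ - _).
  by rewrite mulrA -mulrA [X in _ * X]mulrC mulrA.
- move=> x y /asboolP[p [m hp]] /asboolP[p' [m' hp']]; apply/asboolP.
  exists (p * p'), (m + m')%N.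
  by rewrite tofracM -hp -hp' exprD mulrACA.
Qed.

HB.instance Definition _ := GRing.isSubringClosed.Build Fu laurentb
  laurentb_subring.

(* F[u, u^-1] as a subring of F(u), the indeterminate being 'X. *)
Definition laurent : Type := {x : Fu | x \in laurentb}.
HB.instance Definition _ := SubChoice.on laurent.
HB.instance Definition _ := [SubChoice_isSubComNzRing of laurent by <:].

Lemma poly_laurent (p : {poly F}) : p%:F \in laurentb.
Proof. by apply/asboolP; exists p, 0%N; rewrite expr0 mulr1. Qed.

Definition laurent_of_poly (p : {poly F}) : laurent := Sub p%:F (poly_laurent p).

Lemma laurentP (x : laurent) :
  exists pm : {poly F} * nat, val x * ('X%:F) ^+ pm.2 = pm.1%:F.
Proof. by case: x => x /= /asboolP[p [m h]]; exists (p, m). Qed.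

Section Evaluation.
Variable c : F.

Definition laurent_eval (c_neq0 : c != 0) (x : laurent) : F :=
  let pm := sval (cid (laurentP x)) in pm.1.[c] / c ^+ pm.2.

Hypothesis c_neq0 : c != 0.

Lemma laurent_evalE x p m : val x * ('X%:F) ^+ m = p%:F ->
  laurent_eval c_neq0 x = p.[c] / c ^+ m.
Proof.
rewrite /laurent_eval; case: cid => -[p' m'] /= hp' hp.
have e : p' * 'X ^+ m = p * 'X ^+ m'.
  by apply/eqP; rewrite -tofrac_eq; apply/eqP; rewrite !tofracM !tofracXn -hp -hp' mulrAC.
have {e}/(congr1 (horner_eval c)) : _ := e.
rewrite /horner_eval !hornerM !hornerXn => e.
by apply/eqP; rewrite eqr_div ?expf_neq0 // e.
Qed.

Lemma laurent_eval_poly p : laurent_eval c_neq0 (laurent_of_poly p) = p.[c].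
Proof.
by rewrite (@laurent_evalE _ p 0%N) ?divr1 //= expr0 mulr1.
Qed.

Fact laurent_eval_zmod : zmod_morphism (laurent_eval c_neq0).
Proof.
move=> x y; have [[p m] /= hp] := laurentP x; have [[p' m'] /= hp'] := laurentP y.
rewrite (laurent_evalE hp) (laurent_evalE hp').
rewrite (@laurent_evalE _ (p * 'X ^+ m' - p' * 'X ^+ m) (m + m')%N); last first.
  rewrite tofracB !tofracM !tofracXn -hp -hp' exprD rmorphB /= mulrBl mulrA.
  by congr (_ - _); rewrite mulrA -mulrA [X in _ * X]mulrC mulrA.
rewrite hornerD hornerN !hornerM !hornerXn exprD mulrBl; congr (_ - _).
  by rewrite -mulf_div divff ?expf_neq0 ?mulr1.
by rewrite [c ^+ m * _]mulrC -mulf_div divff ?expf_neq0 ?mulr1.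
Qed.

Fact laurent_eval_monoid : monoid_morphism (laurent_eval c_neq0).
Proof.
split.
  rewrite (@laurent_evalE _ 1 0%N) ?hornerC ?divr1 //.
  by rewrite rmorph1 mulr1 tofrac1.
move=> x y; have [[p m] /= hp] := laurentP x; have [[p' m'] /= hp'] := laurentP y.
rewrite (laurent_evalE hp) (laurent_evalE hp').
rewrite (@laurent_evalE _ (p * p') (m + m')%N); last first.
  by rewrite tofracM -hp -hp' exprD rmorphM /= mulrACA.
by rewrite hornerM exprD mulf_div.
Qed.

HB.instance Definition _ :=
  GRing.isZmodMorphism.Build laurent F (laurent_eval c_neq0) laurent_eval_zmod.
HB.instance Definition _ :=
  GRing.isMonoidMorphism.Build laurent F (laurent_eval c_neq0) laurent_eval_monoid.

End Evaluation.

End Laurent.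

(* Type data.  Simple roots and basis vectors are numbered from 0. *)

Inductive ctype := TypeA | TypeAstar | TypeB | TypeC | TypeD.

Definition nb_simple (ty : ctype) (n : nat) : nat :=
  match ty with TypeA | TypeAstar => n.-1 | _ => n end.

Section TypeData.
Variable n : nat.

Definition basisH (j : nat) : 'cV[int]_n := \col_(i < n) (i == j :> nat)%:R.

Definition swap (k j : nat) : nat :=
  if j == k then k.+1 else if j == k.+1 then k else j.

Definition transp_mx (k : nat) : 'M[int]_n :=
  \matrix_(i < n, j < n) (i == swap k j :> nat)%:R.

Definition neg1_mx : 'M[int]_n := diag_mx (\row_(j < n) (-1) ^+ (j == 0 :> nat)).

Definition refl_mx (ty : ctype) (i : nat) : 'M[int]_n :=
  match ty, i with
  | (TypeA | TypeAstar), _ => transp_mx i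
  | _, k.+1 => transp_mx k
  | TypeD, 0 => neg1_mx *m transp_mx 0 *m neg1_mx
  | _, 0 => neg1_mx
  end.

Definition coroot (ty : ctype) (i : nat) : 'cV[int]_n :=
  match ty, i with
  | (TypeA | TypeAstar), _ => basisH i - basisH i.+1
  | _, k.+1 => basisH k - basisH k.+1
  | TypeB, 0 => basisH 0 *+ 2
  | TypeD, 0 => basisH 0 + basisH 1
  | _, 0 => basisH 0
  end.

Definition has_order (M : 'M[int]_n) (m : nat) : Prop :=
  [/\ (0 < m)%N, M ^+ m = 1 &
      forall k : nat, (0 < k < m)%N -> M ^+ k <> 1].

(* A finite abelian torus by generators and relations: each generator is the
   element t_H of some H = tval x in the lattice, and tword H writes t_H as a
   word in the generators. *)
Record torus := Torus {
  tgen : Type;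
  tval : tgen -> 'cV[int]_n;
  tword : 'cV[int]_n -> seq tgen;
  trel : seq tgen -> seq tgen -> Prop
}.

Section Tori.
Variable d : nat.

Inductive full_rel : seq 'I_n -> seq 'I_n -> Prop :=
  | FullComm j k : full_rel [:: j; k] [:: k; j]
  | FullPow j : full_rel (nseq d j) [::].

(* t_j has order d, so that a possibly negative exponent is reduced mod d. *)
Definition full_torus : torus := {|
  tgen := 'I_n;
  tval := fun j => basisH j;
  tword := fun H => flatten [seq nseq `|(H j ord0 %% d)%Z|%N j | j <- enum 'I_n];
  trel := full_rel
|}.

(* Identifying C_d with Z/d, t_H is the diagonal matrix with entries
   zeta^(H_1), ..., zeta^(H_n), whose determinant is one if and only if d
   divides the sum of the H_j.  All the t_H with this property are taken as
   generators, with the multiplication table as relations, for the torus of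
   type A*. *)
Definition sl_lattice : {pred 'cV[int]_n} :=
  fun H => (d %| \sum_j H j ord0)%Z.

Lemma sl_lattice0 : 0 \in sl_lattice.
Proof. by rewrite unfold_in /= big1 ?dvdz0 // => j _; rewrite mxE. Qed.

Definition sl_gen : Type := {H : 'cV[int]_n | H \in sl_lattice}.
HB.instance Definition _ := SubChoice.on sl_gen.

Inductive sl_rel : seq sl_gen -> seq sl_gen -> Prop :=
  | SlMul (x y z : sl_gen) : val z = val x + val y -> sl_rel [:: x; y] [:: z]
  | SlOne (x : sl_gen) : (forall j, (d %| val x j ord0)%Z) -> sl_rel [:: x] [::].

(* tword is only used on elements of sl_lattice. *)
Definition sl_torus : torus := {|
  tgen := sl_gen;
  tval := fun x => val x;
  tword := fun H => [:: insubd (Sub 0 sl_lattice0 : sl_gen) H];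
  trel := sl_rel
|}.

End Tori.

Definition torus_of (ty : ctype) (d : nat) : torus :=
  match ty with TypeAstar => sl_torus d | _ => full_torus d end.

End TypeData.

Section Objects.
Variables (ty : ctype) (d n : nat).
Notation T := (torus_of n ty d).
Notation l := (nb_simple ty n).
Notation s := (refl_mx n ty).

Inductive gen : Type := Tg of tgen T | Xi of 'I_l.

Definition t_ (H : 'cV[int]_n) : seq gen := map Tg (tword T H).
Definition t_pow (H : 'cV[int]_n) (k : nat) : seq gen := flatten (nseq k (t_ H)).
Definition h_ (i : 'I_l) : seq gen := t_pow (coroot n ty i) d./2.

Fixpoint alternating (x y : gen) (m : nat) : seq gen :=
  if m is k.+1 then x :: alternating y x k else [::].

Inductive common_rel : seq gen -> seq gen -> Prop :=
  | RelTorus v w : trel v w -> common_rel (map Tg v) (map Tg w)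
  | RelAct i x : common_rel [:: Xi i; Tg x] (t_ (s i *m tval x) ++ [:: Xi i])
  | RelBraid (i j : 'I_l) m : has_order (s i *m s j) m ->
      common_rel (alternating (Xi i) (Xi j) m) (alternating (Xi j) (Xi i) m).

Section Algebras.
Variable R : comNzRingType.
Notation term := (aterm R gen).

Definition aword (w : seq gen) : term :=
  foldr (fun x t => AMul (AVar x) t) (ACst 1) w.

(* dinv stands for 1/d *)
Definition e_ (dinv : R) (i : 'I_l) : term :=
  AMul (ACst dinv)
    (\big[@AAdd R gen/ACst 0]_(1 <= k < d.+1) aword (t_pow (coroot n ty i) k)).

Inductive Y_rel (u dinv : R) : term -> term -> Prop :=
  | YCommon v w : common_rel v w -> Y_rel u dinv (aword v) (aword w)
  | YQuad i : Y_rel u dinv (aword [:: Xi i; Xi i])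
      (AAdd (AMul (ACst u) (aword (h_ i)))
            (AMul (AMul (ACst (1 - u)) (e_ dinv i)) (AVar (Xi i)))).

Inductive Z_rel (u : R) : term -> term -> Prop :=
  | ZCommon v w : common_rel v w -> Z_rel u (aword v) (aword w)
  | ZQuad i : Z_rel u (aword [:: Xi i; Xi i])
      (AAdd (AMul (ACst u) (aword (h_ i))) (ACst (1 - u))).

End Algebras.

Definition gword (w : seq gen) : gterm gen :=
  foldr (fun x t => GMul (GVar x) t) GOne w.

Inductive N_rel : gterm gen -> gterm gen -> Prop :=
  | NCommon v w : common_rel v w -> N_rel (gword v) (gword w)
  | NQuad i : N_rel (gword [:: Xi i; Xi i]) (gword (h_ i)).

Inductive S_rel : gterm gen -> gterm gen -> Prop :=
  | SCommon v w : common_rel v w -> S_rel (gword v) (gword w)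
  | SQuad i : S_rel (gword [:: Xi i; Xi i]) GOne.

Definition N_group := pgrp N_rel.
HB.instance Definition _ := Group.on N_group.

Definition S_group := pgrp S_rel.
HB.instance Definition _ := Group.on S_group.

Variable F : fieldType.

Definition Y_algebra :=
  palg (Y_rel (laurent_of_poly 'X) (laurent_of_poly (d%:R^-1 : F)%:P)).
HB.instance Definition _ := PzAlgebra.on Y_algebra.

Definition Z_algebra := palg (Z_rel ('X : {poly F})).
HB.instance Definition _ := PzAlgebra.on Z_algebra.

Definition ga_word (grel : gterm gen -> gterm gen -> Prop) (w : seq gen) :
    group_algebra F (pgrp grel) :=
  to_group_algebra F (pi_grp grel (gword w)).

Section ToGroup.
Variables (R : comNzRingType) (f : {rmorphism R -> F}).
Variables (rel : aterm R gen -> aterm R gen -> Prop).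
Variables (grel : gterm gen -> gterm gen -> Prop).

(* The map from the specialized algebra F (x)_R A to the group algebra F[G],
   sending 1 (x) t_j to t_j and 1 (x) xi_i to xi_i. *)
Definition spec_to_group :
    base_change f (palg rel) -> group_algebra F (pgrp grel) :=
  palg_lift (@alg_cst F _)
    (palg_lift (fun a => alg_cst (f a))
       (fun x => to_group_algebra F (pgrp_gen grel x))).

Notation cst_f := ((@alg_cst F (group_algebra F (pgrp grel))) \o f).
Notation gen_g := (fun x => to_group_algebra F (pgrp_gen grel x)).

Lemma aeval_aword w : aeval cst_f gen_g (aword R w) = ga_word grel w.
Proof.
rewrite /ga_word; elim: w => [|x w IHw] /=.
  by rewrite !rmorph1; apply/esym/pi_alg_eq/acong_rel/GaOne.
rewrite IHw pi_grpM -[_ * _]pi_algM; apply/esym/pi_alg_eq/acong_rel/GaMul.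
Qed.

Hypothesis rel_grel : forall s t, rel s t ->
  aeval cst_f gen_g s = aeval cst_f gen_g t.

Let spec_lift : palg rel -> group_algebra F (pgrp grel) :=
  palg_lift cst_f gen_g.

Let cst_fC a b : cst_f a * b = b * cst_f a.
Proof. exact: alg_cstC. Qed.

Fact base_change_spec s t : base_change_rel f s t ->
  aeval (@alg_cst F (group_algebra F (pgrp grel))) spec_lift s =
  aeval (@alg_cst F (group_algebra F (pgrp grel))) spec_lift t.
Proof.
have liftB : zmod_morphism spec_lift := palg_lift_zmod_morphism cst_fC rel_grel.
have [_ liftM] : monoid_morphism spec_lift := palg_lift_monoid_morphism cst_fC rel_grel.
have lift0 : spec_lift 0 = 0 by rewrite -[0 in LHS](subrr 0) liftB subrr.
case=> [x y|x y|a] //=.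
- rewrite -{1}[y]opprK liftB.
  by rewrite -[- y]sub0r liftB lift0 sub0r opprK.
- by rewrite /spec_lift (palg_lift_pi cst_fC rel_grel).
Qed.

Lemma spec_to_group_zmod : zmod_morphism spec_to_group.
Proof. exact: (palg_lift_zmod_morphism (@alg_cstC _ _) base_change_spec). Qed.

Lemma spec_to_group_monoid : monoid_morphism spec_to_group.
Proof. exact: (palg_lift_monoid_morphism (@alg_cstC _ _) base_change_spec). Qed.

Lemma spec_to_group_gen x :
  spec_to_group (to_base_change f (palg_gen rel x)) =
  to_group_algebra F (pgrp_gen grel x).
Proof.
rewrite /spec_to_group (palg_lift_gen (@alg_cstC _ _) base_change_spec).
exact: (palg_lift_gen cst_fC rel_grel).
Qed.

End ToGroup.

Definition Y1_to_N :
    base_change (laurent_eval (oner_neq0 F)) Y_algebra ->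
    group_algebra F N_group :=
  @spec_to_group _ _ _ N_rel.

Definition Z1_to_N :
    base_change (horner_eval (1 : F)) Z_algebra -> group_algebra F N_group :=
  @spec_to_group _ _ _ N_rel.

Definition Z0_to_S :
    base_change (horner_eval (0 : F)) Z_algebra -> group_algebra F S_group :=
  @spec_to_group _ _ _ S_rel.

(* The relations hold in the group algebras, so that spec_to_group_zmod,
   spec_to_group_monoid and spec_to_group_gen apply to the three maps. *)

Fact Y1_to_N_rel s t :
  Y_rel (laurent_of_poly 'X) (laurent_of_poly (d%:R^-1 : F)%:P) s t ->
  aeval (fun a => alg_cst (laurent_eval (oner_neq0 F) a))
    (fun x => to_group_algebra F (pgrp_gen N_rel x)) s =
  aeval (fun a => alg_cst (laurent_eval (oner_neq0 F) a))
    (fun x => to_group_algebra F (pgrp_gen N_rel x)) t.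
Proof.
have E := @aeval_aword _ (laurent_eval (oner_neq0 F)) N_rel.
case=> [v w vw|i].
  by rewrite !E; congr to_group_algebra; apply/pi_grp_eq/gcong_rel/NCommon.
rewrite -[RHS]/(_ * aeval _ _ (aword _ (h_ i)) + _ * _ * _) !E.
rewrite rmorphB rmorph1 laurent_eval_poly hornerX.
rewrite [X in 1 - X](laurent_eval_poly (oner_neq0 F)) hornerX subrr.
rewrite !rmorph0 !mul0r addr0.
rewrite rmorph1 mul1r; congr to_group_algebra.
exact/pi_grp_eq/gcong_rel/NQuad.
Qed.

Fact Z1_to_N_rel s t : Z_rel ('X : {poly F}) s t ->
  aeval (fun a => alg_cst (horner_eval 1 a))
    (fun x => to_group_algebra F (pgrp_gen N_rel x)) s =
  aeval (fun a => alg_cst (horner_eval 1 a))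
    (fun x => to_group_algebra F (pgrp_gen N_rel x)) t.
Proof.
have E := @aeval_aword _ (horner_eval (1 : F)) N_rel.
case=> [v w vw|i].
  by rewrite !E; congr to_group_algebra; apply/pi_grp_eq/gcong_rel/NCommon.
rewrite -[RHS]/(_ * aeval _ _ (aword _ (h_ i)) + _) !E.
rewrite rmorphB rmorph1 [horner_eval _ _]hornerX [X in 1 - X]hornerX.
rewrite subrr rmorph0 addr0 rmorph1 mul1r.
by congr to_group_algebra; apply/pi_grp_eq/gcong_rel/NQuad.
Qed.

Fact Z0_to_S_rel s t : Z_rel ('X : {poly F}) s t ->
  aeval (fun a => alg_cst (horner_eval 0 a))
    (fun x => to_group_algebra F (pgrp_gen S_rel x)) s =
  aeval (fun a => alg_cst (horner_eval 0 a))
    (fun x => to_group_algebra F (pgrp_gen S_rel x)) t.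
Proof.
have E := @aeval_aword _ (horner_eval (0 : F)) S_rel.
case=> [v w vw|i].
  by rewrite !E; congr to_group_algebra; apply/pi_grp_eq/gcong_rel/SCommon.
rewrite -[RHS]/(_ * aeval _ _ (aword _ (h_ i)) + _) !E.
rewrite rmorphB rmorph1 [horner_eval _ _]hornerX [X in 1 - X]hornerX.
rewrite rmorph0 mul0r add0r subr0.
transitivity (ga_word S_rel [::]); last by rewrite -E /= !rmorph1.
apply: (congr1 (to_group_algebra F)).
exact/pi_grp_eq/gcong_rel/SQuad.
Qed.

End Objects.

(* d_theta for a specialization theta : O -> F of the integral closure O of R in
   K.  Here B is the specialized algebra F (x)_R A, or the group algebra it is
   identified with, and sp : A -> B the canonical map.  The character
   d_theta chi is the F-linear form on B whose composite with sp is
   a |-> theta (chi (1 (x) a)). *)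
Section Specialization.
Variables (R : comNzRingType) (K : fieldType) (j : {rmorphism R -> K}).
Variables (A : pzAlgType R) (F : fieldType).
Variables (theta : {rmorphism integral_closure j -> F}).
Variables (B : pzAlgType F) (sp : A -> B).

Definition is_specialization (chi : base_change j A -> K) (psi : B -> F) : Prop :=
  [/\ forall x y, psi (x + y) = psi x + psi y,
      forall c x, psi (alg_cst c * x) = c * psi x &
      forall a, psi (sp a) = theta (insubd 0 (chi (to_base_change j a)))].

Definition spec_map (chi : base_change j A -> K) : B -> F :=
  xget (fun=> 0) [set psi | is_specialization chi psi].

Definition spec_well_defined : Prop :=
  forall chi, Irr (base_change j A) chi ->
    (forall a, chi (to_base_change j a) \in integralb j) /\
    exists! psi, is_specialization chi psi.

Definition spec_bijective : Prop :=
  spec_well_defined /\ set_bij (Irr (base_change j A)) (Irr B) spec_map.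

End Specialization.

Definition odd_prime_power (q : nat) : Prop :=
  odd q /\ exists p k : nat, [/\ prime p, (0 < k)%N & q = (p ^ k)%N].

Lemma odd_prime_power_invr_neq0 (F : numFieldType) (q : nat) :
  odd_prime_power q -> (q%:R^-1 : F) != 0.
Proof. by case=> q_odd _; rewrite invr_eq0 pnatr_eq0; case: q q_odd. Qed.

(* H(G, U), identified through its presentation with the specialization of
   Y_{q-1,n} at u = 1/q. *)
Definition H_algebra (F : numFieldType) (ty : ctype) (n q : nat)
    (hq : odd_prime_power q) :=
  base_change (laurent_eval (odd_prime_power_invr_neq0 F hq))
    (Y_algebra ty q.-1 n F).
HB.instance Definition _ F ty n q hq := PzAlgebra.on (@H_algebra F ty n q hq).

Section Extension.
Variables (F : fieldType) (K : splittingFieldType {fraction {poly F}}).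

Definition poly_in : {rmorphism {poly F} -> K} :=
  in_alg K \o @FracField.tofrac {poly F}.

Definition laurent_in : {rmorphism laurent F -> K} := in_alg K \o val.

Definition KY (ty : ctype) (d n : nat) :=
  base_change laurent_in (Y_algebra ty d n F).
HB.instance Definition _ ty d n := PzAlgebra.on (KY ty d n).

Definition KZ (ty : ctype) (d n : nat) :=
  base_change poly_in (Z_algebra ty d n F).
HB.instance Definition _ ty d n := PzAlgebra.on (KZ ty d n).

End Extension.

(* Main.v *)
Require Import Defs.
From HB Require Import structures.
From mathcomp Require Import all_boot all_order all_algebra.
From mathcomp Require Import all_fingroup all_field.
From mathcomp Require Import mxrepresentation.
From mathcomp Require Import boolp classical_sets functions reals.
From mathcomp Require Import complex.
From mathcomp Require Import ring zify.

Set Implicit Arguments.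
Unset Strict Implicit.
Unset Printing Implicit Defensive.

Import Order.TTheory GRing.Theory Num.Theory.
Local Open Scope ring_scope.

(** All four maps are instances of Tits' deformation theorem ([deformation]).
    Let A be an R-algebra with a finite basis, K and F fields over R, and theta
    a morphism to F from the integral closure of R in K.  If the fiber of A over
    K is split, the fiber over F is split and the trace form of its regular
    representation is nondegenerate, then theta carries the irreducible
    characters over K bijectively to those over F.  Indeed character values are
    integral by the theorem of Cayley-Hamilton.  The Gram determinant of the
    trace form does not vanish at theta, so the dual basis specializes, and with
    it the central idempotent of each irreducible character chi, whose
    coefficients are chi(1) times the values of chi on the dual basis.  The
    specialized idempotents are nonzero and orthogonal, so each of them supports
    an irreducible character over F and no character is reached twice.  Finally
    the number of irreducible characters is the same expression in the
    structure constants over K and over F ([size_Irr_seq]), whence each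
    specialized idempotent supports exactly one character, and comparing
    regular traces shows that this character is theta o chi.

    Three facts feed the theorem.

    Freeness.  Y and Z are both generated by the torus T and by elements xi_i
    with xi_i^2 = p h_i + q + r (sum_k t_{a_i}^k) xi_i.  The products
    t xi_w, with t in T and w in the Weyl group W, span by Matsumoto's theorem.
    They are independent because the algebra acts on the free R[T]-module on W
    by the expected formulas: the braid relations hold for these operators since
    they commute with the analogous right multiplications, and so are determined
    by their value at one vector ([lmul_braid]).  That W is a Coxeter group
    comes from the signs of the roots, measured by a linear form of positive
    integer weights ([weyl_coxeter]).

    Nondegeneracy at u = 1/q, 1 and 0.  There xi_i^2 = kappa g_i + b_i xi_i with
    kappa > 0, with g_i = h_i or g_i = 1, and with b_i in F[T] self-adjoint.  For
    the positive definite Hermitian form in which t xi_w has square length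
    kappa^l(w) and distinct such products are orthogonal, the adjoint of xi_i is
    g_i xi_i ([mform_lmul]).  Hence the algebra is stable under adjunction and
    the trace of a* a is positive ([gram_pos_unit]).

    Group algebras.  At u = 1 and u = 0 the squares xi_i^2 lie in T, so the
    generators are invertible and the specialized algebra is the group algebra
    of N, respectively S ([group_fiber]). *)

(** * Algebras with a finite basis *)

Section Coordinates.
Variables (R : comNzRingType) (A : pzAlgType R).

(** Coordinates in a finite basis are carried along as a function, so that
    the matrix of a multiplication can be written down directly. *)
Record coordinates N (b : 'I_N -> A) (co : A -> 'I_N -> R) : Prop := {
  coordE : forall x, x = \sum_i alg_cst (co x i) * b i;
  coord_comb : forall c i, co (\sum_j alg_cst (c j) * b j) i = c i
}.

Variables (N : nat) (b : 'I_N -> A) (co : A -> 'I_N -> R).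
Hypothesis bco : coordinates b co.

Lemma coordD x y i : co (x + y) i = co x i + co y i.
Proof.
rewrite {1}(coordE bco x) {1}(coordE bco y) -big_split /=.
under eq_bigr do rewrite -mulrDl -rmorphD.
exact: (coord_comb bco (fun j => co x j + co y j)).
Qed.

Lemma coordZ a x i : co (alg_cst a * x) i = a * co x i.
Proof.
rewrite {1}(coordE bco x) mulr_sumr.
under eq_bigr do rewrite mulrA -rmorphM.
exact: (coord_comb bco (fun j => a * co x j)).
Qed.

Lemma coord0 i : co 0 i = 0.
Proof. by have := coordZ 0 0 i; rewrite rmorph0 mul0r mul0r. Qed.

Lemma coord_sum I (r : seq I) (F : I -> A) i :
  co (\sum_(k <- r) F k) i = \sum_(k <- r) co (F k) i.
Proof.
elim/big_rec2: _ => [|k x y _ <-]; first exact: coord0.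
by rewrite coordD.
Qed.

Lemma coord_basis j i : co (b j) i = (i == j)%:R.
Proof.
rewrite -(coord_comb bco (fun i => (i == j)%:R) i); congr (co _ _).
rewrite (bigD1 j) //= eqxx rmorph1 mul1r big1 ?addr0 // => k /negPf->.
by rewrite rmorph0 mul0r.
Qed.

Lemma coord_inj x y : (forall i, co x i = co y i) -> x = y.
Proof.
by move=> xy; rewrite (coordE bco x) (coordE bco y); apply: eq_bigr => i _; rewrite xy.
Qed.

Lemma coordM x y i : co (x * y) i = \sum_j co (x * b j) i * co y j.
Proof.
rewrite {1}(coordE bco y) mulr_sumr coord_sum; apply: eq_bigr => j _.
by rewrite mulrA -alg_cstC -mulrA coordZ mulrC.
Qed.

Definition reg_mx (a : A) : 'M[R]_N := \matrix_(i, j) co (a * b j) i.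

Lemma reg_mxM x y : reg_mx (x * y) = reg_mx x *m reg_mx y.
Proof.
apply/matrixP => i j; rewrite !mxE -mulrA coordM.
by apply: eq_bigr => k _; rewrite !mxE.
Qed.

Lemma reg_mxD x y : reg_mx (x + y) = reg_mx x + reg_mx y.
Proof. by apply/matrixP => i j; rewrite !mxE mulrDl coordD. Qed.

Lemma reg_mxZ c x : reg_mx (alg_cst c * x) = c *: reg_mx x.
Proof. by apply/matrixP => i j; rewrite !mxE -mulrA coordZ. Qed.

Lemma reg_mx1 : reg_mx 1 = 1%:M.
Proof. by apply/matrixP => i j; rewrite !mxE mul1r coord_basis. Qed.

Lemma reg_mx_inj : injective reg_mx.
Proof.
move=> x y xy; rewrite -[x]mulr1 -[y]mulr1; apply: coord_inj => i.
rewrite coordM [RHS]coordM; apply: eq_bigr => j _; congr (_ * _).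
by have /matrixP/(_ i j) := xy; rewrite !mxE.
Qed.

Definition reg_tr (a : A) : R := \tr (reg_mx a).

Lemma reg_trE a : reg_tr a = \sum_j co (a * b j) j.
Proof. by apply: eq_bigr => j _; rewrite mxE. Qed.

Lemma reg_trD x y : reg_tr (x + y) = reg_tr x + reg_tr y.
Proof. by rewrite /reg_tr reg_mxD mxtraceD. Qed.

Lemma reg_trZ c x : reg_tr (alg_cst c * x) = c * reg_tr x.
Proof. by rewrite /reg_tr reg_mxZ mxtraceZ. Qed.

Lemma reg_trC x y : reg_tr (x * y) = reg_tr (y * x).
Proof. by rewrite /reg_tr !reg_mxM mxtrace_mulC. Qed.

Lemma reg_tr0 : reg_tr 0 = 0.
Proof. by have := reg_trZ 0 0; rewrite rmorph0 mul0r mul0r. Qed.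

Lemma reg_tr_sum I (r : seq I) (F : I -> A) :
  reg_tr (\sum_(k <- r) F k) = \sum_(k <- r) reg_tr (F k).
Proof.
elim/big_rec2: _ => [|k x y _ <-]; first exact: reg_tr0.
by rewrite reg_trD.
Qed.

Definition gram : 'M[R]_N := \matrix_(i, j) reg_tr (b i * b j).

Lemma gram_sym : gram^T = gram.
Proof. by apply/matrixP => i j; rewrite !mxE reg_trC. Qed.

End Coordinates.

(** * Representations of an algebra over a field *)

Section Representations.
Variables (k : fieldType) (A : pzAlgType k).

(** Representations are plain functions here, so that the degree 0 is allowed:
    the ranks of stable subspaces and of quotients are not given as successors. *)
Record arep m (rho : A -> 'M[k]_m) : Prop := {
  arepD : forall x y, rho (x + y) = rho x + rho y;
  arepM : forall x y, rho (x * y) = rho x *m rho y;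
  arep_cst : forall c, rho (alg_cst c) = c%:M
}.

Lemma arepZ m (rho : A -> 'M[k]_m) (hrho : arep rho) c x :
  rho (alg_cst c * x) = c *: rho x.
Proof. by rewrite (arepM hrho) (arep_cst hrho) mul_scalar_mx. Qed.

Lemma arep0 m (rho : A -> 'M[k]_m) (hrho : arep rho) : rho 0 = 0.
Proof. by have := arepZ hrho 0 0; rewrite rmorph0 mul0r scale0r. Qed.

Lemma arep1 m (rho : A -> 'M[k]_m) (hrho : arep rho) : rho 1 = 1%:M.
Proof. by rewrite -(arep_cst hrho) rmorph1. Qed.

Lemma arep_sum m (rho : A -> 'M[k]_m) (hrho : arep rho) I (r : seq I) (F : I -> A) :
  rho (\sum_(i <- r) F i) = \sum_(i <- r) rho (F i).
Proof.
elim/big_rec2: _ => [|i x y _ <-]; first exact: arep0.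
by rewrite (arepD hrho).
Qed.

Lemma exists_rmorph m (rho : A -> 'M[k]_m.+1) (hrho : arep rho) :
  exists M : {rmorphism A -> 'M[k]_m.+1}, M =1 rho.
Proof.
have zm : zmod_morphism rho.
  move=> x y; rewrite -[in LHS](mulN1r y) -(rmorphN1 (@alg_cst k A)).
  by rewrite (arepD hrho) (arepZ hrho) scaleN1r.
have mm : monoid_morphism rho by split=> [|x y]; [exact: arep1 | exact: arepM].
pose am := GRing.isZmodMorphism.Build _ _ _ zm.
pose mu := GRing.isMonoidMorphism.Build _ _ _ mm.
by exists (HB.pack rho am mu : {rmorphism A -> 'M[k]_m.+1}).
Qed.

Lemma arep_rmorph m (rho : {rmorphism A -> 'M[k]_m.+1}) :
  irreducible_repr rho -> arep rho.
Proof. by case=> rhoC _; split=> // x y; rewrite (rmorphD, rmorphM). Qed.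

Definition airr m (rho : A -> 'M[k]_m) : Prop :=
  forall U : 'M[k]_m, (forall a, stablemx U (rho a)) -> U = 0 \/ row_full U.

Lemma arep_Irr m (rho : A -> 'M[k]_m.+1) :
  arep rho -> airr rho -> Irr A (fun a => \tr (rho a)).
Proof.
move=> hrho irr; have [M hM] := exists_rmorph hrho.
exists m, M; split; last by apply: funext => a; rewrite hM.
split=> [c|U stU]; first by rewrite hM; exact: arep_cst.
by apply: irr => a; rewrite -hM.
Qed.

(** A representation is filtered by a stable subspace and its quotient, so its
    trace is a sum of irreducible characters. *)
Lemma trace_sum_Irr m (rho : A -> 'M[k]_m) : arep rho ->
  exists2 s : seq (A -> k), (forall chi, chi \in s -> Irr A chi) &
    forall a, \tr (rho a) = \sum_(chi <- s) chi a.
Proof.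
elim: m {-2}m (leqnn m) rho => [|M IHM] m.
  rewrite leqn0 => /eqP-> rho _; exists [::] => // a.
  by rewrite big_nil [rho a]flatmx0 mxtrace0.
case: m => [|m] lemM rho hrho.
  exists [::] => // a; by rewrite big_nil [rho a]flatmx0 mxtrace0.
have [irr|] := pselect (airr rho).
  exists [:: fun a => \tr (rho a)]; last by move=> a; rewrite big_seq1.
  by move=> chi; rewrite inE => /eqP->; exact: arep_Irr.
move=> /existsNP[U] /not_implyP[stU] /not_orP[/eqP nzU /negP nfU].
pose sub (x : A) : 'M_(\rank U) :=
  in_submod U ((val_submod 1%:M : 'M_(\rank U, m.+1)) *m rho x).
pose fact (x : A) : 'M_(\rank (cokermx U)) :=
  in_factmod U ((val_factmod 1%:M : 'M_(\rank (cokermx U), m.+1)) *m rho x).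
have subP x (W : 'M_(1, \rank U)) : val_submod (W *m sub x) = val_submod W *m rho x.
  rewrite mulmxA [W *m _]mulmxA -val_submodE in_submodK //.
  apply: submx_trans (stU x); apply: submxMr; exact: val_submodP.
have factP x (W : 'M_(1, m.+1)) : in_factmod U (W *m rho x) = in_factmod U W *m fact x.
  rewrite -{1}[W](add_sub_fact_mod U) mulmxDl linearD /=.
  apply: (canLR (subrK _)); apply: etrans (_ : 0 = _).
    apply/eqP; rewrite in_factmod_eq0.
    apply: submx_trans (stU x); apply: submxMr; exact: val_submodP.
  by rewrite /fact mulmxA [_ *m (val_factmod _ *m _)]mulmxA -val_factmodE subrr.
have factE x i : delta_mx 0 i *m fact x =
    in_factmod U (val_factmod (delta_mx 0 i : 'rV_(\rank (cokermx U))) *m rho x).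
  by rewrite factP val_factmodK.
have hsub : arep sub.
  split=> [x y|x y|c].
  - by rewrite /sub (arepD hrho) mulmxDr linearD.
  - apply/row_matrixP => i; apply: (@val_submod_inj _ _ U).
    rewrite !rowE subP mulmxA subP subP -mulmxA -(arepM hrho) //.
  - rewrite /sub (arep_cst hrho) mul_mx_scalar linearZ /= val_submodK.
    by rewrite scalemx1.
have hfact : arep fact.
  split=> [x y|x y|c].
  - by rewrite /fact (arepD hrho) mulmxDr linearD.
  - apply/row_matrixP => i; rewrite !rowE mulmxA.
    by rewrite !factE -factP -mulmxA -(arepM hrho).
  - rewrite /fact (arep_cst hrho) mul_mx_scalar linearZ /= val_factmodK.
    by rewrite scalemx1.
have rkU : (0 < \rank U < m.+1)%N.
  by rewrite lt0n mxrank_eq0 nzU /= ltn_neqAle rank_leq_row andbT.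
case/andP: rkU => rkU0 rkUm.
have [|s1 s1P s1E] := IHM _ _ sub hsub.
  by rewrite -ltnS; exact: leq_trans lemM.
have [|s2 s2P s2E] := IHM _ _ fact hfact.
  rewrite mxrank_coker -ltnS; apply: leq_trans lemM.
  by rewrite ltn_subrL rkU0.
exists (s1 ++ s2) => [chi|a].
  by rewrite mem_cat => /orP[/s1P|/s2P].
rewrite big_cat /= -s1E -s2E.
rewrite -[sub a]mulmxA mxtrace_mulC -val_submodE addrC.
rewrite -[fact a]mulmxA mxtrace_mulC -val_factmodE addrC.
by rewrite -mxtraceD add_sub_fact_mod.
Qed.

(** Schur's lemma: the kernel and the image of an intertwiner are stable, so a
    nonzero one is invertible and conjugates one representation into the other. *)
Lemma schur_neq m n (rho : A -> 'M[k]_m) (sig : A -> 'M[k]_n) (X : 'M_(m, n)) :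
    arep rho -> arep sig -> airr rho -> airr sig ->
    (forall a, rho a *m X = X *m sig a) ->
  X = 0 \/ forall a, \tr (rho a) = \tr (sig a).
Proof.
move=> hrho hsig irho isig rX.
have [|K0|Kf] := irho (kermx X).
- by move=> a; apply/sub_kermxP; rewrite -mulmxA rX mulmxA mulmx_ker mul0mx.
- have fX : row_free X by rewrite -kermx_eq0 K0.
  have [|I0|If] := isig (<<X>>%MS).
  + move=> a; rewrite (eqmxMr _ (genmxE X)) genmxE -rX.
    exact: submxMl.
  + by left; apply/eqP; rewrite -submx0 -(genmxE X) I0.
  + right=> a; have {}If : row_full X by rewrite -sub1mx -(genmxE X) sub1mx.
    have [Y XY] : exists Y, X *m Y = 1%:M by apply/row_freeP.
    have [Z ZX] : exists Z, Z *m X = 1%:M by apply/row_fullP.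
    have YZ : Y = Z by rewrite -[Y]mul1mx -ZX -mulmxA XY mulmx1.
    rewrite -[rho a]mulmx1 -XY mulmxA rX mxtrace_mulC mulmxA YZ ZX.
    by rewrite mul1mx.
- left; rewrite -[X]mul1mx; apply/sub_kermxP.
  by rewrite sub1mx.
Qed.

End Representations.

(** * Characters of a split algebra with nondegenerate trace form *)

Section SeparableAlgebra.
Variables (k : fieldType) (A : pzAlgType k).
Variables (N : nat) (b : 'I_N -> A) (co : A -> 'I_N -> k).
Hypothesis bco : coordinates b co.
Hypothesis gram_unit : gram b co \in unitmx.

Local Notation lam := (reg_tr b co).
Local Notation cst := (@alg_cst k A).

(** The basis dual to [b] for the trace form of the regular representation. *)
Definition dual_basis (j : 'I_N) : A :=
  \sum_i cst (invmx (gram b co) i j) * b i.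
Local Notation bd := dual_basis.

Lemma invgram_sym i j : invmx (gram b co) i j = invmx (gram b co) j i.
Proof.
by rewrite -[in LHS](gram_sym bco) -trmx_inv mxE.
Qed.

Lemma reg_tr_dual i j : lam (b i * bd j) = (i == j)%:R.
Proof.
rewrite mulr_sumr (reg_tr_sum bco).
have /matrixP/(_ i j) := mulmxV gram_unit; rewrite !mxE => <-.
apply: eq_bigr => l _; rewrite mulrA -alg_cstC -mulrA (reg_trZ bco).
by rewrite !mxE mulrC.
Qed.

Lemma coord_reg_tr x i : co x i = lam (x * bd i).
Proof.
rewrite {2}(coordE bco x) mulr_suml (reg_tr_sum bco) (bigD1 i) //=.
rewrite -mulrA (reg_trZ bco) reg_tr_dual eqxx mulr1 big1 ?addr0 // => j /negPf ji.
by rewrite -mulrA (reg_trZ bco) reg_tr_dual ji mulr0.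
Qed.

Lemma trace_form_nondeg y : (forall i, lam (b i * y) = 0) -> y = 0.
Proof.
move=> y0; apply: (coord_inj bco) => i; rewrite (coord0 bco) coord_reg_tr.
rewrite (reg_trC bco) /bd mulr_suml (reg_tr_sum bco) big1 // => j _.
by rewrite -mulrA (reg_trZ bco) y0 mulr0.
Qed.

Lemma dual_coordE x : x = \sum_i cst (lam (b i * x)) * bd i.
Proof.
apply/eqP; rewrite -subr_eq0; apply/eqP/trace_form_nondeg => i.
rewrite mulrBr -mulN1r -(rmorphN1 cst) (reg_trD bco) (reg_trZ bco) mulN1r.
rewrite mulr_sumr (reg_tr_sum bco) (bigD1 i) //=.
rewrite [b i * (_ * _)]mulrA -alg_cstC -mulrA (reg_trZ bco) reg_tr_dual eqxx mulr1.
rewrite big1 ?addr0 ?subrr // => j /negPf ji.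
by rewrite mulrA -alg_cstC -mulrA (reg_trZ bco) reg_tr_dual eq_sym ji mulr0.
Qed.

(** The trace of a is the sum of the diagonal coordinates of its action, which the
    dual basis reads off; so multiplying by the Casimir element preserves traces,
    and the trace form is nondegenerate. *)
Lemma casimir1 : \sum_i b i * bd i = 1.
Proof.
apply/eqP; rewrite -subr_eq0; apply/eqP/trace_form_nondeg => j.
rewrite mulrBr mulr1 -mulN1r -(rmorphN1 cst) (reg_trD bco) (reg_trZ bco) mulN1r.
apply/eqP; rewrite subr_eq0; apply/eqP.
rewrite mulr_sumr (reg_tr_sum bco) [RHS](reg_trE b co); apply: eq_bigr => i _.
by rewrite mulrA -coord_reg_tr.
Qed.

Lemma casimir1C : \sum_i bd i * b i = 1.
Proof.
rewrite -casimir1 /bd.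
under eq_bigr do rewrite mulr_suml; under [RHS]eq_bigr do rewrite mulr_sumr.
rewrite exchange_big; apply: eq_bigr => i _; apply: eq_bigr => j _.
by rewrite invgram_sym mulrA alg_cstC.
Qed.

Section Average.
Variables (m n : nat) (rho : A -> 'M[k]_m) (sig : A -> 'M[k]_n).
Hypotheses (hrho : arep rho) (hsig : arep sig).

Definition average (X : 'M[k]_(m, n)) := \sum_i rho (b i) *m X *m sig (bd i).

(** As with the average over a finite group, expanding a * b i in the basis and
    bd j * a in the dual basis gives the same coefficients. *)
Lemma average_comm X a : rho a *m average X = average X *m sig a.
Proof.
rewrite mulmx_sumr mulmx_suml.
transitivity (\sum_i \sum_j co (a * b i) j *: (rho (b j) *m X *m sig (bd i))).
  apply: eq_bigr => i _; rewrite !mulmxA -(arepM hrho) {1}(coordE bco (a * b i)).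
  rewrite (arep_sum hrho) !mulmx_suml; apply: eq_bigr => j _.
  by rewrite (arepZ hrho) -!scalemxAl.
rewrite exchange_big; apply: eq_bigr => j _.
rewrite -[RHS]mulmxA -(arepM hsig) [bd j * a]dual_coordE.
rewrite (arep_sum hsig) mulmx_sumr; apply: eq_bigr => i _.
rewrite (arepZ hsig) -scalemxAr coord_reg_tr; congr (_ *: _).
by rewrite (reg_trC bco) mulrA [RHS](reg_trC bco).
Qed.

End Average.

Hypothesis char0 : forall n, (n.+1%:R : k) != 0.
Hypothesis Asplit : split_algebra A.

(** The scalar given by Schur's lemma is found by taking traces, since the Casimir
    element is 1. *)
Lemma average_scalar m (rho : A -> 'M[k]_m.+1) (hrho : arep rho) X :
    airr rho -> average rho rho X = (\tr X / m.+1%:R)%:M.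
Proof.
move=> irr; have [M hM] := exists_rmorph hrho.
have irrM : irreducible_repr M.
  split=> [c|U stU]; first by rewrite hM (arep_cst hrho).
  by apply: irr => a; rewrite -hM.
have /is_scalar_mxP[c Ec] : is_scalar_mx (average rho rho X).
  by apply: (Asplit irrM) => a; rewrite hM; exact: average_comm.
rewrite Ec; congr (_%:M); apply: (mulIf (char0 m)); rewrite divfK //.
have := congr1 mxtrace Ec; rewrite mxtrace_scalar mulr_natr => <-.
rewrite /average raddf_sum /=.
under eq_bigr do rewrite mxtrace_mulC mulmxA -(arepM hrho).
rewrite -(raddf_sum (@mxtrace k m.+1)) /= -mulmx_suml.
by rewrite -(arep_sum hrho) casimir1C (arep1 hrho) mul1mx.
Qed.

Section IrrChar.
Variable chi : A -> k.
Hypothesis chi_irr : Irr A chi.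

Lemma IrrP : exists m (rho : A -> 'M[k]_m.+1),
  [/\ arep rho, airr rho & forall a, chi a = \tr (rho a)].
Proof.
have [m [rho [[rhoC irr] ->]]] := chi_irr.
by exists m, rho; split=> //; split=> // x y; rewrite (rmorphD, rmorphM).
Qed.

Lemma Irr1E : exists m, chi 1 = m.+1%:R.
Proof.
have [m [rho [hrho _ ->]]] := IrrP; exists m.
by rewrite (arep1 hrho) mxtrace1.
Qed.

Lemma Irr1_neq0 : chi 1 != 0.
Proof. by have [m ->] := Irr1E; exact: char0. Qed.

Lemma IrrD x y : chi (x + y) = chi x + chi y.
Proof. by have [m [rho [hrho _ E]]] := IrrP; rewrite !E (arepD hrho) mxtraceD. Qed.

Lemma IrrZ c x : chi (cst c * x) = c * chi x.
Proof. by have [m [rho [hrho _ E]]] := IrrP; rewrite !E (arepZ hrho) mxtraceZ. Qed.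

Lemma Irr0 : chi 0 = 0.
Proof. by have := IrrZ 0 0; rewrite rmorph0 mul0r mul0r. Qed.

Lemma Irr_sum I (r : seq I) (F : I -> A) :
  chi (\sum_(i <- r) F i) = \sum_(i <- r) chi (F i).
Proof.
elim/big_rec2: _ => [|i x y _ <-]; first exact: Irr0.
by rewrite IrrD.
Qed.

End IrrChar.

(** The element that represents the linear form chi 1 * chi for the trace form. *)
Definition char_idem (chi : A -> k) : A :=
  \sum_i cst (chi 1 * chi (bd i)) * b i.

Lemma reg_tr_char_idem chi a : Irr A chi ->
  lam (char_idem chi * a) = chi 1 * chi a.
Proof.
move=> hchi; rewrite mulr_suml (reg_tr_sum bco).
rewrite {2}[a]dual_coordE (Irr_sum hchi) mulr_sumr; apply: eq_bigr => i _.
by rewrite -mulrA (reg_trZ bco) (IrrZ hchi) mulrAC mulrA.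
Qed.

(** The orthogonality relations: the entries of the action of [char_idem] are
    entries of averages of elementary matrices, which are scalar for equal
    characters and vanish for distinct ones. *)
Lemma char_idem_id m (rho : A -> 'M[k]_m.+1) : arep rho -> airr rho ->
  rho (char_idem (fun a => \tr (rho a))) = 1%:M.
Proof.
move=> hrho irr; rewrite (arep_sum hrho); apply/matrixP => i j.
rewrite summxE; under eq_bigr do rewrite (arepZ hrho) mxE.
rewrite (arep1 hrho) mxtrace1.
transitivity (\sum_q m.+1%:R * (average rho rho (delta_mx j q)) i q).
  under [RHS]eq_bigr do rewrite summxE mulr_sumr.
  rewrite exchange_big; apply: eq_bigr => l _.
  rewrite -mulrA [in LHS]/mxtrace mulr_suml mulr_sumr; apply: eq_bigr => q _.
  congr (_ * _); rewrite -mulmxA mxE (bigD1 j) //= big1 => [|p /negPf pj].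
    rewrite addr0 mxE (bigD1 q) //= big1 => [|p /negPf pq].
      by rewrite mxE !eqxx mul1r addr0 mulrC.
    by rewrite mxE pq andbF mul0r.
  by rewrite mxE big1 ?mulr0 // => s _; rewrite mxE pj mul0r.
rewrite (bigD1 i) //= big1 => [|q /negPf qi].
  rewrite average_scalar // mxE eqxx mulr1n mulrC divfK // addr0 /mxtrace mxE.
  rewrite (bigD1 i) //= mxE eqxx andbT big1 => [|p /negPf pi].
    by rewrite addr0.
  by rewrite mxE pi andbF.
by rewrite average_scalar // mxE eq_sym qi mulr0.
Qed.

Lemma char_idem_neq m n (rho : A -> 'M[k]_m) (sig : A -> 'M[k]_n) :
    arep rho -> airr rho -> arep sig -> airr sig ->
    (fun a => \tr (rho a)) <> (fun a => \tr (sig a)) ->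
  rho (char_idem (fun a => \tr (sig a))) = 0.
Proof.
move=> hrho irho hsig isig neq; rewrite (arep_sum hrho); apply/matrixP => i j.
rewrite summxE; under eq_bigr do rewrite (arepZ hrho) mxE.
transitivity (\tr (sig 1) * \sum_q (average rho sig (delta_mx j q)) i q).
  under [in RHS]eq_bigr do rewrite summxE.
  rewrite exchange_big mulr_sumr; apply: eq_bigr => l _.
  rewrite -mulrA; congr (_ * _); rewrite mulr_suml; apply: eq_bigr => q _.
  rewrite -mulmxA mxE (bigD1 j) //= big1 => [|p /negPf pj].
    rewrite addr0 mxE (bigD1 q) //= big1 => [|p /negPf pq].
      by rewrite mxE !eqxx mul1r addr0 mulrC.
    by rewrite mxE pq andbF mul0r.
  by rewrite mxE big1 ?mulr0 // => s _; rewrite mxE pj mul0r.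
rewrite big1 ?mulr0 ?mxE // => q _.
have [|->|eqc] := @schur_neq _ _ _ _ _ _ (average rho sig (delta_mx j q)) hrho hsig irho isig.
- by move=> a; exact: average_comm.
- by rewrite mxE.
- by case: neq; apply: funext.
Qed.

Lemma exists_Irr_seq : exists s : seq (A -> k),
  (forall chi, chi \in s -> Irr A chi) /\ forall a, lam a = \sum_(chi <- s) chi a.
Proof.
have hreg : arep (reg_mx b co).
  split=> [x y|x y|c]; first exact: reg_mxD.
  - exact: reg_mxM.
  - by rewrite -[cst c]mulr1 (reg_mxZ bco) (reg_mx1 bco) scalemx1.
have [s sP sE] := trace_sum_Irr hreg.
by exists s.
Qed.

(** The regular trace is a sum of irreducible characters, so an element killed by
    all irreducible representations is in the kernel of the trace form. *)
Lemma Irr_faithful x :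
  (forall m (rho : A -> 'M[k]_m.+1), arep rho -> airr rho -> rho x = 0) -> x = 0.
Proof.
move=> x0; apply: trace_form_nondeg => i.
have [s [sP ->]] := exists_Irr_seq; rewrite big1_seq // => chi /= chis.
have [m [rho [hrho irr ->]]] := IrrP (sP _ chis).
by rewrite (arepM hrho) (x0 _ _ hrho irr) mulmx0 mxtrace0.
Qed.

Lemma char_idem_act m (rho : A -> 'M[k]_m.+1) chi : Irr A chi ->
    arep rho -> airr rho ->
  rho (char_idem chi) = (`[< chi = fun a => \tr (rho a) >])%:R%:M.
Proof.
move=> /IrrP[n [sig [hsig isig /funext chiE]]] hrho irho.
case: asboolP => [->|neq]; first by rewrite (char_idem_id hrho irho).
rewrite chiE in neq *; rewrite (char_idem_neq hrho irho hsig isig).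
  by apply/matrixP => i j; rewrite !mxE mul0rn.
by move=> e; apply: neq; rewrite e.
Qed.

Lemma char_idem_central chi x : Irr A chi ->
  char_idem chi * x = x * char_idem chi.
Proof.
move=> hchi; apply/eqP; rewrite -subr_eq0; apply/eqP/Irr_faithful => m rho hrho irho.
rewrite -mulN1r -(rmorphN1 cst) (arepD hrho) (arepZ hrho) !(arepM hrho).
by rewrite (char_idem_act hchi hrho irho) scalar_mxC scaleN1r subrr.
Qed.

Lemma char_idemM chi psi : Irr A chi -> Irr A psi ->
  char_idem chi * char_idem psi = if `[< chi = psi >] then char_idem chi else 0.
Proof.
move=> hchi hpsi; apply/eqP; rewrite -subr_eq0; apply/eqP/Irr_faithful => m rho hrho irho.
rewrite -mulN1r -(rmorphN1 cst) (arepD hrho) (arepZ hrho) (arepM hrho).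
rewrite (char_idem_act hchi hrho irho) (char_idem_act hpsi hrho irho).
rewrite scaleN1r -scalar_mxM.
case: (asboolP (chi = psi)) => [<-|neq].
  by rewrite (char_idem_act hchi hrho irho); case: asboolP => _; rewrite ?mulr1 ?mulr0 subrr.
rewrite (arep0 hrho) subr0.
case: asboolP => [e|]; last by rewrite mul0r -scalemx1 scale0r.
case: asboolP => [e'|]; last by rewrite mulr0 -scalemx1 scale0r.
by case: neq; rewrite e e'.
Qed.

(** In a split algebra a central element acts on an irreducible module by a
    scalar, and an idempotent scalar is 0 or 1. *)
Lemma central_idem_Irr z chi : z * z = z -> (forall x, z * x = x * z) ->
  Irr A chi -> (forall a, chi (z * a) = 0) \/ (forall a, chi (z * a) = chi a).
Proof.
move=> zz zC [m [rho [irr ->]]].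
have hrho := arep_rmorph irr.
have /is_scalar_mxP[c Ec] : is_scalar_mx (rho z).
  by apply: (Asplit irr) => a; rewrite -!(arepM hrho) zC.
have : c * c = c.
  have := congr1 rho zz; rewrite (arepM hrho) Ec -scalar_mxM.
  by move/matrixP/(_ 0 0); rewrite !mxE.
move/eqP; rewrite -subr_eq0 -{3}[c]mulr1 -mulrBr mulf_eq0 subr_eq0.
case/orP=> /eqP c01; [left|right] => a; rewrite (arepM hrho) Ec c01.
  by rewrite mul_scalar_mx scale0r mxtrace0.
by rewrite mul1mx.
Qed.

(** The multiplicity of chi in the regular trace is found by evaluating this trace
    at [char_idem chi]: it is the degree of chi. *)
Lemma Irr_seq : exists s : seq (A -> k),
  [/\ uniq s, forall chi, (chi \in s) <-> Irr A chi &
      forall a, lam a = \sum_(chi <- s) chi 1 * chi a].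
Proof.
have [s [sP sE]] := exists_Irr_seq.
have mult chi : Irr A chi -> chi 1 = (count_mem chi s)%:R.
  move=> hchi; apply: (mulfI (Irr1_neq0 hchi)).
  rewrite -{1}(reg_tr_char_idem 1 hchi) sE -sum1_count mulr1 natr_sum.
  rewrite mulr_sumr [RHS]big_mkcond /=; apply: eq_big_seq => psi /sP hpsi.
  have [m [rho [hrho irho psiE]]] := IrrP hpsi.
  rewrite psiE (char_idem_act hchi hrho irho) -(funext psiE).
  case: asboolP => [e|neq].
    by rewrite e /= eqxx mulr1 psiE (arep1 hrho).
  case: ifP => [/eqP e|_]; first by case: neq; rewrite e.
  by rewrite -scalemx1 scale0r mxtrace0.
exists (undup s); split; first exact: undup_uniq.
  move=> chi; rewrite mem_undup; split=> [/sP//|hchi].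
  rewrite -has_pred1 has_count lt0n; apply: contra_neq (Irr1_neq0 hchi) => E.
  by rewrite (mult _ hchi) E.
move=> a; rewrite sE -big_undup_iterop_count /=; apply: eq_big_seq => chi.
rewrite mem_undup => /sP hchi; rewrite (mult _ hchi).
by rewrite mulr_natl.
Qed.

(** The number of irreducible characters, that is the dimension of the center,
    is the trace of the projection onto the center given by averaging. *)
Lemma size_Irr_seq s : uniq s -> (forall chi, (chi \in s) <-> Irr A chi) ->
    (forall a, lam a = \sum_(chi <- s) chi 1 * chi a) ->
  (size s)%:R = \sum_i \sum_j lam (b i * b j * bd i * bd j).
Proof.
move=> us sP sE; rewrite -sum1_size natr_sum.
under [RHS]eq_bigr => i _ do under eq_bigr do rewrite sE.
under [RHS]eq_bigr do rewrite exchange_big.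
rewrite exchange_big /=; apply: eq_big_seq => chi /sP hchi.
have [m [rho [hrho irho chiE]]] := IrrP hchi.
rewrite exchange_big /=; under eq_bigr do rewrite -mulr_sumr.
rewrite -mulr_sumr; apply/esym.
transitivity (chi 1 * \sum_j chi (b j) / m.+1%:R * chi (bd j)).
  congr (_ * _); apply: eq_bigr => j _.
  rewrite -(Irr_sum hchi) -mulr_suml chiE (arepM hrho) (arep_sum hrho).
  under eq_bigr do rewrite !(arepM hrho).
  rewrite [X in \tr (X *m _)](average_scalar hrho _ irho) mul_scalar_mx mxtraceZ.
  by rewrite !chiE.
have E1 : chi 1 = m.+1%:R by rewrite chiE (arep1 hrho) mxtrace1.
have := char_idem_id hrho irho; rewrite -(funext chiE) => Ee.
have : chi (char_idem chi) = chi 1 by rewrite !chiE Ee (arep1 hrho).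
rewrite (Irr_sum hchi) E1 => E.
apply: (mulIf (char0 m)); rewrite mul1r -[RHS]E.
rewrite mulr_sumr mulr_suml; apply: eq_bigr => j _.
rewrite (IrrZ hchi); move: (m.+1%:R) (char0 m) => d d0; field; exact: d0.
Qed.

End SeparableAlgebra.

(** * Integrality of character values *)

Section Splitting.

Lemma dvdp_root (F : fieldType) (p q : {poly F}) x : p %| q -> root p x -> root q x.
Proof. by rewrite !root_factor_theorem => pq /dvdp_trans; apply. Qed.

Lemma irreducible_factor (F : fieldType) (p : {poly F}) : (1 < size p)%N ->
  exists2 r, irreducible_poly r & r %| p.
Proof.
elim: (size p) {-2}p (leqnn (size p)) => [|n IHn] {}p; first by case: (size p).
move=> lepn p1; have [irr|] := pselect (irreducible_poly p); first by exists p.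
move=> /not_andP[//|/existsNP[r /not_implyP[r1 /not_implyP[rp /negP nrp]]]].
have p0 : p != 0 by rewrite -size_poly_gt0 ltnW.
have r0 : r != 0 by apply: contraNneq p0 => r0; rewrite -dvd0p -r0.
have ltr : (size r < size p)%N.
  by rewrite ltn_neqAle dvdp_leq // andbT (dvdp_size_eqp rp).
have [||r' irr r'r] := IHn r; first by rewrite -ltnS; exact: leq_trans ltr lepn.
  by rewrite ltn_neqAle eq_sym r1 size_poly_gt0.
by exists r' => //; exact: dvdp_trans rp.
Qed.

(** One root is adjoined at a time. *)
Lemma splitting_extension (F : fieldType) (p : {poly F}) : p \is monic ->
  exists (L : fieldType) (iota : {rmorphism F -> L}) (rs : seq L),
    map_poly iota p = \prod_(z <- rs) ('X - z%:P).
Proof.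
have [n] := ubnP (size p); elim: n => // n IHn in F p *.
rewrite ltnS => sp mp; have [p1|p1] := leqP (size p) 1.
  exists F, idfun, [::]; rewrite big_nil map_poly_id //.
  move: mp; rewrite monicE; have /size1_polyC-> := p1.
  by rewrite lead_coefC => /eqP->.
have [r irr rp] := irreducible_factor p1.
have [L _ [z rz _]] := irredp_FAdjoin irr.
pose iota : {rmorphism F -> L} := in_alg L.
have rootz : root (map_poly iota p) z.
  by apply: dvdp_root rz; rewrite dvdp_map.
have /factor_theorem[p' Ep] := rootz.
have mp' : p' \is monic.
  have : map_poly iota p \is monic by rewrite map_monic.
  by rewrite Ep monicMr // monicXsubC.
have [|M [kappa [rs Ers]]] := IHn L p' _ mp'.
  move: (congr1 (size \o @polyseq L) Ep) => /=.
  rewrite size_map_poly size_Mmonic ?monicXsubC ?monic_neq0 //.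
  by rewrite size_XsubC addn2 /= => E; rewrite -E.
exists M, (kappa \o iota), (kappa z :: rs).
rewrite map_poly_comp Ep rmorphM /= Ers big_cons mulrC.
by rewrite rmorphB /= map_polyX map_polyC.
Qed.

End Splitting.

(** A matrix annihilated by a monic polynomial with coefficients in R has its
    eigenvalues, hence its trace, integral over R. *)
Lemma integral_mxtrace (R : comNzRingType) (K : fieldType)
    (j : {rmorphism R -> K}) m (M : 'M[K]_m.+1) (p : {poly R}) :
  p \is monic -> horner_mx M (map_poly j p) = 0 -> \tr M \in integralb j.
Proof.
move=> mp pM0; have [L [iota [rs Ers]]] := splitting_extension (char_poly_monic M).
have size_rs : size rs = m.+1.
  have := congr1 (size \o @polyseq L) Ers => /=.
  by rewrite size_map_poly size_char_poly size_prod_XsubC => -[].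
have int_rs z : z \in rs -> z \in integralb (iota \o j).
  move=> zrs; apply/asboolP; exists p => //.
  have rz : root (char_poly (map_mx iota M)) z.
    by rewrite -map_char_poly Ers root_prod_XsubC.
  rewrite -eigenvalue_root_char eigenvalue_root_min in rz.
  apply: dvdp_root rz; apply: mxminpoly_min.
  by rewrite map_poly_comp -map_horner_mx pM0 map_mx0.
have Etr : iota (\tr M) = \sum_(z <- rs) z.
  apply: oppr_inj; rewrite -coefPn_prod_XsubC ?size_rs //.
  by rewrite -Ers coef_map char_poly_trace // raddfN.
have /asboolP[r mr] : iota (\tr M) \in integralb (iota \o j).
  by rewrite Etr big_seq rpred_sum.
by rewrite map_poly_comp fmorph_root => rr; apply/asboolP; exists r.
Qed.

(** * Fibers of an algebra *)

Section Fibers.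
Variables (R : comNzRingType) (A : pzAlgType R).
Variables (N : nat) (b : 'I_N -> A) (co : A -> 'I_N -> R).
Hypothesis bco : coordinates b co.

(** [B] is obtained from [A] by extending scalars along [f], expressed through
    a basis of [A]. *)
Record fiber (F : comNzRingType) (f : R -> F) (B : pzAlgType F) (sp : A -> B)
    (coB : B -> 'I_N -> F) : Prop := {
  fiber_coord : coordinates (fun i => sp (b i)) coB;
  fiberE : forall a i, coB (sp a) i = f (co a i);
  fiberM : forall x y, sp (x * y) = sp x * sp y;
  fiber1 : sp 1 = 1
}.

Section Fiber.
Variables (F : comNzRingType) (f : {rmorphism R -> F}) (B : pzAlgType F).
Variables (sp : A -> B) (coB : B -> 'I_N -> F).
Hypothesis hB : fiber f sp coB.
Let spb i := sp (b i).

Lemma fiberD x y : sp (x + y) = sp x + sp y.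
Proof.
apply: (coord_inj (fiber_coord hB)) => i.
by rewrite (coordD (fiber_coord hB)) !(fiberE hB) (coordD bco) rmorphD.
Qed.

Lemma fiberZ k x : sp (alg_cst k * x) = alg_cst (f k) * sp x.
Proof.
apply: (coord_inj (fiber_coord hB)) => i.
by rewrite (coordZ (fiber_coord hB)) !(fiberE hB) (coordZ bco) rmorphM.
Qed.

Lemma fiber0 : sp 0 = 0.
Proof. by apply: (addrI (sp 0)); rewrite -fiberD !addr0. Qed.

Lemma fiber_sum I (r : seq I) (G : I -> A) :
  sp (\sum_(i <- r) G i) = \sum_(i <- r) sp (G i).
Proof. exact: (big_morph sp fiberD fiber0). Qed.

Lemma fiber_prod I (r : seq I) (G : I -> A) :
  sp (\prod_(i <- r) G i) = \prod_(i <- r) sp (G i).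
Proof. exact: (big_morph sp (fiberM hB) (fiber1 hB)). Qed.

Lemma fiberX x k : sp (x ^+ k) = sp x ^+ k.
Proof. by elim: k => [|k IHk]; rewrite ?(fiber1 hB) // !exprS (fiberM hB) IHk. Qed.

Lemma fiber_reg_mx a : reg_mx spb coB (sp a) = map_mx f (reg_mx b co a).
Proof. by apply/matrixP => i k; rewrite !mxE -(fiberM hB) (fiberE hB). Qed.

Lemma fiber_reg_tr a : reg_tr spb coB (sp a) = f (reg_tr b co a).
Proof. by rewrite /reg_tr fiber_reg_mx trace_map_mx. Qed.

Lemma fiber_gram : gram spb coB = map_mx f (gram b co).
Proof. by apply/matrixP => i k; rewrite !mxE -(fiberM hB) fiber_reg_tr. Qed.

End Fiber.
End Fibers.

(** * Specialization along a place *)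

Section Place.
Variables (R : comNzRingType) (K F : fieldType) (j : {rmorphism R -> K}).
Variable theta : {rmorphism integral_closure j -> F}.
Local Notation O := (integral_closure j).

Let valD (a c : O) : val (a + c) = val a + val c. Proof. exact: rmorphD. Qed.
Let valM (a c : O) : val (a * c) = val a * val c. Proof. exact: rmorphM. Qed.

(** The extension of [theta] to the localization of the integral closure at its
    kernel, as a functional relation: [y] is the value of [theta] at [x]. *)
Definition place (x : K) (y : F) : Prop :=
  exists a c : O, [/\ theta c != 0, x * val c = val a & y * theta c = theta a].

Lemma place_int (a : O) : place (val a) (theta a).
Proof. by exists a, 1; rewrite rmorph1 oner_neq0 !mulr1. Qed.

Lemma place_fun x y y' : place x y -> place x y' -> y = y'.
Proof.
move=> [a [c [c0 xc yc]]] [a' [c' [c'0 xc' yc']]].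
have E : a * c' = c * a' by apply: val_inj; rewrite !valM -xc -xc'; ring.
apply: (mulIf (mulf_neq0 c0 c'0)).
by rewrite mulrA yc mulrCA yc' -!rmorphM E.
Qed.

Lemma placeD x y x' y' : place x y -> place x' y' -> place (x + x') (y + y').
Proof.
move=> [a [c [c0 xc yc]]] [a' [c' [c'0 xc' yc']]].
exists (a * c' + a' * c), (c * c').
split; first by rewrite rmorphM mulf_neq0.
  rewrite valD !valM -xc -xc'; ring.
rewrite rmorphD !rmorphM /= -yc -yc'; ring.
Qed.

Lemma placeM x y x' y' : place x y -> place x' y' -> place (x * x') (y * y').
Proof.
move=> [a [c [c0 xc yc]]] [a' [c' [c'0 xc' yc']]].
exists (a * a'), (c * c').
split; first by rewrite rmorphM mulf_neq0.
  rewrite !valM -xc -xc'; ring.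
rewrite !rmorphM /= -yc -yc'; ring.
Qed.

Lemma place0 : place 0 0.
Proof. by have := place_int 0; rewrite !rmorph0. Qed.

Lemma place_nat n : place n%:R n%:R.
Proof. by have := place_int n%:R; rewrite !rmorph_nat. Qed.

Lemma place_sum I (r : seq I) (G : I -> K) (H : I -> F) :
  (forall i, place (G i) (H i)) -> place (\sum_(i <- r) G i) (\sum_(i <- r) H i).
Proof.
move=> GH; apply: (big_rec2 place); first exact: place0.
by move=> i x y _ xy; exact: placeD.
Qed.

Lemma place_neq0 x y : place x y -> y != 0 -> x != 0.
Proof.
move=> xy; apply: contra_neq => x0; apply: place_fun xy _.
by rewrite x0; exact: place0.
Qed.

Lemma placeV x y : place x y -> y != 0 -> place x^-1 y^-1.
Proof.
move=> xy y0; have x0 := place_neq0 xy y0; case: xy => a [c [c0 xc yc]].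
exists c, a; split; first by rewrite -yc mulf_neq0.
  by rewrite -xc mulKf.
by rewrite -yc mulKf.
Qed.

End Place.

Section Deformation.
Variables (R : comNzRingType) (K F : fieldType) (j : {rmorphism R -> K}).
Variable f : {rmorphism R -> F}.
Variable theta : {rmorphism integral_closure j -> F}.
Hypothesis thetaE : forall a, theta (to_integral_closure j a) = f a.
Local Notation pl := (place theta).

Variables (A : pzAlgType R) (N : nat) (b : 'I_N.+1 -> A) (co : A -> 'I_N.+1 -> R).
Hypothesis bco : coordinates b co.

Local Notation AK := (base_change j A).
Local Notation spK := (@to_base_change R K j A).
Variable coK : AK -> 'I_N.+1 -> K.
Hypothesis hK : fiber b co j spK coK.

Variables (AF : pzAlgType F) (spF : A -> AF) (coF : AF -> 'I_N.+1 -> F).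
Hypothesis hF : fiber b co f spF coF.

Hypothesis K_char0 : forall n, (n.+1%:R : K) != 0.
Hypothesis F_char0 : forall n, (n.+1%:R : F) != 0.
Hypothesis K_split : split_algebra AK.
Hypothesis F_split : split_algebra AF.
Local Notation bK := (fun i => spK (b i)).
Local Notation bF := (fun i => spF (b i)).
Hypothesis gramF_unit : gram bF coF \in unitmx.

Let cK := fiber_coord hK.
Let cF := fiber_coord hF.

Lemma place_base a : pl (j a) (f a).
Proof. by rewrite -thetaE; exact: place_int (to_integral_closure j a). Qed.

Let detF : f (\det (gram b co)) != 0.
Proof. by move: gramF_unit; rewrite unitmxE unitfE (fiber_gram hF) det_map_mx. Qed.

Lemma gramK_unit : gram bK coK \in unitmx.
Proof.
rewrite unitmxE unitfE (fiber_gram hK) det_map_mx.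
exact: place_neq0 (place_base _) detF.
Qed.

(** [y] is the specialization of [x], coordinate by coordinate. *)
Definition related (x : AK) (y : AF) : Prop := forall i, pl (coK x i) (coF y i).

Lemma related_sp a : related (spK a) (spF a).
Proof. by move=> i; rewrite (fiberE hK) (fiberE hF); exact: place_base. Qed.

Lemma related_fun x y y' : related x y -> related x y' -> y = y'.
Proof. by move=> xy xy'; apply: (coord_inj cF) => i; exact: place_fun (xy i) (xy' i). Qed.

Lemma related_comb c c' : (forall i, pl (c i) (c' i)) ->
  related (\sum_i alg_cst (c i) * bK i) (\sum_i alg_cst (c' i) * bF i).
Proof. by move=> cc' i; rewrite (coord_comb cK) (coord_comb cF). Qed.

Lemma related0 : related 0 0.
Proof. by move=> i; rewrite (coord0 cK) (coord0 cF); exact: place0. Qed.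

Lemma relatedM x y x' y' : related x y -> related x' y' -> related (x * x') (y * y').
Proof.
move=> xy xy' i; rewrite (coordM cK) (coordM cF).
apply: place_sum => l; apply: placeM => //.
rewrite {1}(coordE cK x) {1}(coordE cF y) !mulr_suml (coord_sum cK) (coord_sum cF).
apply: place_sum => m; rewrite -!mulrA (coordZ cK) (coordZ cF); apply: placeM => //.
by rewrite -(fiberM hK) -(fiberM hF); exact: related_sp.
Qed.

Lemma related_reg_tr x y : related x y -> pl (reg_tr bK coK x) (reg_tr bF coF y).
Proof.
move=> xy; rewrite (reg_trE bK coK) (reg_trE bF coF); apply: place_sum => i.
by apply: relatedM => //; exact: related_sp.
Qed.

Lemma place_invgram i l :
  pl (invmx (gram bK coK) i l) (invmx (gram bF coF) i l).
Proof.
rewrite /invmx gramK_unit gramF_unit (fiber_gram hK) (fiber_gram hF).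
rewrite !det_map_mx -!map_mx_adj !mxE.
apply: placeM (place_base _); exact: placeV (place_base _) detF.
Qed.

Lemma related_dual i : related (dual_basis bK coK i) (dual_basis bF coF i).
Proof. by apply: related_comb => l; exact: place_invgram. Qed.

Section Values.
Variable chi : AK -> K.
Hypothesis chi_irr : Irr AK chi.

(** Character values on [A] are integral: by Cayley-Hamilton, [a] is a root of
    the characteristic polynomial of its action on [A]. *)
Lemma Irr_integral a : chi (spK a) \in integralb j.
Proof.
have [m [rho [hrho irr ->]]] := IrrP chi_irr.
pose p := char_poly (reg_mx b co a).
apply: (@integral_mxtrace _ _ _ _ _ p); first exact: char_poly_monic.
pose ev := \sum_(i < size p) alg_cst (p`_i) * a ^+ i.
have regX i : reg_mx b co (a ^+ i) = reg_mx b co a ^+ i.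
  by elim: i => [|i IHi]; rewrite ?expr0 ?(reg_mx1 bco) // !exprS (reg_mxM bco) IHi.
have evM q : reg_mx b co (\sum_(i < q) alg_cst (p`_i) * a ^+ i) =
    \sum_(i < q) p`_i *: (reg_mx b co a) ^+ i.
  elim: q => [|q IHq].
    rewrite !big_ord0; apply/matrixP => s t.
    by rewrite !mxE mul0r (coord0 bco).
  by rewrite !big_ord_recr /= (reg_mxD bco) IHq (reg_mxZ bco) regX.
have ev0 : ev = 0.
  apply: (reg_mx_inj bco); rewrite evM.
  have -> : \sum_(i < size p) p`_i *: reg_mx b co a ^+ i = horner_mx (reg_mx b co a) p.
    rewrite -[in RHS](coefK p) poly_def raddf_sum; apply: eq_bigr => i _ /=.
    by rewrite linearZ /= rmorphXn /= horner_mx_X.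
  rewrite Cayley_Hamilton; apply/matrixP => s t.
  by rewrite !mxE mul0r (coord0 bco).
have spev : \sum_(i < size p) alg_cst (j p`_i) * spK a ^+ i = 0.
  rewrite -[RHS](fiber0 bco hK) -ev0 (fiber_sum bco hK); apply: eq_bigr => i _.
  by rewrite (fiberZ bco hK) (fiberX hK).
have := congr1 rho spev; rewrite (arep0 hrho) (arep_sum hrho) => E.
have -> : map_poly j p = \sum_(i < size p) j p`_i *: 'X^i.
  rewrite -{1}(coefK p) poly_def raddf_sum; apply: eq_bigr => i _ /=.
  by rewrite linearZ /= map_polyXn.
rewrite raddf_sum -[RHS]E; apply: eq_bigr => i _ /=.
rewrite linearZ /= rmorphXn /= horner_mx_X (arepZ hrho); congr (_ *: _).
elim: (nat_of_ord i) => [|q IHq]; first by rewrite !expr0 (arep1 hrho).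
by rewrite !exprS IHq (arepM hrho).
Qed.

Local Notation thchi a := (theta (insubd 0 (chi (spK a)))).

Lemma place_Irr a : pl (chi (spK a)) (thchi a).
Proof.
have := place_int theta (insubd 0 (chi (spK a))).
by rewrite val_insubd Irr_integral.
Qed.

(** The coefficients of the idempotent involve, besides values of chi, only the
    inverse of the Gram matrix, whose determinant does not vanish at theta. *)
Lemma exists_related_idem : exists y : AF, related (char_idem bK coK chi) y.
Proof.
pose c' i := thchi 1 * \sum_l invmx (gram bF coF) l i * thchi (b l).
exists (\sum_i alg_cst (c' i) * bF i); apply: related_comb => i.
apply: placeM; first by rewrite -(fiber1 hK); exact: place_Irr.
rewrite (Irr_sum chi_irr); apply: place_sum => l.
by rewrite (IrrZ chi_irr); apply: placeM (place_invgram _ _) (place_Irr _).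
Qed.

Lemma exists_unique_specialization :
  exists! psi : AF -> F, is_specialization theta spF chi psi.
Proof.
have thchi_comb a : thchi a = \sum_i f (co a i) * thchi (b i).
  apply: place_fun (place_Irr a) _.
  have -> : chi (spK a) = \sum_i j (co a i) * chi (spK (b i)).
    rewrite {1}(coordE cK (spK a)) (Irr_sum chi_irr); apply: eq_bigr => i _.
    by rewrite (IrrZ chi_irr) (fiberE hK).
  by apply: place_sum => i; apply: placeM (place_base _) (place_Irr _).
exists (fun x => \sum_i coF x i * thchi (b i)); split.
  split=> [x y|c x|a].
  - by rewrite -big_split; apply: eq_bigr => i _; rewrite (coordD cF) mulrDl.
  - by rewrite mulr_sumr; apply: eq_bigr => i _; rewrite (coordZ cF) mulrA.
  - by rewrite thchi_comb; apply: eq_bigr => i _; rewrite (fiberE hF).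
move=> psi [psiD psiZ psiE]; apply: funext => x.
rewrite [in RHS](coordE cF x).
have psi_sum (c : 'I_N.+1 -> F) (r : seq 'I_N.+1) : psi (\sum_(i <- r) alg_cst (c i) * bF i) =
    \sum_(i <- r) c i * psi (bF i).
  elim/big_rec2: _ => [|i y1 y2 _ E]; last by rewrite psiD E psiZ.
  by have := psiZ 0 0; rewrite rmorph0 mul0r mul0r.
by rewrite psi_sum; apply: eq_bigr => i _; rewrite psiE.
Qed.

Lemma specialization_basis psi :
    Irr AF psi -> (forall i, psi (spF (b i)) = thchi (b i)) ->
  is_specialization theta spF chi psi.
Proof.
move=> hpsi E; have [phi [[phiD phiZ phiE] _]] := exists_unique_specialization.
split=> [x y|c x|a]; [exact: (IrrD hpsi) | exact: (IrrZ hpsi) |].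
rewrite -phiE (coordE cF (spF a)) (Irr_sum hpsi).
have phi_sum (c : 'I_N.+1 -> F) (r : seq 'I_N.+1) : phi (\sum_(i <- r) alg_cst (c i) * bF i) =
    \sum_(i <- r) c i * phi (bF i).
  elim/big_rec2: _ => [|i y1 y2 _ E']; last by rewrite phiD E' phiZ.
  by have := phiZ 0 0; rewrite rmorph0 mul0r mul0r.
by rewrite phi_sum; apply: eq_bigr => i _; rewrite (IrrZ hpsi) E phiE.
Qed.

End Values.

Let natF_inj m n : (m%:R : F) = n%:R -> m = n.
Proof.
have lt_neq p q : (p < q)%N -> (p%:R : F) <> q%:R.
  move=> pq; rewrite -(subnKC pq) addSnnS natrD => /esym/eqP.
  by rewrite -subr_eq0 addrAC subrr add0r (negPf (F_char0 _)).
by case: (ltngtP m n) => [/lt_neq|/lt_neq/nesym|].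
Qed.

Let sK := sval (cid (Irr_seq cK gramK_unit K_char0 K_split)).
Let sF := sval (cid (Irr_seq cF gramF_unit F_char0 F_split)).

Let sKP : [/\ uniq sK, forall chi, (chi \in sK) <-> Irr AK chi &
  forall a, reg_tr bK coK a = \sum_(chi <- sK) chi 1 * chi a].
Proof. exact: svalP (cid (Irr_seq cK gramK_unit K_char0 K_split)). Qed.

Let sFP : [/\ uniq sF, forall psi, (psi \in sF) <-> Irr AF psi &
  forall a, reg_tr bF coF a = \sum_(psi <- sF) psi 1 * psi a].
Proof. exact: svalP (cid (Irr_seq cF gramF_unit F_char0 F_split)). Qed.

(** [size_Irr_seq] writes both numbers as traces of products of basis and dual
    basis elements, which correspond to each other; natural numbers are fixed by
    theta. *)
Lemma size_Irr_eq : size sK = size sF.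
Proof.
have [uK mK lK] := sKP; have [uF mF lF] := sFP.
apply: natF_inj; apply: (place_fun (place_nat theta (size sK))).
rewrite (size_Irr_seq cK gramK_unit K_char0 K_split uK mK lK).
rewrite (size_Irr_seq cF gramF_unit F_char0 F_split uF mF lF).
apply: place_sum => i; apply: place_sum => l; apply: related_reg_tr.
by do !apply: relatedM; try exact: related_sp; exact: related_dual.
Qed.

(** [psi] occurs in the specialization of the central idempotent of [chi]. *)
Definition linked (chi : AK -> K) (psi : AF -> F) : Prop :=
  exists2 y, related (char_idem bK coK chi) y & forall a, psi (y * a) = psi a.

Let eK := char_idem bK coK.
Let eK_central chi x : Irr AK chi -> eK chi * x = x * eK chi.
Proof. exact: char_idem_central cK gramK_unit K_char0 K_split chi x. Qed.

Let eK_M chi chi' : Irr AK chi -> Irr AK chi' ->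
  eK chi * eK chi' = if `[< chi = chi' >] then eK chi else 0.
Proof. exact: char_idemM cK gramK_unit K_char0 K_split chi chi'. Qed.

Lemma related_idem_Irr chi y psi : Irr AK chi -> related (eK chi) y -> Irr AF psi ->
  (forall a, psi (y * a) = 0) \/ (forall a, psi (y * a) = psi a).
Proof.
move=> hchi ey hpsi; apply: (central_idem_Irr F_split) => // [|x].
  apply: related_fun (relatedM ey ey) _.
  by rewrite eK_M // asboolT.
rewrite (coordE cF x) mulr_sumr mulr_suml; apply: eq_bigr => i _.
rewrite mulrA -alg_cstC -mulrA -[RHS]mulrA; congr (_ * _).
apply: related_fun (relatedM ey (related_sp (b i))) _.
by rewrite eK_central //; apply: relatedM ey; exact: related_sp.
Qed.

(** If no character were linked to chi, the specialized idempotent would vanish by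
    nondegeneracy, but its regular trace is the square of the degree of chi. *)
Lemma exists_linked chi : Irr AK chi -> exists2 psi, psi \in sF & linked chi psi.
Proof.
move=> hchi; have [uF mF lF] := sFP.
have [y ey] := exists_related_idem hchi.
have [//|none] := pselect (exists2 psi, psi \in sF & linked chi psi).
have y0 : y = 0.
  apply: (trace_form_nondeg cF gramF_unit) => i.
  rewrite (reg_trC cF) lF big1_seq // => psi /= psiF.
  have hpsi : Irr AF psi by apply/mF.
  have [->|yid] := related_idem_Irr hchi ey hpsi; first by rewrite mulr0.
  by case: none; exists psi => //; exists y.
have := related_reg_tr ey; rewrite y0 (reg_tr0 cF) -[char_idem _ _ _]mulr1.
rewrite (reg_tr_char_idem cK gramK_unit _ hchi).
have [m ->] := Irr1E hchi => E.
have := place_fun E (placeM (place_nat theta m.+1) (place_nat theta m.+1)).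
by move/esym/eqP; rewrite mulf_eq0 orbb (negPf (F_char0 m)).
Qed.

(** The idempotents of distinct characters are orthogonal, and so are their
    specializations. *)
Lemma linked_inj chi chi' psi : Irr AK chi -> Irr AK chi' -> Irr AF psi ->
  linked chi psi -> linked chi' psi -> chi = chi'.
Proof.
move=> hchi hchi' hpsi [y ey yid] [y' ey' yid'].
have [//|neq] := pselect (chi = chi').
have : y * y' = 0.
  apply: related_fun (relatedM ey ey') _.
  rewrite -/(eK chi) -/(eK chi') eK_M // asboolF //; exact: related0.
move=> yy'; have := Irr1_neq0 F_char0 hpsi.
by rewrite -yid' -yid mulrA yy' mul0r (Irr0 hpsi) eqxx.
Qed.

Let linked_char (chi : AK -> K) : AF -> F :=
  if pselect (exists2 psi, psi \in sF & linked chi psi) is left e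
  then s2val (cid2 e) else fun=> 0.

Let linked_charP chi : Irr AK chi -> linked_char chi \in sF /\ linked chi (linked_char chi).
Proof.
move=> hchi; rewrite /linked_char; case: pselect => [e|[]]; last exact: exists_linked.
by case: (cid2 e).
Qed.

Let linked_char_inj : {in sK &, injective linked_char}.
Proof.
have [_ mK _] := sKP; have [_ mF _] := sFP.
move=> chi chi' /mK hchi /mK hchi' E.
have [gF l] := linked_charP hchi; have [_ l'] := linked_charP hchi'.
by apply: (linked_inj hchi hchi' _ l); [apply/mF | rewrite E].
Qed.

(** There are as many irreducible characters on both sides, so linking is a
    bijection. *)
Let linked_char_onto : map linked_char sK =i sF.
Proof.
have [uK mK _] := sKP; have [_ mF _] := sFP.
have ug : uniq (map linked_char sK) by rewrite map_inj_in_uniq.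
have sub : {subset map linked_char sK <= sF}.
  by move=> _ /mapP[chi /mK /linked_charP[] ? _ ->].
by have [|_] := uniq_min_size ug sub; first by rewrite size_map size_Irr_eq.
Qed.

(** Only one character is linked to chi, so the regular trace of a multiple of the
    specialized idempotent involves it alone: psi 1 * psi a is the specialization
    of chi 1 * chi a.  At a = 1 the degrees agree. *)
Lemma linked_specialization chi : Irr AK chi ->
  is_specialization theta spF chi (linked_char chi).
Proof.
move=> hchi; have [uK mK _] := sKP; have [uF mF lF] := sFP.
have [gF [y ey yid]] := linked_charP hchi.
have hg : Irr AF (linked_char chi) by apply/mF.
have trg a : reg_tr bF coF (y * a) = linked_char chi 1 * linked_char chi a.
  rewrite lF (bigD1_seq (linked_char chi)) //= yid big1_seq ?addr0 // => psi /andP[neq psiF].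
  have hpsi : Irr AF psi by apply/mF.
  have [->|yid'] := related_idem_Irr hchi ey hpsi; first by rewrite mulr0.
  move: psiF; rewrite -linked_char_onto => /mapP[chi' /mK hchi' E].
  case/eqP: neq; rewrite E; congr linked_char; apply: (linked_inj hchi' hchi hpsi).
    by rewrite E; have [] := linked_charP hchi'.
  by exists y.
have pl_tr a : pl (chi 1 * chi (spK a)) (linked_char chi 1 * linked_char chi (spF a)).
  rewrite -trg -(reg_tr_char_idem cK gramK_unit _ hchi).
  by apply: related_reg_tr; apply: relatedM ey (related_sp a).
have [m Em] := Irr1E hchi; have [n En] := Irr1E hg.
have mn : m = n.
  have := pl_tr 1; rewrite (fiber1 hK) (fiber1 hF) Em En => E.
  have := place_fun E (placeM (place_nat theta m.+1) (place_nat theta m.+1)).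
  by rewrite -!natrM => /natF_inj; nia.
apply: specialization_basis => // i.
apply: (mulfI (Irr1_neq0 F_char0 hg)).
apply: place_fun (pl_tr _) _; rewrite Em En mn.
exact: placeM (place_nat _ _) (place_Irr hchi _).
Qed.

Lemma spec_mapE chi : Irr AK chi -> spec_map theta spF chi = linked_char chi.
Proof.
move=> hchi; have [psi [hpsi uni]] := exists_unique_specialization hchi.
rewrite -(uni _ (linked_specialization hchi)); apply: xget_unique => // phi hphi.
by rewrite -(uni _ hphi).
Qed.

(** Tits' deformation theorem: the specialization of chi is the irreducible
    character linked to chi. *)
Theorem deformation : spec_bijective theta spF.
Proof.
have [uK mK _] := sKP; have [uF mF lF] := sFP.
split=> [chi hchi|].
  by split; [move=> a; exact: Irr_integral | exact: exists_unique_specialization].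
split.
- by move=> chi hchi /=; rewrite spec_mapE //; apply/mF; have [] := linked_charP hchi.
- move=> chi chi'; rewrite !inE => hchi hchi'; rewrite !spec_mapE //.
  by apply: linked_char_inj; apply/mK.
- move=> psi /mF; rewrite -linked_char_onto => /mapP[chi /mK hchi ->].
  by exists chi => //; rewrite spec_mapE.
Qed.

End Deformation.

(** * Presented algebras and their specializations *)

Section PresentedInduction.
Variables (R : comNzRingType) (X : Type) (rel : aterm R X -> aterm R X -> Prop).

Lemma palg_gen_ind (P : palg rel -> Prop) :
    (forall x, P (palg_gen rel x)) -> (forall c, P (alg_cst c)) ->
    (forall x y, P x -> P y -> P (x + y)) -> (forall x y, P x -> P y -> P (x * y)) ->
  forall x, P x.
Proof.
move=> Pg Pc PD PM; elim/palg_ind; elim=> [x|c|s IHs t IHt|s IHs t IHt].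
- exact: Pg.
- exact: (Pc c).
- by rewrite pi_algD; exact: PD.
- by rewrite pi_algM; exact: PM.
Qed.

End PresentedInduction.

(** The eigenspaces of an intertwiner are stable. *)
Lemma split_closed (F : numClosedFieldType) (A : pzAlgType F) : split_algebra A.
Proof.
move=> m rho [_ irr] B BC.
have [a Ba] := eigenvalue_closed B (ltn0Sn m).
have [|E|full] := irr (eigenspace B a).
- move=> x; apply/sub_kermxP; rewrite -mulmxA mulmxBr BC scalar_mxC -mulmxBl mulmxA.
  by rewrite mulmx_ker mul0mx.
- by move: Ba; rewrite /eigenvalue E eqxx.
- apply/is_scalar_mxP; exists a; apply/eqP; rewrite -subr_eq0 -[_ - _]mul1mx.
  by apply/eqP/sub_kermxP; rewrite sub1mx.
Qed.

Section BaseChangeBasis.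
Variables (R S : comNzRingType) (f : {rmorphism R -> S}) (A : pzAlgType R).
Local Notation AS := (base_change f A).
Local Notation sp := (@to_base_change R S f A).

Lemma to_base_changeD x y : sp (x + y) = sp x + sp y.
Proof. by rewrite -[RHS]pi_algD; apply/pi_alg_eq/acong_rel/BcAdd. Qed.

Lemma to_base_changeM x y : sp (x * y) = sp x * sp y.
Proof. by rewrite -[RHS]pi_algM; apply/pi_alg_eq/acong_rel/BcMul. Qed.

Lemma to_base_change_cst c : sp (alg_cst c) = alg_cst (f c).
Proof. exact/pi_alg_eq/acong_rel/BcCst. Qed.

Lemma to_base_change1 : sp 1 = 1.
Proof. by rewrite -(rmorph1 (@alg_cst R A)) to_base_change_cst !rmorph1. Qed.

Lemma to_base_change0 : sp 0 = 0.
Proof. by rewrite -(rmorph0 (@alg_cst R A)) to_base_change_cst !rmorph0. Qed.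

Lemma to_base_change_sum I (r : seq I) (G : I -> A) :
  sp (\sum_(i <- r) G i) = \sum_(i <- r) sp (G i).
Proof.
elim/big_rec2: _ => [|i x y _ <-]; first exact: to_base_change0.
exact: to_base_changeD.
Qed.

Variables (N : nat) (b : 'I_N.+1 -> A) (co : A -> 'I_N.+1 -> R).
Hypothesis bco : coordinates b co.

Let base_change_span (x : AS) : exists c, x = \sum_i alg_cst (c i) * sp (b i).
Proof.
have spE a : sp a = \sum_i alg_cst (f (co a i)) * sp (b i).
  rewrite {1}(coordE bco a) to_base_change_sum; apply: eq_bigr => i _.
  by rewrite to_base_changeM to_base_change_cst.
elim/palg_gen_ind: x => [a|c|x y [c ->] [c' ->]|x y [c ->] [c' ->]].
- by exists (fun i => f (co a i)); exact: spE.
- exists (fun i => c * f (co 1 i)); rewrite -[LHS]mulr1 -to_base_change1 spE mulr_sumr.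
  by apply: eq_bigr => i _; rewrite mulrA -rmorphM.
- exists (fun i => c i + c' i); rewrite -big_split; apply: eq_bigr => i _ /=.
  by rewrite rmorphD mulrDl.
- exists (fun k => \sum_i \sum_l c i * c' l * f (co (b i * b l) k)).
  under [RHS]eq_bigr do rewrite rmorph_sum mulr_suml.
  rewrite exchange_big mulr_suml; apply: eq_bigr => i _ /=.
  under [RHS]eq_bigr do rewrite rmorph_sum mulr_suml.
  rewrite exchange_big mulr_sumr; apply: eq_bigr => l _ /=.
  rewrite mulrA -[_ * alg_cst (c' l)]mulrA -alg_cstC !mulrA -rmorphM -mulrA.
  rewrite -to_base_changeM spE mulr_sumr; apply: eq_bigr => k _.
  by rewrite mulrA -rmorphM.
Qed.

(** Linear independence after base change is seen on the regular
    representation, whose matrices extend to the new scalars. *)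
Lemma base_change_fiber : exists coS, fiber b co f sp coS.
Proof.
pose M (x : AS) : 'M[S]_N.+1 :=
  palg_lift (@scalar_mx S N.+1) (fun a => map_mx f (reg_mx b co a)) x.
have cC (c : S) (B : 'M[S]_N.+1) : scalar_mx c * B = B * scalar_mx c.
  by rewrite -[RHS]/(B *m c%:M) scalar_mxC.
have relM s t : base_change_rel f s t ->
    aeval (@scalar_mx S N.+1) (fun a => map_mx f (reg_mx b co a)) s =
    aeval (@scalar_mx S N.+1) (fun a => map_mx f (reg_mx b co a)) t.
  case=> [x y|x y|c] /=.
  - by rewrite (reg_mxD bco) map_mxD.
  - by rewrite (reg_mxM bco) map_mxM.
  - rewrite -[alg_cst c]mulr1 (reg_mxZ bco) (reg_mx1 bco) scalemx1.
    by rewrite map_scalar_mx.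
have MzM : zmod_morphism M := palg_lift_zmod_morphism cC relM.
have [M1 MM] : monoid_morphism M := palg_lift_monoid_morphism cC relM.
have Mgen a : M (sp a) = map_mx f (reg_mx b co a) := palg_lift_gen cC relM a.
have Mcst c : M (alg_cst c) = c%:M := palg_lift_pi cC relM (ACst c).
pose u : 'cV[S]_N.+1 := \col_i f (co 1 i).
have M0 : M 0 = 0 by rewrite -[0 in LHS](subrr 0) MzM subrr.
have MD x y : M (x + y) = M x + M y.
  by rewrite -[y in LHS]opprK MzM -[- y]sub0r MzM M0 sub0r opprK.
pose coS x i := (M x *m u) i 0.
have coScomb c i : coS (\sum_l alg_cst (c l) * sp (b l)) i = c i.
  rewrite /coS; have -> : M (\sum_l alg_cst (c l) * sp (b l)) =
      \sum_l c l *: map_mx f (reg_mx b co (b l)).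
    elim/big_rec2: _ => [|l x y _ <-]; first exact: M0.
    by rewrite MD MM Mcst Mgen -mul_scalar_mx.
  rewrite mulmx_suml summxE (bigD1 i) //=.
  have E l : (c l *: map_mx f (reg_mx b co (b l)) *m u) i 0 = c l * (i == l)%:R.
    rewrite -scalemxAl mxE; congr (_ * _).
    rewrite -(rmorph_nat f) -(coord_basis bco) -[b l in RHS]mulr1 (coordM bco) rmorph_sum mxE.
    by apply: eq_bigr => k _; rewrite !mxE rmorphM.
  rewrite E eqxx mulr1 big1 ?addr0 // => l /negPf li.
  by rewrite E eq_sym li mulr0.
exists coS; split.
- split=> [x|c i]; last exact: coScomb.
  by have [c xE] := base_change_span x; rewrite {1}xE; apply: eq_bigr => i _; rewrite xE coScomb.
- move=> a i; rewrite -(coScomb (fun i => f (co a i)) i); congr (coS _ _).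
  rewrite {1}(coordE bco a) to_base_change_sum; apply: eq_bigr => l _.
  by rewrite to_base_changeM to_base_change_cst.
- exact: to_base_changeM.
- exact: to_base_change1.
Qed.

End BaseChangeBasis.

Section GroupEvaluation.
Variables (X : Type) (B : pzRingType) (u v : X -> B).

(** Evaluation of a group expression, together with its inverse. *)
Fixpoint geval (t : gterm X) : B * B :=
  match t with
  | GVar x => (u x, v x)
  | GOne => (1, 1)
  | GMul s t => ((geval s).1 * (geval t).1, (geval t).2 * (geval s).2)
  | GInv t => ((geval t).2, (geval t).1)
  end.

Hypotheses (uv : forall x, u x * v x = 1) (vu : forall x, v x * u x = 1).

Lemma geval_inv t : (geval t).1 * (geval t).2 = 1 /\ (geval t).2 * (geval t).1 = 1.
Proof.
elim: t => [x||s [s1 s2] t [t1 t2]|t [t1 t2]] //=; first by rewrite mulr1.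
by rewrite !mulrA -[_ * _ * (geval t).2]mulrA t1 mulr1 -[_ * _ * (geval s).1]mulrA s2 mulr1.
Qed.

Lemma geval_fst s t : (geval s).1 = (geval t).1 -> geval s = geval t.
Proof.
move=> st; rewrite [LHS]surjective_pairing [RHS]surjective_pairing st; congr pair.
have [_ s2] := geval_inv s; have [t1 _] := geval_inv t.
by rewrite -[LHS]mulr1 -t1 mulrA -st s2 mul1r.
Qed.

Variable rel : gterm X -> gterm X -> Prop.
Hypothesis relE : forall s t, rel s t -> (geval s).1 = (geval t).1.

Lemma geval_cong s t : gcong rel s t -> geval s = geval t.
Proof.
elim=> [{}s {}t /relE|//|{}s {}t _ -> //|{}s {}t r _ -> _ -> //|
  s1 s2 t1 t2 _ /= -> _ -> //|{}s {}t _ /= -> //|r {}s {}t|{}t|{}t|{}t|{}t];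
  first exact: geval_fst; apply: geval_fst => /=.
- by rewrite mulrA.
- by rewrite mul1r.
- by rewrite mulr1.
- by have [] := geval_inv t.
- by have [] := geval_inv t.
Qed.

End GroupEvaluation.

Section GroupFiber.
Variables (ty : ctype) (d n : nat) (F : fieldType).
Variables (R : comNzRingType) (f : {rmorphism R -> F}).
Local Notation X := (gen ty d n).
Variables (rel : aterm R X -> aterm R X -> Prop) (grel : gterm X -> gterm X -> Prop).
Local Notation cst_f := ((@alg_cst F (group_algebra F (pgrp grel))) \o f).
Local Notation gen_g := (fun x => to_group_algebra F (pgrp_gen grel x)).
Hypothesis rel_grel : forall s t, rel s t ->
  aeval cst_f gen_g s = aeval cst_f gen_g t.

Local Notation A := (palg rel).
Local Notation B := (base_change f A).
Local Notation GA := (group_algebra F (pgrp grel)).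
Local Notation genB := (fun x => to_base_change f (palg_gen rel x)).
Variable invB : X -> B.
Hypotheses (genVB : forall x, genB x * invB x = 1) (invVB : forall x, invB x * genB x = 1).
Hypothesis grelB : forall s t, grel s t ->
  (geval genB invB s).1 = (geval genB invB t).1.

Variables (N : nat) (b : 'I_N.+1 -> A) (co : A -> 'I_N.+1 -> R).
Hypothesis bco : coordinates b co.

Let to_grp : B -> GA := @spec_to_group ty d n F R f rel grel.
Let to_grpB : zmod_morphism to_grp := spec_to_group_zmod rel_grel.
Let to_grpM : monoid_morphism to_grp := spec_to_group_monoid rel_grel.

Let to_grp0 : to_grp 0 = 0.
Proof. by rewrite -[0 in LHS](subrr 0) to_grpB subrr. Qed.

Let to_grpD x y : to_grp (x + y) = to_grp x + to_grp y.
Proof. by rewrite -[y in LHS]opprK to_grpB -[- y]sub0r to_grpB to_grp0 sub0r opprK. Qed.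

Let from_gen (g : pgrp grel) : B := (geval genB invB (generic_quotient.repr g)).1.
Let from_grp : GA -> B := palg_lift (@alg_cst F B) from_gen.

Let from_gen_pi t : from_gen (pi_grp grel t) = (geval genB invB t).1.
Proof. by rewrite /from_gen (geval_cong genVB invVB grelB (gcong_repr grel t)). Qed.

Let from_rel s t : @group_algebra_rel F (pgrp grel) s t ->
  aeval (@alg_cst F B) from_gen s = aeval (@alg_cst F B) from_gen t.
Proof.
case=> [x y|] /=; last by rewrite [1%g]/(pi_grp grel GOne) from_gen_pi rmorph1.
by elim/pgrp_ind: x => x; elim/pgrp_ind: y => y; rewrite -[(_ * _)%g]pi_grpM !from_gen_pi.
Qed.

Let from_grpB : zmod_morphism from_grp := palg_lift_zmod_morphism (@alg_cstC _ _) from_rel.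
Let from_grpM : monoid_morphism from_grp := palg_lift_monoid_morphism (@alg_cstC _ _) from_rel.

Let from_grp0 : from_grp 0 = 0.
Proof. by rewrite -[0 in LHS](subrr 0) from_grpB subrr. Qed.

Let from_grpD x y : from_grp (x + y) = from_grp x + from_grp y.
Proof. by rewrite -[y in LHS]opprK from_grpB -[- y]sub0r from_grpB from_grp0 sub0r opprK. Qed.

Let from_grp_cst c : from_grp (alg_cst c) = alg_cst c.
Proof. exact: (palg_lift_pi (@alg_cstC _ _) from_rel (ACst c)). Qed.

Let to_grp_cst c : to_grp (alg_cst c) = alg_cst c.
Proof. exact: (palg_lift_pi (@alg_cstC _ _) (base_change_spec rel_grel) (ACst c)). Qed.

Let to_grp_gen x : to_grp (genB x) = gen_g x := spec_to_group_gen rel_grel x.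

Let from_grp_gen g : from_grp (to_group_algebra F g) = from_gen g.
Proof. exact: (palg_lift_gen (@alg_cstC _ _) from_rel). Qed.

Let to_grpK : cancel to_grp from_grp.
Proof.
elim/palg_gen_ind => [a|c|x y Ex Ey|x y Ex Ey].
- change (from_grp (to_grp (to_base_change f a)) = to_base_change f a).
  elim/palg_gen_ind: a => [x|c|x y Ex Ey|x y Ex Ey].
  + by rewrite to_grp_gen from_grp_gen from_gen_pi.
  + by rewrite to_base_change_cst to_grp_cst from_grp_cst.
  + by rewrite to_base_changeD to_grpD from_grpD Ex Ey.
  + by rewrite to_base_changeM (snd to_grpM) (snd from_grpM) Ex Ey.
- by rewrite to_grp_cst from_grp_cst.
- by rewrite to_grpD from_grpD Ex Ey.
- by rewrite (snd to_grpM) (snd from_grpM) Ex Ey.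
Qed.

Let gaM x y : to_group_algebra F (x * y)%g =
  to_group_algebra F x * to_group_algebra F y :> GA.
Proof. by rewrite -[RHS]pi_algM; apply/pi_alg_eq/acong_rel/GaMul. Qed.

Let ga1 : to_group_algebra F 1%g = 1 :> GA.
Proof. exact/pi_alg_eq/acong_rel/GaOne. Qed.

Let from_grpK : cancel from_grp to_grp.
Proof.
elim/palg_gen_ind => [g|c|x y Ex Ey|x y Ex Ey].
- change (to_grp (from_grp (to_group_algebra F g)) = to_group_algebra F g).
  rewrite from_grp_gen; elim/pgrp_ind: g => t; rewrite from_gen_pi.
  suff [] : to_grp (geval genB invB t).1 = to_group_algebra F (pi_grp grel t) /\
            to_grp (geval genB invB t).2 = to_group_algebra F (pi_grp grel t)^-1%g by [].
  have inv_uniq x y (g : pgrp grel) : x * y = 1 -> to_grp x = to_group_algebra F g ->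
      to_grp y = to_group_algebra F g^-1%g.
    move=> xy xg; rewrite -[LHS]mul1r -ga1 -(mulVg g) gaM -xg -mulrA -(snd to_grpM) xy.
    by rewrite (fst to_grpM) mulr1.
  have fst_ok : to_grp (geval genB invB t).1 = to_group_algebra F (pi_grp grel t) ->
      to_grp (geval genB invB t).2 = to_group_algebra F (pi_grp grel t)^-1%g.
    by apply: inv_uniq; have [] := geval_inv genVB invVB t.
  suff fstE : to_grp (geval genB invB t).1 = to_group_algebra F (pi_grp grel t).
    by split=> //; exact: fst_ok.
  elim: t {fst_ok} => [x||s IHs t IHt|t IHt] /=.
  + by rewrite to_grp_gen.
  + by rewrite (fst to_grpM) [pi_grp _ _]/(1%g : pgrp grel) ga1.
  + by rewrite (snd to_grpM) IHs IHt pi_grpM -gaM.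
  + by rewrite pi_grpV; apply: inv_uniq IHt; have [] := geval_inv genVB invVB t.
- by rewrite from_grp_cst to_grp_cst.
- by rewrite from_grpD to_grpD Ex Ey.
- by rewrite (snd from_grpM) (snd to_grpM) Ex Ey.
Qed.

(** The universal properties of the presented algebra and of the presented group
    give morphisms in both directions that are inverse on the generators. *)
Lemma group_fiber : exists coG,
  fiber b co f (fun a => @spec_to_group ty d n F R f rel grel (to_base_change f a)) coG.
Proof.
have [coB [[cE cC] E M1 M2]] := base_change_fiber f bco.
have to_sum I (r : seq I) (G : I -> B) :
    to_grp (\sum_(i <- r) G i) = \sum_(i <- r) to_grp (G i).
  by elim/big_rec2: _ => [|i x y _ <-]; [exact: to_grp0 | exact: to_grpD].
have to_comb c : to_grp (\sum_i alg_cst (c i) * to_base_change f (b i)) =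
    \sum_i alg_cst (c i) * to_grp (to_base_change f (b i)).
  by rewrite to_sum; apply: eq_bigr => i _; rewrite (snd to_grpM) to_grp_cst.
exists (fun y => coB (from_grp y)); split.
- split=> [x|c i]; first by rewrite -to_comb -cE from_grpK.
  by rewrite -to_comb to_grpK cC.
- by move=> a i; rewrite -E to_grpK.
- by move=> x y; rewrite M1; exact: to_grpM.2.
- by rewrite M2; exact: to_grpM.1.
Qed.

End GroupFiber.

(** * Coxeter groups through the signs of their roots *)

Fixpoint alt (I : Type) (i j : I) (k : nat) : seq I :=
  if k is k'.+1 then i :: alt j i k' else [::].

(** The letter that follows [alt i j k] in the infinite alternating word. *)
Definition alt_next (I : Type) (i j : I) (k : nat) : I := if odd k then j else i.

Lemma alt_rcons (I : Type) (i j : I) k : alt i j k.+1 = rcons (alt i j k) (alt_next i j k).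
Proof.
elim: k i j => [|k IHk] i j //.
rewrite [LHS]/= -/(alt j i k.+1) IHk /=; congr (_ :: rcons _ _).
by rewrite /alt_next /=; case: (odd k).
Qed.

Lemma size_alt (I : Type) (i j : I) k : size (alt i j k) = k.
Proof. by elim: k i j => //= k IHk i j; rewrite IHk. Qed.

Local Open Scope group_scope.

(** [pos w i] stands for the positivity of the image by [w] of the simple root
    numbered [i].  The field [cox_posS] says that a simple reflection changes
    the sign of no positive root but its own, and [cox_rank2] that the roots met
    along an alternating word are nonnegative combinations of two simple roots. *)
Record coxeter_system (W : finGroupType) l (s : 'I_l -> W)
    (pos : W -> 'I_l -> bool) (m : 'I_l -> 'I_l -> nat) : Prop := {
  cox_sK : forall i, s i * s i = 1;
  cox_gen : forall w, exists e : seq 'I_l, w = \prod_(i <- e) s i;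
  cox_pos1 : forall i, pos 1 i;
  cox_posN : forall w i, pos (w * s i) i = ~~ pos w i;
  cox_posS : forall w i j, pos w i -> ~~ pos (s j * w) i -> s j * w = w * s i;
  cox_m0 : forall i j, (0 < m i j)%N;
  cox_mC : forall i j, m i j = m j i;
  cox_braid : forall i j, i != j ->
    \prod_(k <- alt i j (m i j)) s k = \prod_(k <- alt j i (m i j)) s k;
  cox_rank2 : forall w i j k, i != j -> (k < m i j)%N -> pos w i = pos w j ->
    pos (w * \prod_(a <- alt i j k) s a) (alt_next i j k) = pos w i
}.

Section Coxeter.
Variables (W : finGroupType) (l : nat) (s : 'I_l -> W).
Variables (pos : W -> 'I_l -> bool) (m : 'I_l -> 'I_l -> nat).
Hypothesis cox : coxeter_system s pos m.

Definition wprod (e : seq 'I_l) : W := \prod_(i <- e) s i.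

Lemma wprod_cons i e : wprod (i :: e) = s i * wprod e.
Proof. exact: big_cons. Qed.

Lemma wprod_cat e e' : wprod (e ++ e') = wprod e * wprod e'.
Proof. exact: big_cat. Qed.

Lemma wprod_rcons e i : wprod (rcons e i) = wprod e * s i.
Proof. by rewrite -cats1 wprod_cat /wprod big_seq1. Qed.

Lemma simpleV i : (s i)^-1 = s i.
Proof. by apply: (mulgI (s i)); rewrite mulgV (cox_sK cox). Qed.

Lemma mulsK i w : s i * (s i * w) = w.
Proof. by rewrite mulgA (cox_sK cox) mul1g. Qed.

Lemma mulKs i w : w * s i * s i = w.
Proof. by rewrite -mulgA (cox_sK cox) mulg1. Qed.

Lemma wprodV e : (wprod e)^-1 = wprod (rev e).
Proof.
elim: e => [|i e IHe]; first by rewrite /wprod !big_nil invg1.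
by rewrite wprod_cons invMg IHe simpleV rev_cons wprod_rcons.
Qed.

Definition has_word (w : W) (n : nat) : bool :=
  `[< exists e, size e = n /\ wprod e = w >].

Fact exists_word w : exists n, has_word w n.
Proof. by have [e ->] := cox_gen cox w; exists (size e); apply/asboolP; exists e. Qed.

Definition len (w : W) : nat := ex_minn (exists_word w).

Lemma len_word w : exists2 e, size e = len w & wprod e = w.
Proof. by rewrite /len; case: ex_minnP => n /asboolP[e [? ?]] _; exists e. Qed.

Lemma len_le e : (len (wprod e) <= size e)%N.
Proof. by rewrite /len; case: ex_minnP => n _; apply; apply/asboolP; exists e. Qed.

(** If [w] sends a simple root to a negative one, the sign changes at some letter
    of any word for [w]; that letter can be deleted. *)
Lemma exchange e i : ~~ pos (wprod e) i ->
  exists2 e', (size e').+1 = size e & wprod e' = wprod e * s i.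
Proof.
elim: e => [|j e IHe]; first by rewrite /wprod big_nil (cox_pos1 cox).
rewrite wprod_cons; have [p n|n _] := boolP (pos (wprod e) i).
  by exists e => //; rewrite (cox_posS cox p n) mulKs.
have [e' se E] := IHe n; exists (j :: e'); first by rewrite /= se.
by rewrite wprod_cons E mulgA.
Qed.

Lemma len_down w i : ~~ pos w i -> (len (w * s i)).+1 = len w.
Proof.
case: (len_word w) => e se we; rewrite -we in se *.
move=> /exchange[e' se' we']; apply/eqP; rewrite eqn_leq; apply/andP; split.
  by rewrite -se -se' ltnS -we' len_le.
have [e2 se2 we2] := len_word (wprod e * s i).
rewrite -se2 -(size_rcons e2 i).
have <- : wprod (rcons e2 i) = wprod e by rewrite wprod_rcons we2 mulKs.
exact: len_le.
Qed.

Lemma len_up w i : pos w i -> len (w * s i) = (len w).+1.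
Proof.
move=> p; have /len_down : ~~ pos (w * s i) i by rewrite (cox_posN cox) p.
by rewrite mulKs.
Qed.

Lemma posE w i : pos w i = (len w < len (w * s i))%N.
Proof.
have [p|n] := boolP (pos w i); first by rewrite len_up // ltnSn.
by rewrite -(len_down n) ltnNge leqnSn.
Qed.

Lemma lenV w : len w^-1 = len w.
Proof.
have le v : (len v^-1 <= len v)%N.
  have [e <- <-] := len_word v; rewrite wprodV -[leqRHS]size_rev; exact: len_le.
by apply/eqP; rewrite eqn_leq le -{1}[w]invgK le.
Qed.

Definition desc i w := ~~ pos w^-1 i.

Lemma descE i w : desc i w = (len (s i * w) < len w)%N.
Proof.
rewrite /desc -(lenV w) -(lenV (s i * w)) invMg simpleV.
have [p|n] := boolP (pos _ _); first by rewrite len_up // ltnNge leqnSn.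
by rewrite -(len_down n) ltnSn.
Qed.

Lemma len_descN i w : ~~ desc i w -> len (s i * w) = (len w).+1.
Proof.
by move=> /negPn/len_up; rewrite -{1}(simpleV i) -invMg !lenV.
Qed.

Lemma len_desc i w : desc i w -> (len (s i * w)).+1 = len w.
Proof. by move=> /len_down; rewrite -{1}(simpleV i) -invMg !lenV. Qed.

Lemma desc_mul i w : desc i (s i * w) = ~~ desc i w.
Proof. by rewrite /desc invMg simpleV (cox_posN cox). Qed.

Lemma desc_swap i j w : s i * w = w * s j -> desc i w = ~~ pos w j.
Proof.
move=> E; rewrite descE posE E -leqNgt.
have [p|n] := boolP (pos w j); first by have := len_up p; lia.
by have := len_down n; lia.
Qed.

Lemma pos_mulN i j w : s i * w <> w * s j -> pos (s i * w) j = pos w j.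
Proof.
move=> neq; have [p|n] := boolP (pos w j).
  by apply: contraT => n; case: neq; exact: (cox_posS cox p n).
apply: contraNF n => p; apply: contraT => n; case: neq.
have := @cox_posS _ _ _ _ _ cox (s i * w) j i p; rewrite mulsK => /(_ n) E.
by rewrite {2}E mulKs.
Qed.

Lemma desc_mulN i j w : s i * w <> w * s j -> desc i (w * s j) = desc i w.
Proof.
move=> neq; rewrite /desc invMg simpleV pos_mulN // => E.
by apply: neq; rewrite -[LHS]invgK invMg simpleV -E invMg simpleV invgK.
Qed.

Lemma len1 : len 1 = 0%N.
Proof. by apply/eqP; rewrite -leqn0; have := len_le [::]; rewrite /wprod big_nil. Qed.

Lemma len_alt i j k : i != j -> (k <= m i j)%N -> len (wprod (alt i j k)) = k.
Proof.
move=> ij; elim: k => [|k IHk] km; first by rewrite /wprod big_nil len1.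
rewrite alt_rcons wprod_rcons len_up ?IHk //; first exact: ltnW.
have := @cox_rank2 _ _ _ _ _ cox 1 i j k ij km; rewrite mul1g !(cox_pos1 cox).
exact.
Qed.

(** If both [s i] and [s j] shorten w, each further letter of an alternating word
    still shortens what is left of w, by [cox_rank2]. *)
Lemma len_alt_desc i j w k : i != j -> desc i w -> desc j w -> (k <= m i j)%N ->
  (len ((wprod (alt i j k))^-1 * w) + k)%N = len w.
Proof.
move=> ij di dj; elim: k => [|k IHk] km.
  by rewrite /wprod big_nil invg1 mul1g addn0.
rewrite -(IHk (ltnW km)) alt_rcons wprod_rcons invMg simpleV addnS -addSn.
congr (_ + _)%N; rewrite -mulgA; apply: len_desc; rewrite /desc invMg invgK.
have := @cox_rank2 _ _ _ _ _ cox w^-1 i j k ij km.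
by rewrite (negPf di) (negPf dj) /wprod => ->.
Qed.

Definition reduced e := size e = len (wprod e).

Lemma reduced_tail i e : reduced (i :: e) -> reduced e /\ desc i (wprod (i :: e)).
Proof.
rewrite /reduced wprod_cons /= => E.
have le : (len (s i * wprod e) <= (len (wprod e)).+1)%N.
  have [e' <- we'] := len_word (wprod e); rewrite -we' -wprod_cons; exact: len_le.
have E' : size e = len (wprod e).
  by apply/eqP; rewrite eqn_leq len_le andbT -ltnS E.
by split=> //; rewrite descE mulsK -E E'.
Qed.

(** Matsumoto's theorem, by induction on the length.  If two reduced words of the
    same element start with distinct letters i and j, the element is divisible by
    the longest alternating word in i and j, and a braid move links a reduced word
    that starts with i to one that starts with j. *)
Theorem matsumoto (B : pzRingType) (x : 'I_l -> B) :
    (forall i j, i != j ->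
      (\prod_(k <- alt i j (m i j)) x k = \prod_(k <- alt j i (m i j)) x k)%R) ->
  forall e e', reduced e -> reduced e' -> wprod e = wprod e' ->
    (\prod_(k <- e) x k = \prod_(k <- e') x k)%R.
Proof.
move=> braid e; have [n] := ubnP (size e); elim: n e => // n IHn e.
rewrite ltnS => le_n e' re re' E.
have se : size e = size e' by rewrite re re' E.
case: e e' => [|i e] [|j e'] // in le_n re re' E se *.
have [re0 di] := reduced_tail re; have [re0' dj] := reduced_tail re'.
case: se => se.
have [ij|ij] := eqVneq i j.
  subst j; rewrite !big_cons (IHn e le_n e' re0 re0') //.
  by move: E; rewrite !wprod_cons => /mulgI.
set w := wprod (i :: e) in E di; rewrite -E in dj.
have [k Ek] : exists k, m i j = k.+1 by case: (m i j) (cox_m0 cox i j) => // k; exists k.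
pose v := (wprod (alt i j (m i j)))^-1 * w.
have lv : (len v + m i j)%N = len w by apply: len_alt_desc.
have [y sy wy] := len_word v.
have Ebr : wprod (alt i j (m i j)) = wprod (alt j i (m i j)) by exact: (cox_braid cox).
have wi : w = wprod (i :: (alt j i k ++ y)).
  by rewrite -cat_cons -[i :: _]/(alt i j k.+1) -Ek wprod_cat wy mulKVg.
have wj : w = wprod (j :: (alt i j k ++ y)).
  by rewrite -cat_cons -[j :: _]/(alt j i k.+1) -Ek wprod_cat wy -Ebr mulKVg.
have sw : (size y + k).+1 = len w by rewrite -addnS sy -Ek.
have ri : reduced (i :: (alt j i k ++ y)).
  by rewrite /reduced -wi /= size_cat size_alt addnC.
have rj : reduced (j :: (alt i j k ++ y)).
  by rewrite /reduced -wj /= size_cat size_alt addnC.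
have [ri0 _] := reduced_tail ri; have [rj0 _] := reduced_tail rj.
rewrite !big_cons (IHn e le_n (alt j i k ++ y) re0 ri0); last first.
  by apply: (mulgI (s i)); rewrite -!wprod_cons -wi.
rewrite (IHn e' _ (alt i j k ++ y) re0' rj0) -?se //; last first.
  by apply: (mulgI (s j)); rewrite -!wprod_cons -wj.
have bc a q : (x a * \prod_(k <- q) x k = \prod_(k <- a :: q) x k)%R by rewrite big_cons.
rewrite !bc -!cat_cons !big_cat /=; congr (_ * _)%R.
by have := braid _ _ ij; rewrite Ek.
Qed.

End Coxeter.

Local Close Scope group_scope.

(** * Convolution rings *)

Section Convolution.
Variables (T : finZmodType) (R : comNzRingType).

(** The group ring of T over R, realized by functions. *)
Definition conv : Type := {ffun T -> R}.
HB.instance Definition _ := GRing.Lmodule.copy conv {ffun T -> R^o}.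

Implicit Types f g h : conv.

Definition conv_mul f g : conv := [ffun v => \sum_x f x * g (v - x)].
Definition conv_delta (v : T) : conv := [ffun x => (x == v)%:R].

Lemma conv_mulC : commutative conv_mul.
Proof.
move=> f g; apply/ffunP => v; rewrite !ffunE (reindex_inj (subrI v)) /=.
by apply: eq_bigr => x _; rewrite subKr mulrC.
Qed.

Lemma conv_mulA : associative conv_mul.
Proof.
move=> f g h; apply/ffunP => v; rewrite !ffunE.
under eq_bigr do rewrite ffunE mulr_sumr.
under [RHS]eq_bigr do rewrite ffunE mulr_suml.
rewrite [RHS]exchange_big /=; apply: eq_bigr => x _.
rewrite [RHS](reindex_inj (addrI x)) /=; apply: eq_bigr => y _.
by rewrite mulrA [x + y - x]addrC addKr opprD addrA.
Qed.

Lemma conv_mul1 : left_id (conv_delta 0) conv_mul.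
Proof.
move=> f; apply/ffunP => v; rewrite ffunE (bigD1 0) //= ffunE eqxx mul1r subr0.
by rewrite big1 ?addr0 // => x /negPf x0; rewrite ffunE x0 mul0r.
Qed.

Lemma conv_mulDl : left_distributive conv_mul +%R.
Proof.
move=> f g h; apply/ffunP => v; rewrite !ffunE -big_split; apply: eq_bigr => x _.
by rewrite ffunE mulrDl.
Qed.

Lemma conv_delta_neq0 : conv_delta 0 != 0.
Proof.
apply/eqP => /ffunP/(_ 0); rewrite !ffunE eqxx => /eqP; by rewrite oner_eq0.
Qed.

HB.instance Definition _ := GRing.Zmodule_isComNzRing.Build conv
  conv_mulA conv_mulC conv_mul1 conv_mulDl conv_delta_neq0.

Lemma convM f g v : (f * g) v = \sum_x f x * g (v - x).
Proof. by rewrite ffunE. Qed.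

Lemma convZE a f v : (a *: f) v = a * f v.
Proof. by rewrite ffunE. Qed.

Lemma conv_scalel a f g : a *: (f * g) = (a *: f) * g.
Proof.
apply/ffunP => v; rewrite ffunE !convM [_ *: _]mulr_sumr; apply: eq_bigr => x _.
by rewrite ffunE mulrA.
Qed.

Lemma conv_deltaM v f x : (conv_delta v * f) x = f (x - v).
Proof.
rewrite convM (bigD1 v) //= ffunE eqxx mul1r big1 ?addr0 // => y /negPf yv.
by rewrite ffunE yv mul0r.
Qed.

Lemma conv_deltaD v w : conv_delta (v + w) = conv_delta v * conv_delta w.
Proof. by apply/ffunP => x; rewrite conv_deltaM !ffunE subr_eq addrC. Qed.

Lemma conv_delta0 : conv_delta 0 = 1. Proof. by []. Qed.

Lemma conv_sumE I (r : seq I) (G : I -> conv) v :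
  (\sum_(i <- r) G i) v = \sum_(i <- r) G i v.
Proof. by rewrite sum_ffunE. Qed.

Lemma convE f : f = \sum_v f v *: conv_delta v.
Proof.
apply/ffunP => v; rewrite conv_sumE (bigD1 v) //= big1 => [|w /negPf wv].
  by rewrite addr0 convZE ffunE eqxx mulr1.
by rewrite convZE ffunE eq_sym wv mulr0.
Qed.

End Convolution.

(** * Linear endomorphisms *)

Section Endomorphisms.
Variables (R : comNzRingType) (V : lmodType R).

Definition endo : Type := {f : V -> V | `[< linear f >]}.
HB.instance Definition _ := SubChoice.on endo.

Definition endo_fun (f : endo) : V -> V := val f.
Coercion endo_fun : endo >-> Funclass.
Implicit Types f g h : endo.

Lemma endoP f g : (forall x, f x = g x) -> f = g.
Proof. by move=> fg; apply: val_inj; apply: funext. Qed.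

Lemma endo_linear f a x y : f (a *: x + y) = a *: f x + f y.
Proof. exact: (asboolP _ (valP f)). Qed.

Definition Endo (f : V -> V) (lf : linear f) : endo := Sub f (introT (asboolP _) lf).

Lemma endo_add_linear f g : linear (fun x => f x + g x).
Proof. by move=> a x y; rewrite !endo_linear scalerDr addrACA. Qed.
Lemma endo_opp_linear f : linear (fun x => - f x).
Proof. by move=> a x y; rewrite endo_linear opprD scalerN. Qed.
Lemma endo_zero_linear : linear (fun _ : V => 0 : V).
Proof. by move=> a x y; rewrite scaler0 addr0. Qed.
Lemma endo_one_linear : linear (fun x : V => x).
Proof. by []. Qed.
Lemma endo_comp_linear f g : linear (fun x => f (g x)).
Proof. by move=> a x y; rewrite !endo_linear. Qed.
Lemma endo_scale_linear c : linear (fun x : V => c *: x).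
Proof. by move=> a x y; rewrite scalerDr !scalerA mulrC. Qed.

Lemma endo_addA : associative (fun f g => Endo (endo_add_linear f g)).
Proof. by move=> f g h; apply: endoP => x; exact: addrA. Qed.
Lemma endo_addC : commutative (fun f g => Endo (endo_add_linear f g)).
Proof. by move=> f g; apply: endoP => x; exact: addrC. Qed.
Lemma endo_add0 : left_id (Endo endo_zero_linear) (fun f g => Endo (endo_add_linear f g)).
Proof. by move=> f; apply: endoP => x; exact: add0r. Qed.
Lemma endo_addN : left_inverse (Endo endo_zero_linear)
  (fun f => Endo (endo_opp_linear f)) (fun f g => Endo (endo_add_linear f g)).
Proof. by move=> f; apply: endoP => x; exact: addNr. Qed.

HB.instance Definition _ :=
  GRing.isZmodule.Build endo endo_addA endo_addC endo_add0 endo_addN.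

Lemma endo_mulA : associative (fun f g => Endo (endo_comp_linear f g)).
Proof. by move=> f g h; apply: endoP. Qed.
Lemma endo_mul1l : left_id (Endo endo_one_linear) (fun f g => Endo (endo_comp_linear f g)).
Proof. by move=> f; apply: endoP. Qed.
Lemma endo_mul1r : right_id (Endo endo_one_linear) (fun f g => Endo (endo_comp_linear f g)).
Proof. by move=> f; apply: endoP. Qed.

Lemma endo_funD f x y : f (x + y) = f x + f y.
Proof. by have := endo_linear f 1 x y; rewrite !scale1r. Qed.
Lemma endo_fun0 f : f 0 = 0.
Proof. by apply: (addrI (f 0)); rewrite -endo_funD !addr0. Qed.
Lemma endo_funZ f a x : f (a *: x) = a *: f x.
Proof. by have := endo_linear f a x 0; rewrite endo_fun0 !addr0. Qed.

Lemma endo_mulDl : left_distributive (fun f g => Endo (endo_comp_linear f g)) +%R.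
Proof. by move=> f g h; apply: endoP. Qed.
Lemma endo_mulDr : right_distributive (fun f g => Endo (endo_comp_linear f g)) +%R.
Proof. by move=> f g h; apply: endoP => x; exact: endo_funD. Qed.

HB.instance Definition _ := GRing.Zmodule_isPzRing.Build endo
  endo_mulA endo_mul1l endo_mul1r endo_mulDl endo_mulDr.

Lemma endoDE f g x : (f + g : endo) x = f x + g x. Proof. by []. Qed.
Lemma endoME f g x : (f * g : endo) x = f (g x). Proof. by []. Qed.
Lemma endo1E x : (1 : endo) x = x. Proof. by []. Qed.

Definition endo_cst (c : R) : endo := Endo (endo_scale_linear c).

Lemma endo_cstE c x : endo_cst c x = c *: x. Proof. by []. Qed.

Fact endo_cst_zmod : zmod_morphism endo_cst.
Proof. by move=> a b; apply: endoP => x; exact: scalerBl. Qed.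
Fact endo_cst_monoid : monoid_morphism endo_cst.
Proof.
by split=> [|a b]; apply: endoP => x; [exact: scale1r | exact: esym (scalerA _ _ _)].
Qed.
HB.instance Definition _ :=
  GRing.isZmodMorphism.Build R endo endo_cst endo_cst_zmod.
HB.instance Definition _ :=
  GRing.isMonoidMorphism.Build R endo endo_cst endo_cst_monoid.

Fact endo_cstC c f : endo_cst c * f = f * endo_cst c.
Proof. by apply: endoP => x; exact: esym (endo_funZ _ _ _). Qed.

HB.instance Definition _ := isPzAlgebra.Build R endo endo_cstC.

End Endomorphisms.

(** * The generic algebra and its free model *)

Definition conv_eval (T : finZmodType) (R : comNzRingType) (B : pzRingType)
    (g : R -> B) (tau : T -> B) (f : conv T R) : B :=
  \sum_v g (f v) * tau v.

(** Words in the torus T and in lifts [xi i] of the simple reflections, with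
    quadratic relations whose coefficients [c i] and [b i] lie in R[T]. *)
Record generic_rep (T : finZmodType) (R : comNzRingType) (W : finGroupType) l
    (s : 'I_l -> W) (m : 'I_l -> 'I_l -> nat) (act : W -> T -> T)
    (c b : 'I_l -> conv T R) (B : pzRingType) (g : R -> B) (tau : T -> B)
    (xi : 'I_l -> B) : Prop := {
  gen_tau0 : tau 0 = 1;
  gen_tauD : forall v w, tau (v + w) = tau v * tau w;
  gen_act : forall i v, xi i * tau v = tau (act (s i) v) * xi i;
  gen_braid : forall i j, i != j ->
    \prod_(k <- alt i j (m i j)) xi k = \prod_(k <- alt j i (m i j)) xi k;
  gen_quad : forall i,
    xi i * xi i = conv_eval g tau (c i) + conv_eval g tau (b i) * xi i
}.

Record torus_action (T : finZmodType) (W : finGroupType) (act : W -> T -> T) : Prop := {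
  act1 : forall v, act 1%g v = v;
  actM : forall w w' v, act (w * w')%g v = act w (act w' v);
  actD : forall w v v', act w (v + v') = act w v + act w v'
}.

Section ConvAction.
Variables (T : finZmodType) (R : comNzRingType) (W : finGroupType).
Variable act : W -> T -> T.
Hypothesis hact : torus_action act.
Local Notation S := (conv T R).

Definition cact (w : W) (f : S) : S := [ffun v => f (act w^-1%g v)].

Lemma act_inj w : injective (act w).
Proof.
by apply: (can_inj (g := act w^-1%g)) => v; rewrite -(actM hact) mulVg (act1 hact).
Qed.

Lemma actK w v : act w^-1%g (act w v) = v.
Proof. by rewrite -(actM hact) mulVg (act1 hact). Qed.

Lemma actKV w v : act w (act w^-1%g v) = v.
Proof. by rewrite -(actM hact) mulgV (act1 hact). Qed.

Lemma act0 w : act w 0 = 0.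
Proof. by apply: (addrI (act w 0)); rewrite -(actD hact) !addr0. Qed.

Lemma actB w v v' : act w (v - v') = act w v - act w v'.
Proof. by apply: (canRL (addrK _)); rewrite -(actD hact) subrK. Qed.

Lemma cactD w f f' : cact w (f + f') = cact w f + cact w f'.
Proof. by apply/ffunP => v; rewrite !ffunE. Qed.

Lemma cactM w f f' : cact w (f * f') = cact w f * cact w f'.
Proof.
apply/ffunP => v; rewrite ffunE !convM (reindex_inj (@act_inj w^-1%g)) /=.
by apply: eq_bigr => x _; rewrite !ffunE actB.
Qed.

Lemma cactZ w a f : cact w (a *: f) = a *: cact w f.
Proof. by apply/ffunP => v; rewrite !ffunE. Qed.

Lemma cact_delta w v : cact w (conv_delta R v) = conv_delta R (act w v).
Proof.
apply/ffunP => x; rewrite !ffunE; congr (_%:R); congr nat_of_bool.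
by apply/eqP/eqP => [<-|->]; rewrite ?actKV ?actK.
Qed.

Lemma cact_comp w w' f : cact w (cact w' f) = cact (w * w')%g f.
Proof. by apply/ffunP => v; rewrite !ffunE invMg (actM hact). Qed.

Lemma cact1g f : cact 1%g f = f.
Proof. by apply/ffunP => v; rewrite !ffunE invg1 (act1 hact). Qed.

Lemma cact_one w : cact w 1 = 1.
Proof. by rewrite -conv_delta0 cact_delta act0. Qed.

End ConvAction.

(** The coefficients of the quadratic relations are attached to the roots, up to
    sign, and [b i] does not see the action of the reflection [s i]. *)
Record good_coefs (T : finZmodType) (R : comNzRingType) (W : finGroupType) l
    (s : 'I_l -> W) (act : W -> T -> T) (c b : 'I_l -> conv T R) : Prop := {
  coef_c : forall w i j, (s i * w = w * s j)%g -> cact act w (c j) = c i;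
  coef_b : forall w i j, (s i * w = w * s j)%g -> cact act w (b j) = b i;
  coef_abs : forall i f, b i * cact act (s i) f = b i * f
}.

Section ModelSpace.
Variables (T : finZmodType) (R : comNzRingType) (W : finGroupType).
Local Notation S := (conv T R).

(** The free R[T]-module on W. *)
Definition model : lmodType R := {ffun W -> S}.

(** Locked, so that a vector is only known through its coordinates. *)
Definition mvec (f : W -> S) : model := locked [ffun w => f w].
Definition mcoef (x : model) (w : W) : S := (x : {ffun W -> S}) w.

Lemma mcoefE f w : mcoef (mvec f) w = f w.
Proof. by rewrite /mvec -lock; exact: ffunE. Qed.
Lemma mcoefP x y : (forall w, mcoef x w = mcoef y w) -> x = y.
Proof. by move=> xy; apply/ffunP. Qed.
Lemma mcoefD x y w : mcoef (x + y) w = mcoef x w + mcoef y w.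
Proof. exact: ffunE. Qed.
Lemma mcoefZ k x w : mcoef (k *: x) w = k *: mcoef x w.
Proof. exact: ffunE. Qed.
Lemma mcoef0 w : mcoef 0 w = 0.
Proof. exact: ffunE. Qed.
Lemma mcoef_sum I (r : seq I) (G : I -> model) w :
  mcoef (\sum_(i <- r) G i) w = \sum_(i <- r) mcoef (G i) w.
Proof. by apply: (big_morph (mcoef^~ w)) => [x y|]; rewrite (mcoefD, mcoef0). Qed.

End ModelSpace.

Section Model.
Variables (T : finZmodType) (R : comNzRingType) (W : finGroupType) (l : nat).
Variables (s : 'I_l -> W) (pos : W -> 'I_l -> bool) (m : 'I_l -> 'I_l -> nat).
Hypothesis cox : coxeter_system s pos m.
Variable act : W -> T -> T.
Hypothesis hact : torus_action act.
Variables c b : 'I_l -> conv T R.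
Hypothesis hcb : good_coefs s act c b.
Local Notation S := (conv T R).
Local Notation M := (model T R W).
Local Notation a_ i := (cact act (s i)).

Definition basis_vec (w : W) : M := mvec (fun y => (y == w)%:R : S).

Definition scal_fun (a : S) (x : M) : M := mvec (fun w => a * mcoef x w).

(** Left multiplication by xi i, if the vector x stands for the sum of the
    mcoef x w * lift w: the product xi i * lift w is lift (s i * w) when the length
    grows, and is expanded by the quadratic relation otherwise. *)
Definition left_fun (i : 'I_l) (x : M) : M :=
  mvec (fun w =>
    if desc pos i w then a_ i (mcoef x (s i * w)%g) + b i * a_ i (mcoef x w)
    else c i * a_ i (mcoef x (s i * w)%g)).

(** Right multiplication by xi j, in the same convention; the scalars of the
    quadratic relation have to be moved across lift w. *)
Definition right_fun (j : 'I_l) (x : M) : M :=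
  mvec (fun w =>
    if pos w j then cact act w (c j) * mcoef x (w * s j)%g
    else mcoef x (w * s j)%g + cact act (w * s j)%g (b j) * mcoef x w).

Fact scal_linear a : linear (scal_fun a).
Proof.
move=> k x y; apply: mcoefP => w; rewrite mcoefD mcoefZ !mcoefE mcoefD mcoefZ.
by rewrite mulrDr; congr (_ + _); rewrite mulrC -conv_scalel mulrC.
Qed.

Fact left_linear i : linear (left_fun i).
Proof.
move=> k x y; apply: mcoefP => w; rewrite mcoefD mcoefZ !mcoefE !mcoefD !mcoefZ.
have E (f f' g : S) : f * (k *: f' + g) = k *: (f * f') + f * g.
  by rewrite mulrDr; congr (_ + _); rewrite mulrC -conv_scalel mulrC.
rewrite !cactD !cactZ !E; case: ifP => // _.
by rewrite scalerDr -!addrA; congr (_ + _); rewrite addrCA.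
Qed.

Definition scal (a : S) : endo M := Endo (scal_linear a).
Definition lmul (i : 'I_l) : endo M := Endo (left_linear i).

Lemma scalE a x w : mcoef (scal a x) w = a * mcoef x w. Proof. exact: mcoefE. Qed.
Lemma lmulE i x w : mcoef (lmul i x) w =
  if desc pos i w then a_ i (mcoef x (s i * w)%g) + b i * a_ i (mcoef x w)
  else c i * a_ i (mcoef x (s i * w)%g).
Proof. exact: mcoefE. Qed.
Lemma right_funE j x w : mcoef (right_fun j x) w =
  if pos w j then cact act w (c j) * mcoef x (w * s j)%g
  else mcoef x (w * s j)%g + cact act (w * s j)%g (b j) * mcoef x w.
Proof. exact: mcoefE. Qed.

Lemma scalM (a a' : S) : scal (a * a') = scal a * scal a'.
Proof. by apply: endoP => x; apply: mcoefP => w; rewrite endoME !scalE mulrA. Qed.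

Lemma scalD (a a' : S) : scal (a + a') = scal a + scal a'.
Proof.
by apply: endoP => x; apply: mcoefP => w; rewrite endoDE mcoefD !scalE mulrDl.
Qed.

Lemma scal1 : scal 1 = 1.
Proof. by apply: endoP => x; apply: mcoefP => w; rewrite scalE mul1r. Qed.

Lemma scalZ k (a : S) : scal (k *: a) = endo_cst _ k * scal a.
Proof.
by apply: endoP => x; apply: mcoefP => w; rewrite endoME endo_cstE mcoefZ !scalE conv_scalel.
Qed.

Lemma scal0 : scal 0 = 0.
Proof. by apply: (addrI (scal 0)); rewrite -scalD !addr0. Qed.

Lemma lmul_scal i (a : S) : lmul i * scal a = scal (a_ i a) * lmul i.
Proof.
apply: endoP => x; apply: mcoefP => w; rewrite !endoME scalE !lmulE !scalE !(cactM hact).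
case: ifP => _; ring.
Qed.

Definition commutes_right (E : M -> M) : Prop :=
  forall j x, E (right_fun j x) = right_fun j (E x).

Let c_fix i : a_ i (c i) = c i. Proof. exact: (coef_c hcb). Qed.
Let b_fix i : a_ i (b i) = b i. Proof. exact: (coef_b hcb). Qed.
Let sKw i w : (s i * (s i * w) = w)%g. Proof. exact: (mulsK cox). Qed.
Let wKs j w : (w * s j * s j = w)%g. Proof. exact: (mulKs cox). Qed.

(** If s i * w = w * s j, both multiplications mix the coordinates at w and s i * w,
    and their coefficients agree because they belong to the same root.  Otherwise
    neither changes the case distinction made by the other. *)
Lemma lmul_right i : commutes_right (lmul i).
Proof.
move=> j x; apply: mcoefP => w; rewrite lmulE [RHS]right_funE.
have [E|neq] := eqVneq (s i * w)%g (w * s j)%g.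
  set w' := (s i * w)%g in E *.
  have iw' : (s i * w')%g = w by rewrite /w' sKw.
  have w'j : (w' * s j)%g = w by rewrite E wKs.
  have E' : (s i * w' = w' * s j)%g by rewrite iw' w'j.
  have dw : desc pos i w = ~~ pos w j := desc_swap cox E.
  have dw' : desc pos i w' = ~~ desc pos i w by rewrite (desc_mul cox).
  have pw' : pos w' j = ~~ pos w j by rewrite E (cox_posN cox).
  rewrite -E !right_funE !lmulE -E iw' w'j dw' pw' dw.
  have [p|n] /= := boolP (pos w j).
    by rewrite (coef_c hcb E) (coef_b hcb E) cactD (cactM hact) b_fix; ring.
  rewrite (coef_c hcb E') (coef_b hcb E') !cactD !(cactM hact) c_fix b_fix.
  by ring.
move/eqP: neq => neq.
rewrite !lmulE (desc_mulN cox neq) !right_funE (pos_mulN cox neq).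
rewrite !mulgA.
have Ec : a_ i (cact act (s i * w)%g (c j)) = cact act w (c j).
  by rewrite (cact_comp hact) sKw.
have Eb : a_ i (cact act (s i * w * s j)%g (b j)) = cact act (w * s j)%g (b j).
  by rewrite (cact_comp hact) -mulgA sKw.
have abs (f g : S) : b i * (a_ i f * g) = b i * (f * g).
  by rewrite !mulrA (coef_abs hcb).
case: ifP => _; case: ifP => _; rewrite ?cactD ?(cactM hact) ?Ec ?Eb ?mulrDr ?abs; ring.
Qed.

Lemma lmul_quad i : lmul i * lmul i = scal (c i) + scal (b i) * lmul i.
Proof.
apply: endoP => x; apply: mcoefP => w.
rewrite endoDE mcoefD !endoME !scalE !lmulE !sKw (desc_mul cox).
have aa (f : S) : a_ i (a_ i f) = f.
  by rewrite (cact_comp hact) (cox_sK cox) (cact1g hact).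
case: (desc pos i w) => /=; rewrite ?cactD ?(cactM hact) ?aa ?c_fix ?b_fix.
  by rewrite !mulrDr -(coef_abs hcb i (mcoef x w)) -(coef_abs hcb i (mcoef x _)).
by rewrite !mulrDr [b i * (c i * _)]mulrCA (coef_abs hcb).
Qed.

Definition lmuls (e : seq 'I_l) : endo M := \prod_(i <- e) lmul i.

Lemma lmuls_cons i e : lmuls (i :: e) = lmul i * lmuls e.
Proof. exact: big_cons. Qed.

Lemma lmuls_right e : commutes_right (lmuls e).
Proof.
elim: e => [|i e IHe] j x; first by rewrite /lmuls big_nil !endo1E.
by rewrite lmuls_cons !endoME IHe lmul_right.
Qed.

Lemma lmuls_scal e (a : S) : lmuls e * scal a = scal (cact act (wprod s e) a) * lmuls e.
Proof.
elim: e => [|i e IHe].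
  by rewrite /lmuls /wprod !big_nil (cact1g hact) mul1r mulr1.
by rewrite lmuls_cons -mulrA IHe mulrA lmul_scal -mulrA wprod_cons -(cact_comp hact).
Qed.

Lemma vec_decomp (x : M) : x = \sum_w scal (mcoef x w) (basis_vec w).
Proof.
apply: mcoefP => w; rewrite mcoef_sum (bigD1 w) //= big1 => [|y /negPf yw].
  by rewrite addr0 scalE mcoefE eqxx mulr1.
by rewrite scalE mcoefE eq_sym yw mulr0.
Qed.

Lemma right_basis j w : pos w j -> right_fun j (basis_vec w) = basis_vec (w * s j)%g.
Proof.
move=> p; apply: mcoefP => y; rewrite right_funE !mcoefE.
have eqs : ((y * s j)%g == w) = (y == (w * s j)%g).
  by apply/eqP/eqP => [<-|->]; rewrite wKs.
have [->|neq] := eqVneq y (w * s j)%g.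
  rewrite (cox_posN cox) p /= wKs eqxx.
  have -> : ((w * s j)%g == w) = false.
    apply/eqP => E; move: p; rewrite (posE cox) E ltnn; by [].
  by rewrite mulr0 addr0.
rewrite eqs (negPf neq); have [->|nw] := eqVneq y w; last by rewrite !mulr0 addr0 if_same.
by rewrite p mulr0.
Qed.

Lemma left_basis i w : ~~ desc pos i w -> lmul i (basis_vec w) = basis_vec (s i * w)%g.
Proof.
move=> nd; apply: mcoefP => y; rewrite lmulE !mcoefE.
have eqs : ((s i * y)%g == w) = (y == (s i * w)%g).
  by apply/eqP/eqP => [<-|->]; rewrite sKw.
have cact_nat w' (p : bool) : cact act w' (p%:R : S) = p%:R.
  case: p => /=; first exact: cact_one.
  by apply/ffunP => v; rewrite !ffunE.
have [->|neq] := eqVneq y (s i * w)%g.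
  rewrite (desc_mul cox) nd /= sKw eqxx !cact_nat.
  have -> : ((s i * w)%g == w) = false.
    by apply/eqP => E; move: (len_descN cox nd); rewrite E; lia.
  by rewrite mulr0 addr0.
rewrite eqs (negPf neq) !cact_nat; have [->|nw] := eqVneq y w.
  by rewrite (negPf nd) mulr0.
by rewrite !mulr0 addr0 if_same.
Qed.

Lemma lmuls_basis e : reduced cox e -> lmuls e (basis_vec 1%g) = basis_vec (wprod s e).
Proof.
elim: e => [|i e IHe]; first by rewrite /lmuls /wprod !big_nil endo1E.
move=> re; have [re' d] := reduced_tail re.
rewrite lmuls_cons endoME IHe // left_basis ?wprod_cons //.
by move: d; rewrite wprod_cons (desc_mul cox).
Qed.

(** The right multiplications carry the unit vector to every basis vector, one
    letter at a time. *)
Lemma right_endo_eq (E E' : endo M) (w0 : W) :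
    commutes_right E -> commutes_right E' ->
    (forall a, E * scal a = scal (cact act w0 a) * E) ->
    (forall a, E' * scal a = scal (cact act w0 a) * E') ->
  E (basis_vec 1%g) = E' (basis_vec 1%g) -> E = E'.
Proof.
move=> rE rE' sE sE' E1.
have Ew w : E (basis_vec w) = E' (basis_vec w).
  have [n] := ubnP (len cox w); elim: n w => // n IHn w; rewrite ltnS => lew.
  have [e se we] := len_word cox w.
  case: (lastP e) se we => [|e' j] se we.
    by rewrite -we /wprod big_nil.
  have p : pos (wprod s e') j.
    rewrite (posE cox) -wprod_rcons we -se size_rcons ltnS; exact: len_le.
  rewrite -we wprod_rcons -(right_basis p) rE rE' IHn //.
  by apply: leq_trans lew; rewrite -se size_rcons ltnS len_le.
have sumE (F : endo M) (I : finType) (G : I -> M) : F (\sum_i G i) = \sum_i F (G i).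
  by apply: (big_morph F (endo_funD F) (endo_fun0 F)).
apply: endoP => x; rewrite [x]vec_decomp !sumE; apply: eq_bigr => w _.
by rewrite -!endoME sE sE' !endoME Ew.
Qed.

(** Both sides commute with the right multiplications and send the unit vector to
    the basis vector of the same element of W. *)
Lemma lmul_braid i j : i != j ->
  \prod_(k <- alt i j (m i j)) lmul k = \prod_(k <- alt j i (m i j)) lmul k.
Proof.
move=> ij.
have Ew : wprod s (alt i j (m i j)) = wprod s (alt j i (m i j)) := cox_braid cox ij.
have ri : reduced cox (alt i j (m i j)).
  by rewrite /reduced (len_alt cox) // size_alt.
have rj : reduced cox (alt j i (m i j)).
  by rewrite /reduced (len_alt cox) ?size_alt // 1?eq_sym // (cox_mC cox).
apply: (@right_endo_eq (lmuls _) (lmuls _) (wprod s (alt i j (m i j)))).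
- exact: lmuls_right.
- exact: lmuls_right.
- exact: lmuls_scal.
- by move=> a; rewrite lmuls_scal Ew.
- by rewrite !lmuls_basis // Ew.
Qed.

Lemma scal_sum I (r : seq I) (F : I -> S) :
  scal (\sum_(i <- r) F i) = \sum_(i <- r) scal (F i).
Proof. exact: (big_morph scal scalD scal0). Qed.

Lemma conv_eval_model f :
  conv_eval (@endo_cst R M) (fun v => scal (conv_delta R v)) f = scal f.
Proof.
rewrite [in RHS](convE f) scal_sum; apply: eq_bigr => v _.
by rewrite scalZ.
Qed.

Lemma model_rep : generic_rep s m act c b (@endo_cst R M)
  (fun v => scal (conv_delta R v)) lmul.
Proof.
split.
- by rewrite conv_delta0 scal1.
- by move=> v w; rewrite conv_deltaD scalM.
- by move=> i v; rewrite lmul_scal cact_delta.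
- exact: lmul_braid.
- by move=> i; rewrite !conv_eval_model lmul_quad.
Qed.

End Model.

(** * Freeness of the generic algebra *)

Section Spanning.
Variables (T : finZmodType) (R : comNzRingType) (W : finGroupType) (l : nat).
Variables (s : 'I_l -> W) (pos : W -> 'I_l -> bool) (m : 'I_l -> 'I_l -> nat).
Hypothesis cox : coxeter_system s pos m.
Variable act : W -> T -> T.
Hypothesis hact : torus_action act.
Variables c b : 'I_l -> conv T R.
Local Notation S := (conv T R).
Local Notation M := (model T R W).

Variables (B : pzAlgType R) (tau : T -> B) (xi : 'I_l -> B).
Hypothesis hB : generic_rep s m act c b (@alg_cst R B) tau xi.
Local Notation cst := (@alg_cst R B).
Local Notation sig := (conv_eval cst tau).

Lemma conv_evalD f h : sig (f + h) = sig f + sig h.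
Proof.
by rewrite -big_split; apply: eq_bigr => v _; rewrite ffunE rmorphD mulrDl.
Qed.

Lemma conv_eval0 : sig 0 = 0.
Proof. by apply: (addrI (sig 0)); rewrite -conv_evalD !addr0. Qed.

Lemma conv_evalM f h : sig (f * h) = sig f * sig h.
Proof.
rewrite mulr_suml; under [RHS]eq_bigr do rewrite mulr_sumr.
transitivity (\sum_v \sum_x cst (f x * h (v - x)) * tau v).
  by apply: eq_bigr => v _; rewrite convM rmorph_sum mulr_suml.
rewrite exchange_big; apply: eq_bigr => x _.
rewrite (reindex_inj (addrI x)) /=; apply: eq_bigr => v _.
rewrite [x + v]addrC addrK addrC (gen_tauD hB) rmorphM.
by rewrite !mulrA; congr (_ * _); rewrite -!mulrA; congr (_ * _); exact: alg_cstC.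
Qed.

Lemma conv_eval_delta v : sig (conv_delta R v) = tau v.
Proof.
rewrite /conv_eval (bigD1 v) //= ffunE eqxx rmorph1 mul1r big1 ?addr0 // => x /negPf xv.
by rewrite ffunE xv rmorph0 mul0r.
Qed.

Lemma conv_eval_one : sig 1 = 1.
Proof. by rewrite -conv_delta0 conv_eval_delta (gen_tau0 hB). Qed.

Lemma conv_eval_act i f : xi i * sig f = sig (cact act (s i) f) * xi i.
Proof.
rewrite mulr_sumr mulr_suml (reindex_inj (act_inj hact (w := (s i)^-1%g))) /=.
apply: eq_bigr => v _; rewrite ffunE mulrA -alg_cstC -!mulrA; congr (_ * _).
by rewrite (gen_act hB) (actKV hact).
Qed.

Definition red_word (w : W) : seq 'I_l := s2val (cid2 (len_word cox w)).

Lemma red_wordP w : reduced cox (red_word w) /\ wprod s (red_word w) = w.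
Proof. by rewrite /red_word /reduced; case: cid2 => e /= -> ->. Qed.

(** The lift of an element of W along any of its reduced words. *)
Definition lift (w : W) : B := \prod_(k <- red_word w) xi k.

Lemma lift_up i w : ~~ desc pos i w -> xi i * lift w = lift (s i * w)%g.
Proof.
move=> nd; have [rw ww] := red_wordP w; have [rw' ww'] := red_wordP (s i * w)%g.
rewrite /lift; transitivity (\prod_(k <- i :: red_word w) xi k); first by rewrite big_cons.
have Ew : wprod s (i :: red_word w) = (s i * w)%g by rewrite wprod_cons ww.
have ri : reduced cox (i :: red_word w).
  by rewrite /reduced Ew (len_descN cox nd) -{2}ww -rw.
by apply: (matsumoto (gen_braid hB) ri rw'); rewrite Ew ww'.
Qed.

Lemma lift1 : lift 1%g = 1.
Proof.
have [rw ww] := red_wordP 1%g; rewrite /lift.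
have : size (red_word 1%g) = 0%N by rewrite rw ww len1.
by move/size0nil->; rewrite big_nil.
Qed.

Definition from_model (x : M) : B := \sum_w sig (mcoef x w) * lift w.

Lemma from_modelD x y : from_model (x + y) = from_model x + from_model y.
Proof.
by rewrite -big_split; apply: eq_bigr => w _; rewrite mcoefD conv_evalD mulrDl.
Qed.

Lemma from_model_scal a x : from_model (scal W a x) = sig a * from_model x.
Proof.
rewrite mulr_sumr; apply: eq_bigr => w _.
by rewrite scalE conv_evalM mulrA.
Qed.

Lemma from_modelZ k x : from_model (k *: x) = cst k * from_model x.
Proof.
rewrite mulr_sumr; apply: eq_bigr => w _.
rewrite mcoefZ mulrA; congr (_ * _); rewrite mulr_sumr; apply: eq_bigr => v _.
by rewrite convZE rmorphM mulrA.
Qed.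

(** W is cut into pairs w, s i * w of which one element is shortened by s i. *)
Lemma from_model_lmul i x :
  from_model (lmul s pos act c b i x) = xi i * from_model x.
Proof.
have xiM w : xi i * (sig (mcoef x w) * lift w) =
    sig (cact act (s i) (mcoef x w)) * (xi i * lift w).
  by rewrite mulrA conv_eval_act mulrA.
have xi_desc w : desc pos i w ->
    xi i * lift w = sig (c i) * lift (s i * w)%g + sig (b i) * lift w.
  move=> d; have nd : ~~ desc pos i (s i * w)%g by rewrite (desc_mul cox) d.
  have E := lift_up nd; rewrite (mulsK cox) in E.
  by rewrite -E mulrA (gen_quad hB) mulrDl -mulrA E.
rewrite [RHS]mulr_sumr; under [RHS]eq_bigr do rewrite xiM.
rewrite /from_model [LHS](bigID (desc pos i)) [RHS](bigID (desc pos i)) /=.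
have -> : \sum_(w | desc pos i w) sig (mcoef (lmul s pos act c b i x) w) * lift w =
    \sum_(w | ~~ desc pos i w) sig (cact act (s i) (mcoef x w)) * (xi i * lift w) +
    \sum_(w | desc pos i w) sig (b i * cact act (s i) (mcoef x w)) * lift w.
  rewrite [X in _ = X + _](reindex_inj (mulgI (s i))) /=.
  under [X in _ = X + _]eq_bigl do rewrite (desc_mul cox) negbK.
  rewrite -big_split; apply: eq_bigr => w d /=.
  rewrite lmulE d conv_evalD mulrDl lift_up ?(mulsK cox) //.
  by rewrite (desc_mul cox) d.
have -> : \sum_(w | ~~ desc pos i w) sig (mcoef (lmul s pos act c b i x) w) * lift w =
    \sum_(w | desc pos i w) sig (c i * cact act (s i) (mcoef x w)) * lift (s i * w)%g.
  rewrite [RHS](reindex_inj (mulgI (s i))) /=.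
  under [RHS]eq_bigl do rewrite (desc_mul cox).
  by apply: eq_bigr => w /negPf nd; rewrite lmulE nd (mulsK cox).
rewrite -addrA [RHS]addrC; congr (_ + _); rewrite -big_split /=.
apply: eq_bigr => w d; rewrite (xi_desc _ d) mulrDr addrC !mulrA -!conv_evalM.
by rewrite [c i * _]mulrC [b i * _]mulrC.
Qed.

Lemma from_model_basis w : from_model (basis_vec T R w) = lift w.
Proof.
rewrite /from_model (bigD1 w) //= mcoefE eqxx conv_eval_one mul1r big1 ?addr0 //.
by move=> y /negPf yw; rewrite mcoefE yw conv_eval0 mul0r.
Qed.

Lemma from_model1 : from_model (basis_vec T R 1%g) = 1.
Proof. by rewrite from_model_basis lift1. Qed.

(** The family [tau v * lift w], listed along an enumeration of T * W. *)
Variables (N : nat) (e : 'I_N -> T * W).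
Hypothesis e_bij : bijective e.

Definition gen_basis (k : 'I_N) : B := tau (e k).1 * lift (e k).2.

Lemma from_modelE x :
  from_model x = \sum_k cst (mcoef x (e k).2 (e k).1) * gen_basis k.
Proof.
rewrite -(reindex e (P := xpredT)
  (F := fun p => cst (mcoef x p.2 p.1) * (tau p.1 * lift p.2))) /=; last first.
  exact: onW_bij _ e_bij.
transitivity (\sum_w \sum_v cst (mcoef x w v) * (tau v * lift w)).
  apply: eq_bigr => w _; rewrite mulr_suml; apply: eq_bigr => v _.
  by rewrite mulrA.
by rewrite exchange_big pair_bigA.
Qed.

Lemma gen_basis_ind (co : B -> 'I_N -> R) : coordinates gen_basis co ->
  forall P : B -> Prop, (forall k, P (cst k)) -> (forall v, P (tau v)) ->
    (forall i, P (xi i)) -> (forall x y, P x -> P y -> P (x + y)) ->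
    (forall x y, P x -> P y -> P (x * y)) -> forall x, P x.
Proof.
move=> hco P Pc Pt Px PD PM x; rewrite (coordE hco x).
have P0 : P 0 by have := Pc 0; rewrite rmorph0.
have P1 : P 1 by have := Pc 1; rewrite rmorph1.
apply: (big_ind P) => // k _; apply: (PM _ _ (Pc _)); apply: (PM _ _ (Pt _)).
by apply: (big_ind P) => [|y z|i _]; [exact: P1 | exact: PM | exact: Px].
Qed.

Section Free.
Variable to_model : B -> M.
Hypothesis to_modelK : cancel to_model from_model.
Hypothesis from_modelK : cancel from_model to_model.

Lemma model_coordinates :
  coordinates gen_basis (fun a k => mcoef (to_model a) (e k).2 (e k).1).
Proof.
split=> [x|k i]; first by rewrite -from_modelE to_modelK.
have [e' eK e'K] := e_bij.
pose x : M := mvec (fun w => [ffun v => k (e' (v, w))] : S).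
have xE q : mcoef x (e q).2 (e q).1 = k q.
  by rewrite mcoefE ffunE -surjective_pairing eK.
under eq_bigr do rewrite -xE.
by rewrite -from_modelE from_modelK xE.
Qed.

End Free.

Lemma coordinates_model (co : B -> 'I_N -> R) : coordinates gen_basis co ->
  exists to_model : B -> M, [/\ cancel to_model from_model, cancel from_model to_model &
    forall a k, co a k = mcoef (to_model a) (e k).2 (e k).1].
Proof.
move=> hco; have [e' eK e'K] := e_bij.
pose to_model a : M := mvec (fun w => [ffun v => co a (e' (v, w))] : S).
have toE a k : mcoef (to_model a) (e k).2 (e k).1 = co a k.
  by rewrite mcoefE ffunE -surjective_pairing eK.
exists to_model; split=> [a|x|a k]; last by rewrite toE.
  by rewrite from_modelE {2}(coordE hco a); apply: eq_bigr => k _; rewrite toE.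
apply: mcoefP => w; apply/ffunP => v; rewrite mcoefE ffunE from_modelE.
rewrite (coord_comb hco (fun k => mcoef x (e k).2 (e k).1)) e'K.
by [].
Qed.

End Spanning.

Section Freeness.
Variables (T : finZmodType) (R : comNzRingType) (W : finGroupType) (l : nat).
Variables (s : 'I_l -> W) (pos : W -> 'I_l -> bool) (m : 'I_l -> 'I_l -> nat).
Hypothesis cox : coxeter_system s pos m.
Variable act : W -> T -> T.
Hypothesis hact : torus_action act.
Variables c b : 'I_l -> conv T R.
Hypothesis hcb : good_coefs s act c b.
Local Notation M := (model T R W).

Variables (A : pzAlgType R) (tau : T -> A) (xi : 'I_l -> A).
Hypothesis hA : generic_rep s m act c b (@alg_cst R A) tau xi.
Hypothesis A_ind : forall P : A -> Prop, (forall k, P (alg_cst k)) ->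
  (forall v, P (tau v)) -> (forall i, P (xi i)) ->
  (forall x y, P x -> P y -> P (x + y)) -> (forall x y, P x -> P y -> P (x * y)) ->
  forall x, P x.

Variable rho : A -> endo M.
Hypotheses (rhoB : zmod_morphism rho) (rhoM : monoid_morphism rho).
Hypothesis rho_cst : forall k, rho (alg_cst k) = endo_cst M k.
Hypothesis rho_tau : forall v, rho (tau v) = scal W (conv_delta R v).
Hypothesis rho_xi : forall i, rho (xi i) = lmul s pos act c b i.

Let psi := from_model cox tau xi.
Let phi (a : A) : M := rho a (basis_vec T R 1%g).

Let rho0 : rho 0 = 0.
Proof. by rewrite -[0 in LHS](subrr 0) rhoB subrr. Qed.

Let rhoD x y : rho (x + y) = rho x + rho y.
Proof. by rewrite -[y in LHS]opprK rhoB -[- y]sub0r rhoB rho0 sub0r opprK. Qed.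

Let rho_sum I (r : seq I) (F : I -> A) : rho (\sum_(i <- r) F i) = \sum_(i <- r) rho (F i).
Proof. exact: (big_morph rho rhoD rho0). Qed.

Let psi_rho a x : psi (rho a x) = a * psi x.
Proof.
elim/A_ind: a x => [k|v|i|a a' IH IH'|a a' IH IH'] x.
- by rewrite rho_cst endo_cstE [LHS](from_modelZ cox).
- by rewrite rho_tau [LHS](from_model_scal cox hA) (conv_eval_delta tau).
- by rewrite rho_xi [LHS](from_model_lmul cox hact hA).
- by rewrite rhoD endoDE [LHS](from_modelD cox) -/psi IH IH' mulrDl.
- by rewrite rhoM.2 endoME IH IH' mulrA.
Qed.

Lemma free_from_model : cancel phi psi.
Proof. by move=> a; rewrite /phi psi_rho [psi _](from_model1 cox hA) mulr1. Qed.

Lemma free_to_model : cancel psi phi.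
Proof.
move=> x; rewrite /phi /psi /from_model rho_sum.
have sumE I (r : seq I) (F : I -> endo M) y : (\sum_(i <- r) F i : endo M) y = \sum_(i <- r) F i y.
  by elim/big_rec2: _ => [|i y1 y2 _ <-].
rewrite sumE [RHS]vec_decomp; apply: eq_bigr => w _; rewrite rhoM.2 endoME.
have -> : rho (conv_eval (@alg_cst R A) tau (mcoef x w)) = scal W (mcoef x w).
  rewrite rho_sum [in RHS](convE (mcoef x w)) scal_sum; apply: eq_bigr => v _.
  by rewrite rhoM.2 rho_cst rho_tau scalZ.
congr (scal _ _ _); have [rw ww] := red_wordP cox w.
rewrite /lift -{2}ww -(lmuls_basis hact c b rw); congr (endo_fun _ _).
rewrite /lmuls; elim: (red_word cox w) => [|i q IHq]; first by rewrite !big_nil rhoM.1.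
by rewrite !big_cons rhoM.2 rho_xi IHq.
Qed.

(** Applying an element of A, acting through rho, to the unit vector inverts
    [from_model]. *)
Theorem generic_free N (e : 'I_N -> T * W) : bijective e ->
  exists co, coordinates (gen_basis cox tau xi e) co.
Proof.
move=> e_bij; eexists.
exact: (model_coordinates e_bij free_from_model free_to_model).
Qed.

End Freeness.

(** * Nondegeneracy of the trace form by positivity *)

Section Positivity.
Variables (T : finZmodType) (F : numClosedFieldType) (W : finGroupType) (l : nat).
Variables (s : 'I_l -> W) (pos : W -> 'I_l -> bool) (m : 'I_l -> 'I_l -> nat).
Hypothesis cox : coxeter_system s pos m.
Variable act : W -> T -> T.
Hypothesis hact : torus_action act.
Variables c b : 'I_l -> conv T F.
Hypothesis hcb : good_coefs s act c b.
Local Notation S := (conv T F).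
Local Notation M := (model T F W).
Local Notation a_ i := (cact act (s i)).

Variables (kappa : F) (h : 'I_l -> T).
Hypothesis kappa_gt0 : 0 < kappa.
Hypothesis cE : forall i, c i = kappa *: conv_delta F (h i).
Hypothesis h2 : forall i, h i + h i = 0.
Hypothesis h_fix : forall i, act (s i) (h i) = h i.
Hypothesis b_real : forall i v, (b i v)^* = b i v.
Hypothesis b_sym : forall i v, b i (- v) = b i v.
Hypothesis b_abs : forall i, conv_delta F (h i) * b i = b i.

Definition torus_form (f g : S) : F := \sum_v (f v)^* * g v.

Lemma torus_form_delta v f g :
  torus_form (conv_delta F v * f) g = torus_form f (conv_delta F (- v) * g).
Proof.
rewrite /torus_form (reindex_inj (addIr v)) /=; apply: eq_bigr => x _.
by rewrite !conv_deltaM addrK opprK.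
Qed.

Lemma torus_form_act w f g :
  torus_form (cact act w f) g = torus_form f (cact act w^-1%g g).
Proof.
rewrite /torus_form (reindex_inj (act_inj hact (w := w))) /=; apply: eq_bigr => x _.
by rewrite !ffunE (actK hact) invgK.
Qed.

Lemma torus_formDl f f' g : torus_form (f + f') g = torus_form f g + torus_form f' g.
Proof. by rewrite -big_split; apply: eq_bigr => v _; rewrite ffunE rmorphD mulrDl. Qed.

Lemma torus_formDr f g g' : torus_form f (g + g') = torus_form f g + torus_form f g'.
Proof. by rewrite -big_split; apply: eq_bigr => v _; rewrite ffunE mulrDr. Qed.

Lemma torus_formZr k f g : torus_form f (k *: g) = k * torus_form f g.
Proof. by rewrite mulr_sumr; apply: eq_bigr => v _; rewrite convZE mulrCA. Qed.

Lemma torus_formZl k f g : torus_form (k *: f) g = k^* * torus_form f g.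
Proof. by rewrite mulr_sumr; apply: eq_bigr => v _; rewrite convZE rmorphM mulrA. Qed.

Lemma torus_form_b i f g : torus_form (b i * f) g = torus_form f (b i * g).
Proof.
rewrite /torus_form; under eq_bigr do rewrite convM rmorph_sum mulr_suml.
under [RHS]eq_bigr do rewrite convM mulr_sumr.
rewrite exchange_big [RHS]exchange_big /= (reindex_inj oppr_inj) /=.
apply: eq_bigr => x _; rewrite (reindex_inj (addIr (- x))) /=; apply: eq_bigr => v _.
by rewrite opprK subrK rmorphM /= b_sym b_real; ring.
Qed.

(** The Hermitian form for which the vectors t * basis_vec w are orthogonal, with
    square length kappa ^ len w. *)
Definition mform (x y : M) : F :=
  \sum_w kappa ^+ len cox w * torus_form (mcoef x w) (mcoef y w).

Lemma mformDl x x' y : mform (x + x') y = mform x y + mform x' y.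
Proof.
by rewrite -big_split; apply: eq_bigr => w _; rewrite mcoefD torus_formDl mulrDr.
Qed.

Lemma mformDr x y y' : mform x (y + y') = mform x y + mform x y'.
Proof.
by rewrite -big_split; apply: eq_bigr => w _; rewrite mcoefD torus_formDr mulrDr.
Qed.

Lemma mformZl k x y : mform (k *: x) y = k^* * mform x y.
Proof.
by rewrite mulr_sumr; apply: eq_bigr => w _; rewrite mcoefZ torus_formZl mulrCA.
Qed.

Lemma mformZr k x y : mform x (k *: y) = k * mform x y.
Proof.
by rewrite mulr_sumr; apply: eq_bigr => w _; rewrite mcoefZ torus_formZr mulrCA.
Qed.

Lemma mform_scal v x y :
  mform (scal W (conv_delta F v) x) y = mform x (scal W (conv_delta F (- v)) y).
Proof. by apply: eq_bigr => w _; rewrite !scalE torus_form_delta. Qed.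

Local Notation L i := (lmul s pos act c b i).

(** The multiplication by [xi i] exchanges the coordinates at w and s i * w, and a
    factor kappa on the way down makes up for the weights of the form; the part in
    [b i] is self-adjoint. *)
Lemma mform_lmul i x y :
  mform (L i x) y = mform x (scal W (conv_delta F (h i)) (L i y)).
Proof.
have sV : (s i)^-1%g = s i := simpleV cox i.
have swap f g : torus_form (a_ i f) g = torus_form f (a_ i g).
  by rewrite torus_form_act sV.
have sc (f g : S) : f * (kappa *: g) = kappa *: (f * g).
  by rewrite mulrC -conv_scalel mulrC.
have kr : kappa^* = kappa by apply/CrealP; exact: gtr0_real.
have hN : - h i = h i by apply/eqP; rewrite eq_sym -addr_eq0 h2.
have hh f : conv_delta F (h i) * (conv_delta F (h i) * f) = f.
  by rewrite mulrA -conv_deltaD h2 conv_delta0 mul1r.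
have ah f : a_ i (conv_delta F (h i) * f) = conv_delta F (h i) * a_ i f.
  by rewrite (cactM hact) (cact_delta _ hact) h_fix.
have swap_h f g : torus_form (conv_delta F (h i) * f) g = torus_form f (conv_delta F (h i) * g).
  by rewrite torus_form_delta hN.
have ab f : a_ i (b i * f) = b i * a_ i f.
  by rewrite (cactM hact) [cact _ _ (b i)](coef_b hcb (i := i)).
rewrite /mform (bigID (desc pos i)) [RHS](bigID (desc pos i)) /=.
pose t1 w := kappa ^+ len cox w * torus_form (a_ i (mcoef x (s i * w)%g)) (mcoef y w).
pose t2 w := kappa ^+ len cox w * torus_form (b i * a_ i (mcoef x w)) (mcoef y w).
pose t3 w := kappa ^+ len cox w *
  torus_form (mcoef x w) (conv_delta F (h i) * a_ i (mcoef y (s i * w)%g)).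
have lenS w : desc pos i w -> kappa ^+ len cox w = kappa * kappa ^+ len cox (s i * w)%g.
  by move=> d; rewrite -(len_desc cox d) exprS.
transitivity (\sum_(w | desc pos i w) t1 w + \sum_(w | desc pos i w) t2 w +
              \sum_(w | desc pos i w) t3 w).
  congr (_ + _).
    rewrite -big_split; apply: eq_bigr => w d /=.
    by rewrite lmulE d torus_formDl mulrDr.
  rewrite (reindex_inj (mulgI (s i))) /=; apply: eq_big => w.
    by rewrite (desc_mul cox) negbK.
  rewrite (desc_mul cox) negbK => d.
  rewrite lmulE (desc_mul cox) d /= (mulsK cox) cE -conv_scalel torus_formZl.
  rewrite swap_h swap ah /t3 (lenS w d) kr.
  by rewrite mulrCA mulrA.
transitivity (\sum_(w | desc pos i w) t3 w + \sum_(w | desc pos i w) t2 w +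
              \sum_(w | desc pos i w) t1 w); first by ring.
congr (_ + _).
  rewrite -big_split; apply: eq_bigr => w d /=.
  rewrite scalE lmulE d mulrDr torus_formDr mulrDr /t3 /t2; congr (_ + _ * _).
  by rewrite mulrA b_abs torus_form_b swap ab.
rewrite [RHS](reindex_inj (mulgI (s i))) /=; apply: eq_big => w.
  by rewrite (desc_mul cox) negbK.
move=> d; rewrite scalE lmulE (desc_mul cox) d /= (mulsK cox) cE -conv_scalel.
rewrite sc hh torus_formZr -swap /t1 (lenS w d).
by rewrite mulrCA mulrA.
Qed.

Lemma torus_form_ge0 f : 0 <= torus_form f f.
Proof. by apply: sumr_ge0 => v _; rewrite mulrC mul_conjC_ge0. Qed.

Lemma mform_term_ge0 x w : 0 <= kappa ^+ len cox w * torus_form (mcoef x w) (mcoef x w).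
Proof. by rewrite mulr_ge0 ?torus_form_ge0 // exprn_ge0 // ltW. Qed.

Lemma mform_ge0 x : 0 <= mform x x.
Proof. by apply: sumr_ge0 => w _; exact: mform_term_ge0. Qed.

Lemma mform_eq0 x : mform x x = 0 -> x = 0.
Proof.
move=> x0; apply: mcoefP => w; apply/ffunP => v; rewrite mcoef0 ffunE.
have E := psumr_eq0P (fun w _ => mform_term_ge0 x w) x0.
have /eqP := E w isT.
rewrite mulf_eq0 expf_eq0 (gt_eqF kappa_gt0) andbF /= => /eqP f0.
have {}E : forall v, true -> (mcoef x w v)^* * mcoef x w v = 0.
  by apply: psumr_eq0P f0 => y _; rewrite mulrC mul_conjC_ge0.
by have /eqP := E v isT; rewrite mulf_eq0 conjC_eq0 orbb => /eqP.
Qed.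

Variables (B : pzAlgType F) (tau : T -> B) (xi : 'I_l -> B).
Hypothesis hB : generic_rep s m act c b (@alg_cst F B) tau xi.
Variables (N : nat) (e : 'I_N -> T * W).
Hypothesis e_bij : bijective e.
Local Notation bas := (gen_basis cox tau xi e).
Variable co : B -> 'I_N -> F.
Hypothesis hco : coordinates bas co.

Local Notation psi := (from_model cox tau xi).

(** Every left multiplication has an adjoint that is a left multiplication, so
    the trace of [a' * a] is a sum of squares. *)
Lemma gram_pos_unit : gram bas co \in unitmx.
Proof.
have [phi [phiK psiK coE]] := coordinates_model e_bij hco.
have psi0 : psi 0 = 0 by apply: (addrI (psi 0)); rewrite -(from_modelD cox) !addr0.
have phiD x y : phi (x + y) = phi x + phi y.
  by apply: (can_inj psiK); rewrite (from_modelD cox) !phiK.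
have phiZ k x : phi (alg_cst k * x) = k *: phi x.
  by apply: (can_inj psiK); rewrite (from_modelZ cox) !phiK.
have adj a : exists a', forall x y, mform (phi (a * psi x)) y = mform x (phi (a' * psi y)).
  elim/(gen_basis_ind hco): a => [k|v|i|a1 a2 [a1' E1] [a2' E2]|a1 a2 [a1' E1] [a2' E2]].
  - by exists (alg_cst k^*) => x y; rewrite !phiZ !psiK mformZl mformZr.
  - exists (tau (- v)) => x y.
    by rewrite -!(conv_eval_delta tau) -!(from_model_scal cox hB) !psiK mform_scal.
  - exists (tau (h i) * xi i) => x y.
    rewrite -mulrA -!(from_model_lmul cox hact hB) -(conv_eval_delta tau).
    by rewrite -(from_model_scal cox hB) !psiK mform_lmul.
  - exists (a1' + a2') => x y.
    by rewrite !mulrDl !phiD mformDl mformDr E1 E2.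
  - exists (a2' * a1') => x y.
    by rewrite -!mulrA -[a2 * psi x]phiK E1 E2 phiK.
have nondeg a : (forall x, reg_tr bas co (x * a) = 0) -> a = 0.
  move=> a0; have [a' E] := adj a.
  have wt k : kappa ^+ len cox (e k).2 != 0 by rewrite expf_neq0 // gt_eqF.
  have coF y k : kappa ^+ len cox (e k).2 * co y k = mform (phi (bas k)) (phi y).
    have -> : phi (bas k) = scal W (conv_delta F (e k).1) (basis_vec T F (e k).2).
      apply: (can_inj psiK); rewrite phiK (from_model_scal cox hB).
      by rewrite (conv_eval_delta tau) (from_model_basis cox hB).
    rewrite mform_scal /mform (bigD1 (e k).2) //= big1 ?addr0 => [|w /negPf wk].
      rewrite mcoefE eqxx scalE /torus_form (bigD1 0) //= big1 => [|v /negPf v0].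
        by rewrite addr0 ffunE eqxx conjC1 mul1r conv_deltaM opprK add0r coE.
      by rewrite ffunE v0 conjC0 mul0r.
    by rewrite mcoefE wk /torus_form big1 ?mulr0 // => v _; rewrite ffunE conjC0 mul0r.
  have sq k : co (a' * a * bas k) k =
      (kappa ^+ len cox (e k).2)^-1 * mform (phi (a * bas k)) (phi (a * bas k)).
    apply: (mulfI (wt k)); rewrite coF mulVKf //.
    by have := E (phi (bas k)) (phi (a * bas k)); rewrite !phiK mulrA => ->.
  have := a0 a'; rewrite reg_trE; under eq_bigr do rewrite sq.
  move=> tr0; have ab0 k : a * bas k = 0.
    have E0 : forall k, true ->
        (kappa ^+ len cox (e k).2)^-1 * mform (phi (a * bas k)) (phi (a * bas k)) = 0.
      apply: psumr_eq0P tr0 => q _.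
      by rewrite mulr_ge0 ?mform_ge0 // invr_ge0 exprn_ge0 // ltW.
    have /eqP := E0 k isT; rewrite mulf_eq0 invr_eq0 (negPf (wt k)) /=.
    by move=> /eqP/mform_eq0 E1; rewrite -[LHS]phiK E1 psi0.
  rewrite -[a]mulr1 (coordE hco 1) mulr_sumr big1 // => k _.
  by rewrite mulrA -alg_cstC -mulrA ab0 mulr0.
rewrite unitmxE unitfE; apply/det0P => -[v v0 vG].
case/eqP: v0; pose a := \sum_i alg_cst (v 0 i) * bas i.
have a0 : a = 0.
  apply: nondeg => x; rewrite (coordE hco x) mulr_suml (reg_tr_sum hco) big1 // => k _.
  rewrite -mulrA (reg_trZ hco) /a [gen_basis _ _ _ _ k * _]mulr_sumr (reg_tr_sum hco).
  have /matrixP/(_ 0 k) := vG; rewrite !mxE => vGk.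
  rewrite [X in _ * X](_ : _ = 0) ?mulr0 // -[RHS]vGk; apply: eq_bigr => i _.
  by rewrite mxE mulrA -alg_cstC -mulrA (reg_trZ hco) (reg_trC hco).
apply/rowP => i; rewrite mxE -(coord_comb hco (v 0) i) [X in co X]a0.
exact: coord0 hco i.
Qed.

End Positivity.

(** * The Weyl groups *)

Section IntegerVectors.
Variable n : nat.
Implicit Types x y z : 'cV[int]_n.

Definition dot x y : int := \sum_k x k 0 * y k 0.

Lemma dotC x y : dot x y = dot y x.
Proof. by apply: eq_bigr => k _; rewrite mulrC. Qed.

Lemma dotDl x y z : dot (x + y) z = dot x z + dot y z.
Proof. by rewrite -big_split; apply: eq_bigr => k _; rewrite mxE mulrDl. Qed.

Lemma dotZl a x y : dot (a *: x) y = a * dot x y.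
Proof. by rewrite mulr_sumr; apply: eq_bigr => k _; rewrite mxE mulrA. Qed.

Lemma dotNl x y : dot (- x) y = - dot x y.
Proof. by rewrite -scaleN1r dotZl mulN1r. Qed.

Lemma dotDr x y z : dot x (y + z) = dot x y + dot x z.
Proof. by rewrite dotC dotDl !(dotC _ x). Qed.

Lemma dotNr x y : dot x (- y) = - dot x y.
Proof. by rewrite dotC dotNl dotC. Qed.

Lemma dotZr a x y : dot x (a *: y) = a * dot x y.
Proof. by rewrite dotC dotZl dotC. Qed.

Lemma dot_ge0 x : 0 <= dot x x.
Proof. by apply: sumr_ge0 => k _; rewrite -expr2 sqr_ge0. Qed.

Lemma dot_eq0 x : dot x x <= 0 -> x = 0.
Proof.
move=> le0; have x0 : dot x x = 0 by apply/eqP; rewrite eq_le le0 dot_ge0.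
apply/colP => k; rewrite mxE; apply/eqP; rewrite -sqrf_eq0 expr2; apply/eqP.
have E : forall k, true -> x k 0 * x k 0 = 0.
  by apply: psumr_eq0P x0 => i _; rewrite -expr2 sqr_ge0.
exact: E.
Qed.

Lemma dot_mxE x y : x^T *m y = (dot x y)%:M.
Proof.
apply/matrixP => i j; rewrite !ord1 !mxE eqxx mulr1n.
by apply: eq_bigr => k _; rewrite mxE.
Qed.

Lemma dot_basis x (a : 'I_n) : dot x (basisH n a) = x a 0.
Proof.
rewrite /dot (bigD1 a) //= mxE eqxx mulr1 big1 ?addr0 // => k /negPf ka.
by rewrite mxE [_ == _]ka mulr0.
Qed.

Lemma dot_basis1 (a : 'I_n) : dot (basisH n a) (basisH n a) = 1.
Proof. by rewrite dot_basis mxE eqxx. Qed.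

Lemma dot_mulmx (w : 'M[int]_n) x y : w^T *m w = 1%:M -> dot (w *m x) (w *m y) = dot x y.
Proof.
move=> ww; have : ((w *m x)^T *m (w *m y)) = x^T *m y.
  by rewrite trmx_mul mulmxA -[x^T *m _ *m _]mulmxA ww mulmx1.
by rewrite !dot_mxE => /matrixP/(_ 0 0); rewrite !mxE.
Qed.

(** The linear form that makes a root positive or negative. *)
Definition height x : int := \sum_(k < n) (k.+1)%:Z * x k 0.

Lemma heightD x y : height (x + y) = height x + height y.
Proof. by rewrite -big_split; apply: eq_bigr => k _; rewrite mxE mulrDr. Qed.

Lemma heightZ a x : height (a *: x) = a * height x.
Proof. by rewrite mulr_sumr; apply: eq_bigr => k _; rewrite mxE mulrCA. Qed.

Lemma heightN x : height (- x) = - height x.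
Proof. by rewrite -scaleN1r heightZ mulN1r. Qed.

Lemma height_basis (a : 'I_n) : height (basisH n a) = (a.+1)%:Z.
Proof.
rewrite /height (bigD1 a) //= mxE eqxx mulr1 big1 ?addr0 // => k /negPf ka.
by rewrite mxE [_ == _]ka mulr0.
Qed.

Lemma norm1P x : dot x x = 1 ->
  exists (a : 'I_n) (e : int), (e = 1 \/ e = -1) /\ x = e *: basisH n a.
Proof.
move=> x1; have [a xa] : exists a, x a 0 != 0.
  apply/not_existsP => x0; suff : x = 0 by move=> E; move: x1; rewrite E -(scale0r 0) dotZl mul0r.
  by apply/colP => k; rewrite mxE; apply/eqP; apply: contra_notT (x0 k).
exists a, (x a 0); pose y := x - x a 0 *: basisH n a.
have yy : dot y y = 1 - x a 0 * x a 0.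
  rewrite /y !(dotDl, dotDr, dotNl, dotNr, dotZl, dotZr) x1 dot_basis1 (dotC _ x) !dot_basis.
  by ring.
have := dot_ge0 y; rewrite yy => ge0; have a1 : x a 0 = 1 \/ x a 0 = -1 by move: xa; nia.
split=> //; apply/eqP; rewrite -subr_eq0; apply/eqP; apply: dot_eq0.
by rewrite -/y yy; case: a1 => ->.
Qed.

Lemma norm2P x : dot x x = 2 ->
  exists (a b : 'I_n) (e f : int), [/\ a != b, e = 1 \/ e = -1, f = 1 \/ f = -1 &
    x = e *: basisH n a + f *: basisH n b].
Proof.
move=> x2; have [a xa] : exists a, x a 0 != 0.
  apply/not_existsP => x0; suff : x = 0 by move=> E; move: x2; rewrite E -(scale0r 0) dotZl mul0r.
  by apply/colP => k; rewrite mxE; apply/eqP; apply: contra_notT (x0 k).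
pose y := x - x a 0 *: basisH n a.
have yy : dot y y = 2 - x a 0 * x a 0.
  rewrite /y !(dotDl, dotDr, dotNl, dotNr, dotZl, dotZr) x2 dot_basis1 (dotC _ x) !dot_basis.
  by ring.
have := dot_ge0 y; rewrite yy => ge0; have a1 : x a 0 = 1 \/ x a 0 = -1 by move: xa; nia.
have [|b [f [f1 yE]]] := norm1P (x := y); first by rewrite yy; case: a1 => ->.
exists a, b, (x a 0), f; split=> //; last by rewrite -yE addrC subrK.
apply/eqP => ab; have := congr1 (fun z => dot z (basisH n a)) yE.
rewrite /y -ab !(dotDl, dotNl, dotZl) dot_basis1 dot_basis; case: f1 => ->; lia.
Qed.

Lemma height_neq0 x : dot x x = 1 \/ dot x x = 2 -> height x != 0.
Proof.
case=> [/norm1P[a [e [e1 ->]]]|/norm2P[a [b [e [f [ab e1 f1 ->]]]]]].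
  by rewrite heightZ height_basis; case: e1 => ->; lia.
rewrite heightD !heightZ !height_basis; move: ab; rewrite -val_eqE /= => ab.
by case: e1 => ->; case: f1 => ->; lia.
Qed.

End IntegerVectors.

Section WeylGroup.
Variables (ty : ctype) (n : nat).
Hypothesis hn : (2 <= n)%N.
Local Notation l := (nb_simple ty n).
Local Notation refl := (refl_mx n ty).

(** A positive multiple or the opposite of the coroot, chosen with positive
    height and of norm 1 or 2. *)
Definition wroot (i : nat) : 'cV[int]_n :=
  match ty, i with
  | (TypeA | TypeAstar), _ => basisH n i.+1 - basisH n i
  | _, k.+1 => basisH n k.+1 - basisH n k
  | TypeD, 0 => basisH n 0 + basisH n 1
  | _, 0 => basisH n 0
  end.

Definition short (i : nat) : bool :=
  match ty, i with (TypeB | TypeC), 0 => true | _, _ => false end.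

Definition refl_coef (i : nat) : int := if short i then 2 else 1.

Lemma dot_basisH a b : (a < n)%N -> (b < n)%N -> dot (basisH n a) (basisH n b) = (a == b)%:R.
Proof.
move=> an bn; rewrite -[b]/(val (Ordinal bn)) dot_basis mxE /= eq_sym.
by rewrite eq_sym.
Qed.

Lemma height_basisH a : (a < n)%N -> height (basisH n a) = (a.+1)%:Z.
Proof. by move=> an; rewrite -[a]/(val (Ordinal an)) height_basis. Qed.

Lemma root_norm (i : 'I_l) : dot (wroot i) (wroot i) = if short i then 1 else 2.
Proof.
have n0 : (0 < n)%N by lia.
case: i => i il; rewrite /wroot /short /=.
move: il; rewrite /nb_simple; case: ty => il; try case: i il => [|k] il;
  rewrite ?(dotDl, dotDr, dotNl, dotNr) ?dot_basisH //; lia.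
Qed.

Lemma rcoef_norm (i : 'I_l) : refl_coef i * dot (wroot i) (wroot i) = 2.
Proof. by rewrite root_norm /refl_coef; case: short. Qed.

Lemma root_height (i : 'I_l) : 0 < height (wroot i).
Proof.
have n0 : (0 < n)%N by lia.
case: i => i il; rewrite /wroot /=.
move: il; rewrite /nb_simple; case: ty => il; try case: i il => [|k] il;
  rewrite ?(heightD, heightN) ?height_basisH //; lia.
Qed.

Lemma root_dot (i j : 'I_l) : i != j ->
  dot (wroot i) (wroot j) = 0 \/ dot (wroot i) (wroot j) = -1.
Proof.
have n0 : (0 < n)%N by lia.
case: i j => i il [j jl]; rewrite -val_eqE /wroot /=.
move: il jl; rewrite /nb_simple; case: ty => il jl; try case: i il => [|i] il;
  try case: j jl => [|j] jl; rewrite ?(dotDl, dotDr, dotNl, dotNr) ?dot_basisH //; lia.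
Qed.

Lemma short_inj (i j : 'I_l) : short i -> short j -> i = j.
Proof.
by case: i j => i il [j jl]; rewrite /short /=; case: ty il jl => //; case: i => //;
  case: j => // ? ? _ _; apply: val_inj.
Qed.

Lemma swap_entry (a b k : nat) : ((a == swap k b)%:R : int) =
  (a == b)%:R - ((a == k.+1)%:R - (a == k)%:R) * ((b == k.+1)%:R - (b == k)%:R).
Proof.
rewrite /swap; have kS : (k == k.+1) = false by rewrite ltn_eqF.
have [->|bk] := eqVneq b k.
  by rewrite kS; have [->|] := eqVneq a k; rewrite ?kS //; case: (a == k.+1).
have [->|bk'] := eqVneq b k.+1; last by rewrite subrr mulr0 subr0.
by have [->|] := eqVneq a k; rewrite ?kS //; case: (a == k.+1).
Qed.

Lemma refl_mxE (i : 'I_l) : refl i = 1%:M - refl_coef i *: (wroot i *m (wroot i)^T).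
Proof.
have n0 : (0 < n)%N by lia.
have transpE k : (k.+1 < n)%N -> transp_mx n k =
    1%:M - (basisH n k.+1 - basisH n k) *m (basisH n k.+1 - basisH n k)^T.
  by move=> kn; apply/matrixP => a b; rewrite !mxE big_ord1 !mxE swap_entry.
have negE : neg1_mx n = 1%:M - 2 *: (basisH n 0 *m (basisH n 0)^T).
  apply/matrixP => a b; rewrite !mxE big_ord1 !mxE -val_eqE /=.
  have [->|ab] := eqVneq (nat_of_ord a) (nat_of_ord b); first by case: (nat_of_ord b).
  by move: ab; rewrite /=; case: (nat_of_ord a) => [|x]; case: (nat_of_ord b) => [|y].
rewrite /refl_mx /refl_coef /short /wroot; case: i => i il /=.
move: il; rewrite /nb_simple; case: ty => il; try case: i il => [|k] il;
  rewrite ?scale1r ?transpE //; try lia.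
have nn : neg1_mx n *m neg1_mx n = 1%:M.
  rewrite /neg1_mx mulmx_diag; apply/matrixP => a b; rewrite !mxE -expr2 sqrr_sign.
  by [].
have <- : neg1_mx n *m (basisH n 1 - basisH n 0) = basisH n 0 + basisH n 1.
  apply/matrixP => a b; rewrite /neg1_mx mul_diag_mx !mxE.
  by case: (nat_of_ord a) => [|[|k]].
move: (basisH n 1 - basisH n 0) => v; rewrite mulmxBr mulmxBl mulmx1 nn trmx_mul.
by rewrite /neg1_mx tr_diag_mx !mulmxA.
Qed.

End WeylGroup.

Section WeylPred.
Variables (ty : ctype) (n : nat).
Hypothesis hn : (2 <= n)%N.
Local Notation l := (nb_simple ty n).
Local Notation refl := (refl_mx n ty).
Local Notation root := (wroot ty n).
Local Notation rcoef := (refl_coef ty).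

Lemma refl_mulE (i : 'I_l) (x : 'cV[int]_n) :
  refl i *m x = x - (rcoef i * dot (root i) x) *: root i.
Proof.
rewrite (refl_mxE hn) mulmxBl mul1mx -scalemxAl -mulmxA dot_mxE mul_mx_scalar.
by rewrite scalerA.
Qed.

Lemma refl_root (i : 'I_l) : refl i *m root i = - root i.
Proof.
rewrite refl_mulE (rcoef_norm hn) -{1}[root i]scale1r -scalerBl.
by rewrite -scaleN1r.
Qed.

Lemma refl_tr (i : 'I_l) : (refl i)^T = refl i.
Proof.
rewrite (refl_mxE hn) linearB /= trmx1 linearZ /= trmx_mul trmxK.
by [].
Qed.

Lemma refl_sqr (i : 'I_l) : refl i *m refl i = 1%:M.
Proof.
rewrite {2}(refl_mxE hn) mulmxBr mulmx1 -scalemxAr mulmxA refl_root mulNmx scalerN.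
by rewrite opprK {1}(refl_mxE hn) subrK.
Qed.

Definition weyl_pred (w : 'M[int]_n) : bool :=
  `[< exists e : seq 'I_l, w = \prod_(i <- e) refl i >].

Lemma weyl_predM w w' : weyl_pred w -> weyl_pred w' -> weyl_pred (w *m w').
Proof.
move=> /asboolP[e ->] /asboolP[e' ->]; apply/asboolP; exists (e ++ e').
by rewrite big_cat.
Qed.

Lemma weyl_pred1 : weyl_pred 1%:M.
Proof. by apply/asboolP; exists [::]; rewrite big_nil. Qed.

Lemma weyl_pred_refl (i : 'I_l) : weyl_pred (refl i).
Proof. by apply/asboolP; exists [:: i]; rewrite big_seq1. Qed.

Lemma weyl_pred_tr w : weyl_pred w -> weyl_pred w^T.
Proof.
move=> /asboolP[e ->]; elim: e => [|i e IHe]; first by rewrite big_nil trmx1 weyl_pred1.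
by rewrite big_cons trmx_mul refl_tr; apply: weyl_predM IHe (weyl_pred_refl i).
Qed.

Lemma weyl_orth w : weyl_pred w -> w^T *m w = 1%:M.
Proof.
move=> /asboolP[e ->]; elim: e => [|i e IHe]; first by rewrite big_nil trmx1 mul1mx.
rewrite big_cons trmx_mul refl_tr -mulmxA [refl i *m (_ *m _)]mulmxA refl_sqr mul1mx.
exact: IHe.
Qed.

(** The matrices with entries -1, 0, 1 that are products of simple reflections;
    the bound on the entries makes the type finite. *)
Definition weyl_seq : seq 'M[int]_n :=
  [seq w <- [seq map_mx (fun k : 'I_3 => (k : nat)%:Z - 1) g | g : 'M['I_3]_n] | weyl_pred w].

Lemma mem_weyl_seq (w : 'M[int]_n) : (w \in weyl_seq) = weyl_pred w.
Proof.
rewrite mem_filter andb_idr // => pw.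
have bound i j : w i j * w i j <= 1.
  have E : \sum_k w^T j k * w k j = 1.
    by have /matrixP/(_ j j) := weyl_orth pw; rewrite mxE => ->; rewrite mxE eqxx.
  rewrite -E (bigD1 i) //= mxE lerDl; apply: sumr_ge0 => k _.
  by rewrite mxE -expr2 sqr_ge0.
apply/mapP; exists (map_mx (fun z : int => inord (absz (z + 1))) w); first by rewrite mem_enum.
apply/matrixP => i j; rewrite !mxE.
have : -1 <= w i j <= 1 by have := bound i j; nia.
by move: (w i j : int) => z z1; rewrite inordK; lia.
Qed.

End WeylPred.

(** The hypothesis on n is an index of the type, because the group structure
    depends on it. *)
Definition weyl (ty : ctype) (n : nat) of (2 <= n)%N : Type := seq_sub (weyl_seq ty n).

Section WeylGroupType.
Variables (ty : ctype) (n : nat) (hn : (2 <= n)%N).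
Local Notation l := (nb_simple ty n).
Local Notation refl := (refl_mx n ty).
Local Notation root := (wroot ty n).
Local Notation rcoef := (refl_coef ty).
Local Notation W := (weyl ty hn).

HB.instance Definition _ := Finite.on W.

Definition wval (w : W) : 'M[int]_n := ssval w.

Lemma wval_inj : injective wval.
Proof. exact: val_inj. Qed.

Lemma wval_pred w : weyl_pred ty (wval w).
Proof. by rewrite -(mem_weyl_seq ty hn); exact: ssvalP. Qed.

Definition mkweyl (w : 'M[int]_n) (pw : weyl_pred ty w) : W :=
  SeqSub (etrans (mem_weyl_seq ty hn w) pw).

Lemma mkweylE w pw : wval (@mkweyl w pw) = w. Proof. by []. Qed.

Definition weyl_mul (w w' : W) : W := mkweyl (weyl_predM (wval_pred w) (wval_pred w')).
Definition weyl_one : W := mkweyl (weyl_pred1 ty n).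
Definition weyl_inv (w : W) : W := mkweyl (weyl_pred_tr hn (wval_pred w)).

Lemma weyl_mulA : associative weyl_mul.
Proof. by move=> x y z; apply: wval_inj; rewrite !mkweylE mulmxA. Qed.
Lemma weyl_mul1 : left_id weyl_one weyl_mul.
Proof. by move=> x; apply: wval_inj; rewrite !mkweylE mul1mx. Qed.
Lemma weyl_mulV : left_inverse weyl_one weyl_inv weyl_mul.
Proof. by move=> x; apply: wval_inj; rewrite !mkweylE (weyl_orth hn (wval_pred _)). Qed.

HB.instance Definition _ := Finite_isGroup.Build W weyl_mulA weyl_mul1 weyl_mulV.

Lemma wvalM (w w' : W) : wval (w * w')%g = wval w *m wval w'. Proof. by []. Qed.
Lemma wval1 : wval 1%g = 1%:M. Proof. by []. Qed.

Definition srefl (i : 'I_l) : W := mkweyl (weyl_pred_refl i).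

Lemma sreflE i : wval (srefl i) = refl i. Proof. by []. Qed.

Lemma wval_prod (e : seq 'I_l) : wval (\prod_(i <- e) srefl i)%g = \prod_(i <- e) refl i.
Proof. by elim: e => [|i e IHe]; rewrite ?big_nil // !big_cons wvalM IHe. Qed.

Lemma wval_dot w x y : dot (wval w *m x) (wval w *m y) = dot x y.
Proof. exact/dot_mulmx/(weyl_orth hn (wval_pred w)). Qed.

Definition wpos (w : W) (i : 'I_l) : bool := 0 < height (wval w *m root i).

Lemma wroot_norm w (i : 'I_l) : dot (wval w *m root i) (wval w *m root i) = 1 \/
  dot (wval w *m root i) (wval w *m root i) = 2.
Proof. by rewrite wval_dot (root_norm hn); case: short; [left|right]. Qed.

Lemma wposN w i : ~~ wpos w i = (height (wval w *m root i) < 0).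
Proof. by rewrite /wpos; have := height_neq0 (wroot_norm w i); lia. Qed.

Lemma root_cases (j : 'I_l) :
  [\/ rcoef j = 1 /\ height (root j) = 1,
      short ty j /\ root j = basisH n 0 |
      [/\ ty = TypeD, rcoef j = 1 & root j = basisH n 0 + basisH n 1]].
Proof.
have n0 : (0 < n)%N by lia.
case: j => j jl; rewrite /refl_coef /short /wroot /=.
move: jl; rewrite /nb_simple; case: ty => jl; try (case: j jl => [|k] jl);
  try (by constructor 2); try (by constructor 3);
  by constructor 1; split=> //; rewrite heightD heightN !height_basisH //; lia.
Qed.

(** The reflection [srefl j] changes the height of a root x by its inner product
    with the root j times a small integer.  If the height becomes negative, the
    inner product is so large that x is the root j. *)
Lemma simple_sign w (i j : 'I_l) : wpos w i -> ~~ wpos (srefl j * w)%g i ->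
  wval w *m root i = root j.
Proof.
rewrite wposN wvalM sreflE -mulmxA; have nx := wroot_norm w i.
rewrite /wpos; move: nx; have := wval_dot w (root i) (root i).
rewrite (root_norm hn); move: (wval w *m root i) => x Ex nx x_gt0.
rewrite (refl_mulE hn) heightD heightN heightZ => sx_lt0.
have nj := rcoef_norm hn j.
have eq_root : dot x x + dot (root j) (root j) <= 2 * dot (root j) x -> x = root j.
  move=> le; apply/eqP; rewrite -subr_eq0; apply/eqP; apply: dot_eq0.
  by rewrite !(dotDl, dotDr, dotNl, dotNr) (dotC x (root j)); lia.
case: (root_cases j) => [[cj hj]|[sj rj]|[tyD cj rj]].
- by apply: eq_root; move: sx_lt0 nj; rewrite cj hj; lia.
- have hj : height (root j) = 1 by rewrite rj height_basisH //; lia.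
  have cj : rcoef j = 2 by rewrite /refl_coef sj.
  rewrite cj hj in sx_lt0; rewrite cj in nj.
  case: nx => nx; first by apply: eq_root; lia.
  have [d2|d1] : 2 <= dot (root j) x \/ dot (root j) x = 1 by lia.
    by apply: eq_root; lia.
  have y1 : dot (x - root j) (x - root j) = 1.
    by rewrite !(dotDl, dotDr, dotNl, dotNr) (dotC x (root j)) d1; lia.
  have := height_neq0 (or_introl y1).
  by rewrite heightD heightN hj; lia.
- have hj : height (root j) = 3.
    by rewrite rj heightD !height_basisH //; lia.
  rewrite cj hj in sx_lt0; rewrite cj in nj.
  have x2 : dot x x = 2.
    have sD (k : nat) : short ty k = false by rewrite /short tyD.
    by rewrite Ex sD.
  have [d2|d1] : 2 <= dot (root j) x \/ dot (root j) x = 1 by lia.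
    by apply: eq_root; lia.
  (* The first root of type D has height 3: an inner product equal to 1 is
     excluded by listing the vectors of norm 2. *)
  have [a [b [e [f [ab e1 f1 xE]]]]] := norm2P x2.
  move: d1 sx_lt0 x_gt0; rewrite rj xE.
  have n0 : (0 < n)%N by lia.
  rewrite !(dotDl, dotDr, dotZr) !heightD !heightZ !height_basis.
  rewrite !dot_basisH //; move: ab; rewrite -val_eqE /= => ab.
  move: (a : nat) (b : nat) ab => a' b' ab.
  by case: e1 => ->; case: f1 => ->; case: a' ab => [|[|a']] ab; case: b' ab => [|[|b']] ab; lia.
Qed.

Lemma conj_simple w (i j : 'I_l) : wval w *m root i = root j ->
  (srefl j * w = w * srefl i)%g.
Proof.
move=> E; apply: wval_inj; rewrite !wvalM !sreflE !(refl_mxE hn).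
have c_eq : rcoef i = rcoef j.
  have := rcoef_norm hn i; have := rcoef_norm hn j.
  by rewrite -E wval_dot (root_norm hn) /refl_coef; do 2!case: short.
rewrite mulmxBl mul1mx mulmxBr mulmx1; congr (_ - _).
rewrite -scalemxAl -scalemxAr c_eq; congr (_ *: _); rewrite -E trmx_mul !mulmxA.
by rewrite -[RHS]mulmx1 -mulmxA -[in RHS]mulmxA -(weyl_orth hn (wval_pred w)) !mulmxA.
Qed.

End WeylGroupType.

Section WeylCoxeter.
Variables (ty : ctype) (n : nat) (hn : (2 <= n)%N).
Local Notation l := (nb_simple ty n).
Local Notation refl := (refl_mx n ty).
Local Notation root := (wroot ty n).
Local Notation rcoef := (refl_coef ty).
Local Notation W := (weyl ty hn).
Local Notation srefl := (@srefl ty n hn).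

Definition cox_order (i j : 'I_l) : nat :=
  if i == j then 1%N
  else if dot (root i) (root j) == 0 then 2%N
  else if rcoef i * rcoef j == 1 then 3%N else 4%N.

Lemma wval_wprod_cons i (e : seq 'I_l) (x : 'cV[int]_n) :
  wval (wprod srefl (i :: e)) *m x = refl i *m (wval (wprod srefl e) *m x).
Proof. by rewrite wprod_cons wvalM sreflE mulmxA. Qed.

Lemma wval_wprod_nil (x : 'cV[int]_n) : wval (wprod srefl [::]) *m x = x.
Proof. by rewrite /wprod big_nil wval1 mul1mx. Qed.

Lemma refl_comb (i j : 'I_l) p q : dot (root i) (root j) = -1 ->
  refl i *m (p *: root i + q *: root j) = (rcoef i * q - p) *: root i + q *: root j.
Proof.
move=> d; rewrite mulmxDr -!scalemxAr (refl_root hn) (refl_mulE hn) d.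
by apply/colP => k; rewrite !mxE; ring.
Qed.

Lemma rcoef_prod (i j : 'I_l) : i != j ->
  [\/ rcoef i = 1 /\ rcoef j = 1, rcoef i = 1 /\ rcoef j = 2 |
      rcoef i = 2 /\ rcoef j = 1].
Proof.
move=> ij; rewrite /refl_coef.
case si: (short ty i); case sj: (short ty j).
- by case/eqP: ij; exact: (short_inj (n := n)).
- by constructor 3.
- by constructor 2.
- by constructor 1.
Qed.

Lemma alt_root0 (i j : 'I_l) : dot (root i) (root j) = 0 ->
  refl i *m root j = root j.
Proof. by move=> d; rewrite (refl_mulE hn) d mulr0 scale0r subr0. Qed.

(** The first four roots met along an alternating word are enough, because the
    order of a product of simple reflections is at most 4. *)
Lemma alt_root (i j : 'I_l) k : dot (root i) (root j) = -1 -> (k < 4)%N ->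
  let A := rcoef i in let B := rcoef j in
  wval (wprod srefl (alt i j k)) *m root (alt_next i j k) =
    nth 0 [:: 1; A; A * B - 1; A * (B * A - 1) - A] k *: root i +
    nth 0 [:: 0; 1; B; B * A - 1] k *: root j.
Proof.
move=> d k4 A B; have d' : dot (root j) (root i) = -1 by rewrite dotC.
have ri : root i = 1 *: root i + 0 *: root j by rewrite scale1r scale0r addr0.
have rj : root j = 0 *: root i + 1 *: root j by rewrite scale1r scale0r add0r.
case: k k4 => [|[|[|[|//]]]] _; rewrite [alt _ _ _]/= [alt_next _ _ _]/= ?wval_wprod_cons wval_wprod_nil.
- exact: ri.
- by rewrite {1}rj refl_comb // mulr1 subr0.
- rewrite {1}ri [X in refl j *m X]addrC refl_comb // addrC refl_comb // mulr1 subr0 -/A -/B.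
  by rewrite /= mulrC [B * A]mulrC.
- rewrite {1}rj refl_comb // [X in refl j *m X]addrC refl_comb // addrC refl_comb //.
  by rewrite mulr1 subr0 -/A -/B.
Qed.

Lemma cox_orderC i j : cox_order i j = cox_order j i.
Proof. by rewrite /cox_order eq_sym dotC mulrC. Qed.

Lemma weyl_rank2 (i j : 'I_l) k : i != j -> (k < cox_order i j)%N ->
  exists p q : int, [/\ 0 <= p, 0 <= q, 0 < p + q &
    wval (wprod srefl (alt i j k)) *m root (alt_next i j k) = p *: root i + q *: root j].
Proof.
move=> ij; rewrite /cox_order (negPf ij).
case: (root_dot hn ij) => d; rewrite d /=.
  case: k => [|[|//]] _.
    by exists 1, 0; split=> //; rewrite wval_wprod_nil scale1r scale0r addr0.
  exists 0, 1; split=> //; rewrite wval_wprod_cons wval_wprod_nil /=.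
  by rewrite alt_root0 // scale1r scale0r add0r.
move=> km; have k4 : (k < 4)%N by apply: leq_trans km _; case: ifP.
have E := alt_root d k4; eexists; eexists; split; last exact: E.
all: by case: (rcoef_prod ij) km => [] [-> ->] /=; case: k k4 {E} => [|[|[|[|//]]]].
Qed.

Lemma weyl_braid (i j : 'I_l) : i != j ->
  wprod srefl (alt i j (cox_order i j)) = wprod srefl (alt j i (cox_order i j)).
Proof.
move=> ij; rewrite /cox_order (negPf ij).
case: (root_dot hn ij) => d; rewrite d /=.
  have := @conj_simple _ _ hn (srefl j) i i; rewrite sreflE alt_root0 1?dotC // => /(_ erefl) E.
  by rewrite /wprod /alt !big_cons !big_nil !mulg1.
case: ifP => [/eqP AB|AB].
  have := @conj_simple _ _ hn (srefl i * srefl j)%g i j.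
  have -> : wval (srefl i * srefl j)%g *m root i = root j.
    have := @alt_root i j 2 d isT; rewrite !wval_wprod_cons wval_wprod_nil wvalM -mulmxA => -> /=.
    rewrite AB subrr scale0r add0r.
    by case: (rcoef_prod ij) AB => -[-> ->] // _; rewrite scale1r.
  move=> /(_ erefl) E; rewrite /wprod /alt !big_cons !big_nil !mulg1.
  by rewrite E mulgA.
have AB2 : rcoef i * rcoef j = 2.
  by case: (rcoef_prod ij) AB => -[-> ->].
have := @conj_simple _ _ hn (srefl i * (srefl j * srefl i))%g j j.
have -> : wval (srefl i * (srefl j * srefl i))%g *m root j = root j.
  have := @alt_root i j 3 d isT.
  rewrite !wval_wprod_cons wval_wprod_nil !wvalM -!mulmxA => -> /=.
  rewrite mulrC [rcoef j * _]mulrC AB2 mul1r subrr scale0r add0r.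
  by rewrite [2 - 1](_ : _ = 1) // scale1r.
move=> /(_ erefl) E; rewrite /wprod /alt !big_cons !big_nil !mulg1.
by rewrite E !mulgA.
Qed.

Theorem weyl_coxeter : coxeter_system srefl (@wpos ty n hn) cox_order.
Proof.
split.
- by move=> i; apply: wval_inj; rewrite wvalM !sreflE refl_sqr.
- move=> w; have /asboolP[e we] := wval_pred w; exists e.
  by apply: wval_inj; rewrite wval_prod.
- by move=> i; rewrite /wpos wval1 mul1mx root_height.
- move=> w i; rewrite wposN /wpos wvalM -mulmxA sreflE (refl_root hn) mulmxN heightN.
  by rewrite oppr_gt0.
- by move=> w i j p p'; apply: conj_simple; exact: simple_sign.
- by move=> i j; rewrite /cox_order; do !case: ifP.
- exact: cox_orderC.
- by move=> i j ij; exact: weyl_braid.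
- move=> w i j k ij km E.
  have [p [q [p0 q0 pq Er]]] := weyl_rank2 ij km.
  have : height (wval w *m root i) != 0 by apply: height_neq0; exact: wroot_norm.
  have : height (wval w *m root j) != 0 by apply: height_neq0; exact: wroot_norm.
  move: E; rewrite /wpos wvalM -mulmxA Er.
  rewrite mulmxDr -!scalemxAr heightD !heightZ.
  move: (height (wval w *m root i)) (height (wval w *m root j)) => x y.
  case: ltP => x0; case: ltP => y0 // _ ny nx; first by nia.
  by apply/negbTE; rewrite -leNgt; nia.
Qed.

(** If a smaller power were trivial, an alternating word of length at most the
    order would have a shorter expression, against [len_alt]. *)
Lemma weyl_has_order (i j : 'I_l) : i != j ->
  has_order (refl i *m refl j) (cox_order i j).
Proof.
move=> ij; have cox := weyl_coxeter.
have expE k : (refl i *m refl j) ^+ k = wval (wprod srefl (alt i j k.*2)).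
  elim: k => [|k IHk]; first by rewrite expr0 /wprod big_nil.
  by rewrite exprS IHk doubleS /= !wprod_cons !wvalM !sreflE mulmxA.
have altD a c : wprod srefl (alt i j (a + c)) =
    (wprod srefl (alt i j a) * wprod srefl (if odd a then alt j i c else alt i j c))%g.
  elim: a c => [|a IHa] c; first by rewrite /wprod big_nil mul1g.
  rewrite addSnnS IHa [alt i j a.+1]alt_rcons wprod_rcons -mulgA /alt_next /=.
  by case: odd; rewrite /= wprod_cons.
have len_word_le (e : seq 'I_l) : (len cox (wprod srefl e) <= size e)%N by exact: len_le.
have m0 := cox_m0 cox i j; set m := cox_order i j in m0 *.
split=> // [|k /andP[k0 km] Ek].
  rewrite expE -addnn altD; rewrite -[RHS](wval1 ty hn); congr wval.
  have alt_rev c : (wprod srefl (alt j i c))^-1%g =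
      wprod srefl (if odd c then alt j i c else alt i j c).
    elim: c => [|c IHc]; first by rewrite /wprod big_nil invg1.
    rewrite [in LHS]alt_rcons wprod_rcons invMg IHc (simpleV cox) -wprod_cons /alt_next /=.
    by case: (odd c).
  by rewrite weyl_braid // -/m -alt_rev mulgV.
have E1 : wprod srefl (alt i j k.*2) = 1%g by apply: wval_inj; rewrite -expE Ek wval1.
have kk : k.*2 = (k.+1 + k.-1)%N by lia.
move: E1; rewrite kk altD; set e := (if _ then _ else _) => E1.
have se : size e = k.-1 by rewrite /e; case: ifP; rewrite size_alt.
have E2 : wprod srefl (alt i j k.+1) = (wprod srefl e)^-1%g.
  by apply: (mulIg (wprod srefl e)); rewrite E1 mulVg.
have := len_alt cox ij km; rewrite E2 (lenV cox) => El.
by have := len_word_le e; rewrite El se; lia.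
Qed.

End WeylCoxeter.

(** * The torus modulo d *)

Section TorusType.
Variables (ty : ctype) (d n : nat).

Definition is_Astar : bool := if ty is TypeAstar then true else false.

(** In type A* the torus consists of the diagonal matrices of determinant one. *)
Definition tor_pred : {pred 'cV['Z_d]_n} :=
  fun v => is_Astar ==> (\sum_j v j 0 == 0).

Fact tor_pred_zmod : zmod_closed tor_pred.
Proof.
split=> [|u v]; rewrite !unfold_in.
  by apply/implyP => _; rewrite big1 // => j _; rewrite mxE.
move=> /implyP hu /implyP hv; apply/implyP => a; move: (hu a) (hv a) => /eqP u0 /eqP v0.
by under eq_bigr do rewrite !mxE; rewrite sumrB u0 v0 subrr.
Qed.

HB.instance Definition _ := GRing.isZmodClosed.Build 'cV['Z_d]_n tor_pred tor_pred_zmod.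

Definition tor : Type := {v : 'cV['Z_d]_n | v \in tor_pred}.
HB.instance Definition _ := SubChoice.on tor.
HB.instance Definition _ := [SubChoice_isSubZmodule of tor by <:].
HB.instance Definition _ := [Finite of tor by <:].

End TorusType.

Section IntegersModulo.
Variable d : nat.
Hypothesis hd : (1 < d)%N.

Lemma natZd_eq0 k : ((k%:R : 'Z_d) == 0) = (d %| k)%N.
Proof. by rewrite -val_eqE /= val_Zp_nat. Qed.

Lemma intZd_eq0 (z : int) : ((z%:~R : 'Z_d) == 0) = (d %| z)%Z.
Proof.
by case: z => k; rewrite ?NegzE ?mulrNz ?oppr_eq0 -pmulrn natZd_eq0 dvdzE.
Qed.

Lemma intZd_eq (z z' : int) : ((z%:~R : 'Z_d) == z'%:~R) = (d %| z - z')%Z.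
Proof. by rewrite -subr_eq0 -mulrzBr intZd_eq0. Qed.

Lemma val_intZd (z : int) : (z%:~R : 'Z_d) = absz (z %% d)%Z :> nat.
Proof.
have d0 : (0 < d)%N by lia.
have zd : (0 <= (z %% d)%Z) by rewrite modz_ge0; lia.
have -> : (z%:~R : 'Z_d) = (absz (z %% d)%Z)%:R.
  apply/eqP; rewrite pmulrn intZd_eq gez0_abs // {1}(divz_eq z d) addrK.
  exact: dvdz_mull.
rewrite val_Zp_nat // modn_small // -ltz_nat gez0_abs //.
by rewrite ltz_pmod; lia.
Qed.

End IntegersModulo.

Section TorusLattice.
Variables (ty : ctype) (d n : nat).
Hypothesis hd : (1 < d)%N.
Local Notation T := (tor ty d n).

Definition lattice : {pred 'cV[int]_n} := fun x => is_Astar ty ==> (x \in @sl_lattice n d).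

Lemma latticeE x : (x \in lattice) = (is_Astar ty ==> (d %| \sum_j x j ord0)%Z).
Proof. by []. Qed.

Lemma tor_predE v : (v \in @tor_pred ty d n) = (is_Astar ty ==> (\sum_j v j 0 == 0)).
Proof. by []. Qed.

Definition red (x : 'cV[int]_n) : 'cV['Z_d]_n := map_mx intr x.

Lemma redD x y : red (x + y) = red x + red y. Proof. exact: map_mxD. Qed.
Lemma red_lattice x : x \in lattice -> red x \in @tor_pred ty d n.
Proof.
rewrite latticeE tor_predE => /implyP hx; apply/implyP => /hx dx.
under eq_bigr do rewrite mxE.
by rewrite -rmorph_sum /= (intZd_eq0 hd).
Qed.

(** The element t_H of the torus; off the lattice, 0 is a default value. *)
Definition tor_of (x : 'cV[int]_n) : T := insubd 0 (red x).

Lemma tor_ofK x : x \in lattice -> val (tor_of x) = red x.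
Proof. by move=> /red_lattice hx; rewrite val_insubd hx. Qed.

Lemma latticeD x y : x \in lattice -> y \in lattice -> x + y \in lattice.
Proof.
rewrite !latticeE; case: is_Astar => //= dx dy.
by under eq_bigr do rewrite mxE; rewrite big_split rpredD.
Qed.

Lemma latticeZ k x : x \in lattice -> k *: x \in lattice.
Proof.
rewrite !latticeE; case: is_Astar => //= dx.
by under eq_bigr do rewrite mxE; rewrite -mulr_sumr dvdz_mull.
Qed.

Lemma lattice0 : 0 \in lattice.
Proof. by rewrite latticeE; apply/implyP => _; rewrite big1 => [|j _]; rewrite ?mxE. Qed.

Lemma tor_ofD x y : x \in lattice -> y \in lattice -> tor_of (x + y) = tor_of x + tor_of y.
Proof.
by move=> hx hy; apply: val_inj; rewrite [RHS]raddfD /= !tor_ofK ?redD ?latticeD.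
Qed.

Lemma tor_of0 x : x \in lattice -> (forall j, (d %| x j ord0)%Z) -> tor_of x = 0.
Proof.
move=> hx dx; apply: val_inj; rewrite tor_ofK //; apply/colP => j; rewrite !mxE.
by apply/eqP; rewrite (intZd_eq0 hd).
Qed.

Lemma tor_of_zero : tor_of 0 = 0.
Proof. by rewrite tor_of0 ?lattice0 // => j; rewrite mxE; exact: dvdz0. Qed.

Lemma tor_ofN x : x \in lattice -> tor_of (- x) = - tor_of x.
Proof.
move=> hx; apply/eqP; rewrite -addr_eq0 -tor_ofD -?scaleN1r ?latticeZ //.
by rewrite scaleN1r addNr tor_of_zero.
Qed.

Lemma tor_ofMn x k : x \in lattice -> tor_of (x *+ k) = tor_of x *+ k.
Proof.
move=> hx; elim: k => [|k IHk]; first by rewrite !mulr0n tor_of_zero.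
by rewrite !mulrS tor_ofD ?IHk // -scaler_nat latticeZ.
Qed.

(** A section of [tor_of], by least nonnegative residues. *)
Definition tor_lift (v : T) : 'cV[int]_n := map_mx (fun z : 'Z_d => (z : nat)%:Z) (val v).

Lemma red_lift v : red (tor_lift v) = val v.
Proof. by apply/matrixP => i j; rewrite !mxE -pmulrn natr_Zp. Qed.

Lemma tor_lift_lattice v : tor_lift v \in lattice.
Proof.
have := valP v; rewrite latticeE tor_predE => /implyP hv; apply/implyP => /hv /eqP s0.
rewrite -(intZd_eq0 hd) rmorph_sum; apply/eqP; rewrite -[RHS]s0; apply: eq_bigr => j _.
by rewrite mxE /= -pmulrn natr_Zp.
Qed.

Lemma tor_liftK v : tor_of (tor_lift v) = v.
Proof. by apply: val_inj; rewrite tor_ofK ?tor_lift_lattice // red_lift. Qed.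

End TorusLattice.

Section TorusAction.
Variables (ty : ctype) (d n : nat) (hn : (2 <= n)%N).
Hypothesis hd : (1 < d)%N.
Local Notation l := (nb_simple ty n).
Local Notation refl := (refl_mx n ty).
Local Notation W := (weyl ty hn).
Local Notation T := (tor ty d n).
Local Notation lattice := (@lattice ty d n).
Local Notation tor_of := (@tor_of ty d n).
Local Notation red := (@red d n).

Lemma weyl_lattice (w : W) x : x \in lattice -> wval w *m x \in lattice.
Proof.
rewrite !latticeE; case A : (is_Astar ty) => //= dx.
suff -> : \sum_j (wval w *m x) j 0 = \sum_j x j 0 by [].
have sum_dot (y : 'cV[int]_n) : \sum_j y j 0 = dot (\col_j 1) y.
  by apply: eq_bigr => j _; rewrite mxE mul1r.
have /asboolP[e ->] := wval_pred w.
elim: e => [|i e IHe]; first by rewrite big_nil mul1mx.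
rewrite big_cons -mulmxA -IHe (refl_mulE hn) sum_dot dotDr dotNr dotZr -!sum_dot.
suff -> : \sum_j wroot ty n i j 0 = 0 by rewrite mulr0 subr0 sum_dot.
have tyA : ty = TypeAstar by move: A; case: (ty).
have lE : nb_simple ty n = n.-1 by rewrite tyA.
have rE (k : nat) : wroot ty n k = basisH n k.+1 - basisH n k by rewrite tyA.
have il : (i < n.-1)%N by rewrite -lE.
rewrite sum_dot rE.
have i1 : (i.+1 < n)%N by lia.
have i0 : (i < n)%N by lia.
have dot1 k : (k < n)%N -> dot (\col_j 1) (basisH n k) = 1.
  by move=> kn; rewrite -[k]/(val (Ordinal kn)) dot_basis mxE.
by rewrite dotDr dotNr !dot1 // subrr.
Qed.

Definition wact (w : W) (v : T) : T := tor_of (wval w *m tor_lift v).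

Lemma redM (w : W) x : red (wval w *m x) = map_mx intr (wval w) *m red x.
Proof. exact: map_mxM. Qed.

Lemma val_wact (w : W) v : val (wact w v) = map_mx intr (wval w) *m val v.
Proof.
by rewrite tor_ofK ?weyl_lattice ?tor_lift_lattice // redM red_lift.
Qed.

Lemma wact_of (w : W) x : x \in lattice -> wact w (tor_of x) = tor_of (wval w *m x).
Proof.
by move=> hx; apply: val_inj; rewrite val_wact !tor_ofK ?weyl_lattice // redM.
Qed.

Lemma wact_torus : torus_action wact.
Proof.
split=> [v|w w' v|w v v']; apply: val_inj.
- by rewrite val_wact wval1 map_mx1 mul1mx.
- by rewrite !val_wact wvalM map_mxM mulmxA.
- have valD (u u' : T) : val (u + u') = val u + val u' by exact: raddfD.
  by rewrite valD !val_wact valD mulmxDr.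
Qed.

End TorusAction.

(** * Presentations of the tori *)

Section TorusPresentation.
Variables (d n : nat).
Hypothesis hd : (1 < d)%N.

Lemma commr_prod_split (B : pzRingType) (I : Type) (r : seq I) (x y : I -> B) :
    (forall i j, x i * y j = y j * x i) ->
  \prod_(i <- r) (x i * y i) = \prod_(i <- r) x i * \prod_(i <- r) y i.
Proof.
move=> xy; elim: r => [|i r IHr]; first by rewrite !big_nil mulr1.
rewrite !big_cons IHr -!mulrA; congr (_ * _); rewrite !mulrA; congr (_ * _).
elim: r {IHr} => [|j r IHr]; first by rewrite big_nil mulr1 mul1r.
by rewrite big_cons mulrA -xy -!mulrA IHr.
Qed.

Section Full.
Variable ty : ctype.
Hypothesis tyN : is_Astar ty = false.
Local Notation T := (tor ty d n).
Local Notation tv := (fun j : 'I_n => tor_of ty d (basisH n j)).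

Let all_lattice x : x \in @lattice ty d n.
Proof. by rewrite latticeE tyN. Qed.

Lemma full_val (v : seq 'I_n) i :
  val (\sum_(j <- v) tv j) i 0 = (count_mem i v)%:R.
Proof.
rewrite raddf_sum summxE /= -sum1_count natr_sum [RHS]big_mkcond; apply: eq_bigr => j _.
rewrite tor_ofK // !mxE /=; have -> : (nat_of_ord i == nat_of_ord j) = (j == i) by rewrite eq_sym.
by case: eqP.
Qed.

Lemma full_rel_sum v w : full_rel d v w -> \sum_(j <- v) tv j = \sum_(j <- w) tv j :> T.
Proof.
case=> [j k|j]; first by rewrite !big_cons !big_nil addrCA.
apply: val_inj; apply/colP => i; rewrite full_val big_nil mxE count_nseq.
by rewrite /=; case: (j == i); rewrite ?mul0n // mul1n; apply/eqP; rewrite (natZd_eq0 hd).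
Qed.

Lemma full_word_sum H : \sum_(j <- tword (full_torus n d) H) tv j = tor_of ty d H.
Proof.
apply: val_inj; apply/colP => i; rewrite full_val tor_ofK // mxE /= count_flatten.
rewrite -map_comp sumnE big_map big_enum (bigD1 i) //= count_nseq /= eqxx mul1n.
rewrite big1 ?addn0 => [|j /negPf ji]; last by rewrite count_nseq /= ji mul0n.
by rewrite -(val_intZd hd) natr_Zp.
Qed.

Lemma full_tau (B : pzRingType) (t : 'I_n -> B) :
    (forall v w, full_rel d v w -> \prod_(j <- v) t j = \prod_(j <- w) t j) ->
  exists tau : T -> B, [/\ tau 0 = 1, forall u v, tau (u + v) = tau u * tau v &
    forall j, t j = tau (tv j)].
Proof.
move=> trel; have tC j k : t j * t k = t k * t j.
  by have := trel _ _ (FullComm d j k); rewrite !big_cons !big_nil !mulr1.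
have tX j : t j ^+ d = 1.
  have := trel _ _ (FullPow d j); rewrite big_nil big_nseq => <-.
  by elim: (d) => [|k IHk]; rewrite ?expr0 //= exprS IHk.
have tmod j k : t j ^+ (k %% d) = t j ^+ k.
  by rewrite {2}(divn_eq k d) exprD mulnC exprM tX expr1n mul1r.
exists (fun v : T => \prod_(j <- enum 'I_n) t j ^+ ((val v : 'cV['Z_d]_n) j 0 : 'Z_d)); split.
- by rewrite big1 // => j _; rewrite mxE expr0.
- move=> u v; rewrite -commr_prod_split; last first.
    by move=> j k; apply: commrX; apply: commr_sym; apply: commrX; exact: tC.
  apply: eq_bigr => j _; rewrite -exprD -[RHS]tmod; congr (_ ^+ _).
  by rewrite [val (u + v)]raddfD mxE /=; congr (_ %% _)%N; exact: Zp_cast.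
- move=> j; rewrite tor_ofK //.
  transitivity (\prod_(k <- enum 'I_n | k == j) t k).
    by rewrite -big_filter filter_pred1_uniq ?enum_uniq ?mem_enum // big_seq1.
  rewrite big_mkcond; apply: eq_bigr => k _; rewrite !mxE.
  have -> : (nat_of_ord k == nat_of_ord j) = (k == j) by [].
  rewrite (val_intZd hd); case: eqP => _; last by rewrite mod0z expr0.
  by rewrite modz_small ?expr1 //; lia.
Qed.

End Full.

Section Special.
Local Notation T := (tor TypeAstar d n).
Local Notation gen := (@sl_gen n d).
Local Notation tv := (fun x : gen => tor_of TypeAstar d (val x)).

Lemma sl_gen_lattice (x : gen) : val x \in @lattice TypeAstar d n.
Proof. exact: valP. Qed.

Lemma sl_rel_sum v w : @sl_rel n d v w -> \sum_(x <- v) tv x = \sum_(x <- w) tv x :> T.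
Proof.
case=> [x y z E|x dx]; rewrite !big_cons !big_nil ?addr0.
  by rewrite E tor_ofD ?sl_gen_lattice.
by rewrite tor_of0 ?sl_gen_lattice.
Qed.

Lemma sl_word_sum H : H \in @lattice TypeAstar d n ->
  \sum_(x <- tword (sl_torus n d) H) tv x = tor_of TypeAstar d H.
Proof. by move=> hH; rewrite big_seq1 val_insubd [_ \in _]hH. Qed.

Lemma sl_tau (B : pzRingType) (t : gen -> B) :
    (forall v w, @sl_rel n d v w -> \prod_(x <- v) t x = \prod_(x <- w) t x) ->
  exists tau : T -> B, [/\ tau 0 = 1, forall u v, tau (u + v) = tau u * tau v &
    forall x, t x = tau (tv x)].
Proof.
move=> trel.
have tD (x y z : gen) : val z = val x + val y -> t x * t y = t z.
  by move=> E; have := trel _ _ (SlMul E); rewrite !big_cons !big_nil !mulr1.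
have t1 (x : gen) : (forall j, (d %| val x j ord0)%Z) -> t x = 1.
  by move=> dx; have := trel _ _ (SlOne dx); rewrite big_cons !big_nil mulr1.
have t_eq (x y : gen) : tv x = tv y -> t x = t y.
  move=> E; have hz : val x - val y \in @lattice TypeAstar d n.
    by rewrite -scaleN1r latticeD ?latticeZ ?sl_gen_lattice.
  pose z : gen := Sub (val x - val y) hz.
  have <- : t z * t y = t x by apply: tD; rewrite SubK subrK.
  rewrite t1 ?mul1r // => j; rewrite SubK -(intZd_eq0 hd).
  have E' : (val x j ord0)%:~R = (val y j ord0)%:~R :> 'Z_d.
    have := congr1 val E; rewrite !tor_ofK ?sl_gen_lattice // => /matrixP/(_ j ord0).
    by rewrite !mxE.
  apply/eqP; transitivity ((val x j ord0)%:~R - (val y j ord0)%:~R : 'Z_d).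
    by rewrite !mxE rmorphB.
  by rewrite E' subrr.
pose lift (v : T) : gen := Sub (tor_lift v) (tor_lift_lattice hd v).
have tv_lift v : tv (lift v) = v by rewrite SubK tor_liftK.
exists (fun v => t (lift v)); split.
- apply: t1 => j; rewrite -(intZd_eq0 hd).
  by rewrite SubK !mxE.
- move=> u v; have hz : val (lift u) + val (lift v) \in @lattice TypeAstar d n.
    by rewrite latticeD ?sl_gen_lattice.
  pose z : gen := Sub (val (lift u) + val (lift v)) hz.
  have -> : t (lift u) * t (lift v) = t z by apply: tD; rewrite SubK.
  apply: t_eq; rewrite tv_lift [val z]SubK tor_ofD ?sl_gen_lattice //.
  by rewrite !tv_lift.
- by move=> x; apply: t_eq; rewrite tv_lift.
Qed.

End Special.

Section AllTypes.
Variable ty : ctype.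
Local Notation T := (tor ty d n).
Local Notation TT := (torus_of n ty d).

Definition tgen_elt (x : tgen TT) : T := tor_of ty d (Defs.tval x).

Lemma tval_lattice (x : tgen TT) : Defs.tval x \in @lattice ty d n.
Proof. by rewrite latticeE; case: (ty) x => //= x; exact: (valP x). Qed.

Lemma trel_sum (v w : seq (tgen TT)) : trel v w ->
  \sum_(x <- v) tgen_elt x = \sum_(x <- w) tgen_elt x.
Proof.
rewrite /tgen_elt; case: (ty) v w => v w; try exact: full_rel_sum.
exact: sl_rel_sum.
Qed.

Lemma tword_sum H : H \in @lattice ty d n ->
  \sum_(x <- tword TT H) tgen_elt x = tor_of ty d H.
Proof.
rewrite /tgen_elt; case: (ty) => hH; try exact: full_word_sum.
exact: sl_word_sum.
Qed.

(** A family that satisfies the relations of the torus factors through it: the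
    exponents of a word matter only modulo d. *)
Lemma torus_tau (B : pzRingType) (t : tgen TT -> B) :
    (forall v w, trel v w -> \prod_(x <- v) t x = \prod_(x <- w) t x) ->
  exists tau : T -> B, [/\ tau 0 = 1, forall u v, tau (u + v) = tau u * tau v &
    forall x, t x = tau (tgen_elt x)].
Proof.
rewrite /tgen_elt; case: (ty) t => t; try exact: full_tau.
exact: sl_tau.
Qed.

End AllTypes.

End TorusPresentation.

(** * The coefficients of the quadratic relations *)

(** If 2 x = k a, where x and a have norm 1 or 2, then x and a have the same norm
    and k is 2 or -2. *)
Lemma norm_ratio (a b : bool) (k : int) :
  4 * (if b then 1 else 2) = k * k * (if a then 1 else 2) -> a = b /\ (k = 2 \/ k = -2).
Proof.
move=> N; have k3 : -3 <= k <= 3 by move: N; case: a; case: b; nia.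
move: N; have [->|[->|[->|[->|[->|[->|->]]]]]] :
    k = -3 \/ k = -2 \/ k = -1 \/ k = 0 \/ k = 1 \/ k = 2 \/ k = 3.
  by lia.
all: by case: a; case: b => N; cbv iota in N; split=> //; lia.
Qed.

Section Coefficients.
Variables (ty : ctype) (d n : nat) (hn : (2 <= n)%N).
Local Notation l := (nb_simple ty n).
Local Notation W := (weyl ty hn).
Local Notation T := (tor ty d n).
Local Notation act := (@wact ty d n hn).
Local Notation s := (@srefl ty n hn).
Local Notation root := (wroot ty n).
Local Notation coroot := (coroot n ty).

Lemma coroot_root (i : 'I_l) : exists2 e : int, coroot i = e *: root i &
  (if short ty i then e = 1 \/ e = 2 else e = 1 \/ e = -1) /\
  (short ty i -> forall j : 'I_l, short ty j -> coroot j = e *: root j).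
Proof.
have E (j : 'I_l) (e : int) : short ty i -> coroot i = e *: root i -> short ty j ->
    coroot j = e *: root j.
  by move=> si Ei sj; rewrite -(short_inj (n := n) si sj).
have opp (x y : 'cV[int]_n) : x - y = -1 *: (y - x) by rewrite scaleN1r opprB.
suff [e Ee he] : exists2 e : int, coroot i = e *: root i &
    (if short ty i then e = 1 \/ e = 2 else e = 1 \/ e = -1).
  by exists e => //; split=> // si j sj; exact: (E _ _ si Ee sj).
move: (nat_of_ord i) => k; rewrite /Defs.coroot /wroot /short.
case: (ty) k => [k|k|[|k]|[|k]|[|k]].
- by exists (-1); [exact: opp | right].
- by exists (-1); [exact: opp | right].
- by exists 2; [rewrite scaler_nat | right].
- by exists (-1); [exact: opp | right].
- by exists 1; [rewrite scale1r | left].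
- by exists (-1); [exact: opp | right].
- by exists 1; [rewrite scale1r | left].
- by exists (-1); [exact: opp | right].
Qed.

Lemma coroot_lattice (i : 'I_l) : coroot i \in @lattice ty d n.
Proof.
rewrite latticeE; case A : (is_Astar ty) => //=.
have tyA : ty = TypeAstar by move: A; case: (ty).
have lE : nb_simple ty n = n.-1 by rewrite tyA.
have cE (k : nat) : coroot k = basisH n k - basisH n k.+1 by rewrite tyA.
have il : (i < n.-1)%N by rewrite -lE.
have sum1 k : (k < n)%N -> \sum_j basisH n k j ord0 = 1.
  move=> kn; rewrite (bigD1 (Ordinal kn)) //= mxE eqxx big1 ?addr0 // => j.
  by rewrite mxE -val_eqE /= => /negPf->.
rewrite cE; have -> : \sum_j (basisH n i - basisH n i.+1) j ord0 =
    \sum_j basisH n i j ord0 - \sum_j basisH n i.+1 j ord0.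
  by rewrite -sumrB; apply: eq_bigr => j _; rewrite [LHS]mxE [X in _ + X]mxE.
by rewrite !sum1 ?subrr ?dvdz0 //; lia.
Qed.

(** Conjugation carries the line on which a reflection acts by -1 to the
    corresponding line; the norms of the roots then leave only a sign. *)
Lemma coroot_conj (w : W) (i j : 'I_l) : (s i * w = w * s j)%g ->
  wval w *m coroot j = coroot i \/ wval w *m coroot j = - coroot i.
Proof.
move=> /(congr1 (@wval ty n hn)); rewrite !wvalM !sreflE => /(congr1 (mulmx^~ (root j))) /=.
rewrite -!mulmxA (refl_root hn) mulmxN (refl_mulE hn); set x := wval w *m root j => E.
have nx : dot x x = dot (root j) (root j) by exact: wval_dot.
set k := refl_coef ty i * dot (root i) x in E.
have E2 : 2 *: x = k *: root i.
  by rewrite scaler_nat mulr2n -{1}[x](subrK (k *: root i)) E addrAC addNr add0r.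
have N : 4 * dot x x = k * k * dot (root i) (root i).
  have := congr1 (fun y => dot y y) E2; rewrite !(dotZl, dotZr) => N.
  by rewrite -[RHS]mulrA -N !mulrA.
have ci := coroot_root i; have cj := coroot_root j.
have [sij k2] : short ty i = short ty j /\ (k = 2 \/ k = -2).
  by apply: norm_ratio; rewrite -!(root_norm hn) -nx.
have wx : wval w *m root j = x by [].
clearbody k x; have xE : x = root i \/ x = - root i.
  case: k2 => k2; rewrite k2 in E2; [left|right]; apply/colP => a;
    by move/matrixP/(_ a 0): E2; rewrite !mxE; move: (x a 0) (root i a 0) => y z; lia.
have [e Ee [he hes]] := coroot_root i.
have [f Ef [hf _]] := coroot_root j.
have wf : wval w *m coroot j = f *: x by rewrite Ef -scalemxAr wx.
rewrite wf Ee.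
case si : (short ty i) sij he hf => /esym sj; rewrite sj.
  have := hes si j sj; rewrite Ef => EE he hf.
  have -> : f = e.
    have := congr1 (fun y => dot y (root j)) EE; rewrite !dotZl (root_norm hn) sj !mulr1.
    by [].
  by case: xE => ->; [left | right; rewrite scalerN].
by case=> -> [] ->; case: xE => ->; rewrite ?scaleN1r ?scale1r ?opprK;
  [left|right|right|left|right|left|left|right].
Qed.

Hypothesis hd : (1 < d)%N.

Definition gam (i : 'I_l) : T := tor_of ty d (coroot i).

Lemma tor_exp (v : T) : v *+ d = 0.
Proof.
apply: val_inj; rewrite raddfMn /=; apply/matrixP => i j; rewrite mulmxnE !mxE.
by rewrite -mulr_natr; apply/eqP; rewrite (_ : d%:R = 0) ?mulr0 //; apply/eqP; rewrite (natZd_eq0 hd).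
Qed.

Lemma gam_conj w i j : (s i * w = w * s j)%g -> act w (gam j) = gam i \/ act w (gam j) = - gam i.
Proof.
move=> /coroot_conj; rewrite /gam (wact_of hd) ?coroot_lattice //.
by case=> ->; [left|right; rewrite tor_ofN ?coroot_lattice].
Qed.

Lemma actMn w v k : act w (v *+ k) = act w v *+ k.
Proof.
have h := wact_torus ty hn hd.
by elim: k => [|k IHk]; rewrite ?mulr0n ?(act0 h) // !mulrS (actD h) IHk.
Qed.

Section Ring.
Variable R : comNzRingType.
Local Notation S := (conv T R).
Local Notation delta := (@conv_delta T R).

(** The sum over the subgroup generated by [gam i], with multiplicities. *)
Definition gsum (i : 'I_l) : S := \sum_(1 <= k < d.+1) delta (gam i *+ k).

Lemma gsum0E i : gsum i = \sum_(0 <= k < d) delta (gam i *+ k).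
Proof.
have d0 : (0 < d)%N by lia.
rewrite /gsum big_nat_recr //= tor_exp addrC -[in LHS](mulr0n (gam i)).
by rewrite [RHS]big_ltn.
Qed.

Lemma gsum_opp i : \sum_(1 <= k < d.+1) delta (- gam i *+ k) = gsum i.
Proof.
rewrite gsum0E big_nat_rev big_add1 /= [RHS]big_nat [LHS]big_nat.
apply: eq_bigr => k /andP[_ kd]; congr delta.
have -> : (1 + d.+1 - k.+2 = d - k)%N by lia.
apply/eqP; rewrite mulNrn eq_sym -addr_eq0 -mulrnDr subnKC; last exact: ltnW.
by rewrite tor_exp.
Qed.

Lemma delta_gsum i : delta (gam i) * gsum i = gsum i.
Proof.
rewrite {1}gsum0E mulr_sumr /gsum big_add1 /=; apply: eq_bigr => k _.
by rewrite -conv_deltaD mulrS.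
Qed.

Lemma delta_gsumMn i k : delta (gam i *+ k) * gsum i = gsum i.
Proof.
elim: k => [|k IHk]; first by rewrite mulr0n conv_delta0 mul1r.
by rewrite mulrS conv_deltaD -mulrA IHk delta_gsum.
Qed.

Lemma delta_gsumN i k : delta (- gam i *+ k) * gsum i = gsum i.
Proof.
rewrite -{1}(delta_gsumMn i k) mulrA -conv_deltaD mulNrn addNr conv_delta0 mul1r.
by [].
Qed.

Lemma cact_sum w I (r : seq I) (F : I -> S) :
  cact act w (\sum_(k <- r) F k) = \sum_(k <- r) cact act w (F k).
Proof.
apply: (big_morph (cact act w)) => [x y|]; first exact: cactD.
by apply/ffunP => v; rewrite !ffunE.
Qed.

Lemma gsum_conj w i j : (s i * w = w * s j)%g -> cact act w (gsum j) = gsum i.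
Proof.
have h := wact_torus ty hn hd.
move=> /gam_conj E; rewrite cact_sum.
under eq_bigr do rewrite (cact_delta _ h) actMn.
by case: E => ->; [exact: erefl | exact: gsum_opp].
Qed.

(** A reflection translates each element of the torus by a multiple of its
    coroot, which [gsum] absorbs. *)
Lemma gsum_abs i f : gsum i * cact act (s i) f = gsum i * f.
Proof.
have h := wact_torus ty hn hd.
have Ev v : gsum i * delta (act (s i) v) = gsum i * delta v.
  have [e Ee [he _]] := coroot_root i.
  have [k Ek] : exists k : int,
      (refl_coef ty i * dot (root i) (tor_lift v)) *: root i = k *: coroot i.
    move: (dot _ _) => z; rewrite Ee /refl_coef; case: (short ty i) he => -[] ->.
    - by exists (2 * z); rewrite scale1r.
    - by exists z; rewrite scalerA mulrC.
    - by exists z; rewrite scale1r mul1r.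
    - by exists (- z); rewrite scalerA mul1r mulrN1 opprK.
  have -> : act (s i) v = v - tor_of ty d (k *: coroot i).
    rewrite /wact sreflE (refl_mulE hn) Ek -[v in RHS](tor_liftK hd).
    rewrite (tor_ofD hd) ?(tor_lift_lattice hd) // ?(tor_ofN hd) //.
      by rewrite latticeZ // coroot_lattice.
    by rewrite -scaleN1r !latticeZ // coroot_lattice.
  have abs : delta (- tor_of ty d (k *: coroot i)) * gsum i = gsum i.
    case: k {Ek} => k; rewrite ?NegzE ?scaleNr -?[Posz _]natz scaler_nat ?(tor_ofN hd)
      ?(tor_ofMn hd) ?coroot_lattice //; last by rewrite -scaler_nat latticeZ ?coroot_lattice.
      by rewrite -mulNrn delta_gsumN.
    by rewrite opprK delta_gsumMn.
  rewrite conv_deltaD [LHS]mulrC -mulrA.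
  by rewrite abs mulrC.
have scr (x y : S) a : x * (a *: y) = a *: (x * y) by rewrite mulrC -conv_scalel mulrC.
rewrite [f](convE f) cact_sum !mulr_sumr; apply: eq_bigr => v _.
by rewrite cactZ (cact_delta _ h) [LHS]scr [RHS]scr Ev.
Qed.

End Ring.

Hypothesis d_even : ~~ odd d.

Definition hgam (i : 'I_l) : T := gam i *+ d./2.

Lemma hgam2 i : hgam i + hgam i = 0.
Proof.
rewrite /hgam -mulrnDr addnn -[X in _ *+ X]add0n.
have := odd_double_half d; rewrite (negPf d_even) => ->.
exact: tor_exp.
Qed.

Lemma hgamN i : - hgam i = hgam i.
Proof. by apply/eqP; rewrite eq_sym -addr_eq0 hgam2. Qed.

Lemma hgam_conj w i j : (s i * w = w * s j)%g -> act w (hgam j) = hgam i.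
Proof.
by move=> /gam_conj; rewrite /hgam actMn; case=> ->; rewrite // mulNrn -/(hgam i) hgamN.
Qed.

End Coefficients.


Section QuadraticCoefficients.
Variables (ty : ctype) (d n : nat) (hn : (2 <= n)%N).
Hypotheses (hd : (1 < d)%N) (d_even : ~~ odd d).
Local Notation l := (nb_simple ty n).
Local Notation W := (weyl ty hn).
Local Notation T := (tor ty d n).
Local Notation act := (@wact ty d n hn).
Local Notation s := (@srefl ty n hn).
Local Notation m := (@cox_order ty n).
Local Notation hgam := (@hgam ty d n).
Local Notation gam := (@gam ty d n).

Section Coefs.
Variable R : comNzRingType.
Local Notation S := (conv T R).
Local Notation delta := (@conv_delta T R).
Local Notation gsum := (@gsum ty d n R).

(** The coefficients of the algebras with quadratic relation
    [xi_i ^ 2 = p h_i + q + r (\sum_k t_{a_i} ^ k) xi_i]. *)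
Definition quad_c (p q : R) (i : 'I_l) : S := p *: delta (hgam i) + q *: delta 0.
Definition quad_b (r : R) (i : 'I_l) : S := r *: gsum i.

Lemma quad_good p q r : good_coefs s act (quad_c p q) (quad_b r).
Proof.
have h := wact_torus ty hn hd.
split=> [w i j E|w i j E|i f].
- rewrite /quad_c cactD; congr (_ + _); rewrite cactZ (cact_delta _ h); congr (_ *: delta _).
    exact: hgam_conj.
  exact: act0.
- by rewrite /quad_b cactZ; congr (_ *: _); exact: gsum_conj.
- rewrite /quad_b -[LHS]conv_scalel -[RHS]conv_scalel; congr (_ *: _); exact: gsum_abs.
Qed.

Variables (B : pzAlgType R) (tau : T -> B).
Local Notation cst := (@alg_cst R B).

Lemma conv_evalZ a f : conv_eval cst tau (a *: f) = cst a * conv_eval cst tau f.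
Proof.
rewrite /conv_eval mulr_sumr; apply: eq_bigr => v _.
by rewrite convZE rmorphM mulrA.
Qed.

Lemma conv_eval_sum I (r : seq I) (f : I -> S) :
  conv_eval cst tau (\sum_(k <- r) f k) = \sum_(k <- r) conv_eval cst tau (f k).
Proof. exact: (big_morph (conv_eval cst tau) (conv_evalD tau) (conv_eval0 tau)). Qed.

Lemma eval_quad_c p q i : tau 0 = 1 ->
  conv_eval cst tau (quad_c p q i) = cst p * tau (hgam i) + cst q.
Proof.
move=> t0; rewrite /quad_c conv_evalD; congr (_ + _); rewrite conv_evalZ conv_eval_delta //.
by rewrite t0 mulr1.
Qed.

Lemma eval_quad_b r i : conv_eval cst tau (quad_b r i) =
  cst r * \sum_(1 <= k < d.+1) tau (gam i *+ k).
Proof.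
rewrite /quad_b conv_evalZ; congr (_ * _); rewrite /gsum conv_eval_sum; apply: eq_bigr => k _.
exact: conv_eval_delta.
Qed.

End Coefs.

(** Generic representations, with the quadratic relation spelled out. *)
Definition quad_rep (R : comNzRingType) (p q r : R) (B : pzAlgType R) (tau : T -> B)
    (xi : 'I_l -> B) : Prop :=
  [/\ tau 0 = 1, forall v w, tau (v + w) = tau v * tau w,
      forall i v, xi i * tau v = tau (act (s i) v) * xi i,
      forall i j, i != j ->
        \prod_(k <- alt i j (m i j)) xi k = \prod_(k <- alt j i (m i j)) xi k &
      forall i, xi i * xi i = alg_cst p * tau (hgam i) + alg_cst q +
        alg_cst r * (\sum_(1 <= k < d.+1) tau (gam i *+ k)) * xi i].

Lemma quad_repP R p q r (B : pzAlgType R) tau xi : @quad_rep R p q r B tau xi <->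
  generic_rep s m act (quad_c p q) (quad_b r) (@alg_cst R B) tau xi.
Proof.
split=> [[t0 tD tA tB tQ]|[t0 tD tA tB tQ]]; split=> // i.
  by rewrite eval_quad_c // eval_quad_b tQ.
by rewrite tQ eval_quad_c // eval_quad_b.
Qed.

Lemma quad_rep_fiber (R R' : comNzRingType) (f : {rmorphism R -> R'}) p q r
    (A : pzAlgType R) (B : pzAlgType R') (sp : A -> B) N (b : 'I_N -> A) co coB tau xi :
    coordinates b co -> fiber b co f sp coB -> @quad_rep R p q r A tau xi ->
  @quad_rep R' (f p) (f q) (f r) B (sp \o tau) (sp \o xi).
Proof.
move=> bco hB [t0 tD tA tB tQ].
have spc a : sp (alg_cst a) = alg_cst (f a).
  by rewrite -[alg_cst a]mulr1 (fiberZ bco hB) (fiber1 hB) mulr1.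
split=> [|v w|i v|i j ij|i] /=.
- by rewrite t0 (fiber1 hB).
- by rewrite tD (fiberM hB).
- by rewrite -!(fiberM hB) tA.
- by rewrite -!(fiber_prod hB) tB.
- by rewrite -(fiberM hB) tQ !(fiberD bco hB, fiberM hB) !spc (fiber_sum bco hB).
Qed.

Section Positive.
Variables (F : numClosedFieldType) (B : pzAlgType F) (tau : T -> B) (xi : 'I_l -> B).
Variables (N : nat) (e : 'I_N -> T * W).
Hypothesis e_bij : bijective e.
Variable co : B -> 'I_N -> F.
Local Notation bas := (gen_basis (weyl_coxeter ty hn) tau xi e).
Hypothesis hco : coordinates bas co.
Local Notation gsum := (@gsum ty d n F).

Lemma gsum_conjC i v : (gsum i v)^* = gsum i v.
Proof.
rewrite conv_sumE rmorph_sum; apply: eq_bigr => k _.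
by rewrite ffunE; exact: conjC_nat.
Qed.

Lemma gsum_sym i v : gsum i (- v) = gsum i v.
Proof.
transitivity ((\sum_(1 <= k < d.+1) conv_delta F (- gam i *+ k)) (- v)).
  by congr (fun_of_fin _ _); apply: esym; exact: gsum_opp.
rewrite /gsum !conv_sumE; apply: eq_bigr => k _.
by rewrite !ffunE mulNrn eqr_opp.
Qed.

Lemma quad_gram_unit p r : 0 < p -> r^* = r -> quad_rep p 0 r tau xi -> gram bas co \in unitmx.
Proof.
move=> p0 rR /quad_repP hB.
apply: (gram_pos_unit (wact_torus ty hn hd) (quad_good p 0 r) p0 _ _ _ _ _ _ hB e_bij hco).
- by move=> i; rewrite /quad_c scale0r addr0; exact: erefl.
- exact: (hgam2 hd d_even).
- by move=> i; apply: (hgam_conj hd d_even).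
- by move=> i v; rewrite convZE rmorphM /= gsum_conjC rR.
- by move=> i v; rewrite !convZE gsum_sym.
- move=> i; rewrite mulrC -conv_scalel; congr (_ *: _).
  by rewrite mulrC; exact: delta_gsumMn.
Qed.

Lemma quad_gram_unit0 q : 0 < q -> quad_rep 0 q 0 tau xi -> gram bas co \in unitmx.
Proof.
move=> q0 /quad_repP hB; have h := wact_torus ty hn hd.
apply: (gram_pos_unit (h := fun=> 0) h (quad_good 0 q 0) q0 _ _ _ _ _ _ hB e_bij hco).
- by move=> i; rewrite /quad_c scale0r add0r; exact: erefl.
- by move=> i; rewrite addr0.
- by move=> i; rewrite (act0 h).
- by move=> i v; rewrite convZE mul0r conjC0.
- by move=> i v; rewrite !convZE !mul0r.
- by move=> i; rewrite conv_delta0 mul1r.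
Qed.

End Positive.

End QuadraticCoefficients.

(** * Words in the generators *)

Section Words.
Variables (ty : ctype) (d n : nat) (hn : (2 <= n)%N).
Hypothesis hd : (1 < d)%N.
Local Notation l := (nb_simple ty n).
Local Notation W := (weyl ty hn).
Local Notation T := (tor ty d n).
Local Notation act := (@wact ty d n hn).
Local Notation s := (@srefl ty n hn).
Local Notation m := (@cox_order ty n).
Local Notation gen := (Defs.gen ty d n).
Local Notation TT := (torus_of n ty d).

Section Evaluation.
Variables (B : pzRingType) (u : gen -> B).

Definition holds (v w : seq gen) : Prop := \prod_(x <- v) u x = \prod_(x <- w) u x.

Lemma alternating_alt (i j : 'I_l) k :
  alternating (Xi d i) (Xi d j) k = map (@Xi ty d n) (alt i j k).
Proof. by elim: k i j => [|k IHk] i j //=; rewrite IHk. Qed.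

Variable tau : T -> B.
Hypotheses (tau0 : tau 0 = 1) (tauD : forall v w, tau (v + w) = tau v * tau w).
Hypothesis u_tau : forall x, u (Tg x) = tau (tgen_elt x).

Lemma tau_sum I (r : seq I) (F : I -> T) :
  tau (\sum_(k <- r) F k) = \prod_(k <- r) tau (F k).
Proof. exact: (big_morph tau tauD tau0). Qed.

Lemma torus_word (v : seq (tgen TT)) :
  \prod_(x <- map (@Tg ty d n) v) u x = tau (\sum_(x <- v) tgen_elt x).
Proof. by rewrite tau_sum big_map; apply: eq_bigr => x _; exact: u_tau. Qed.

Lemma t_word H : H \in @lattice ty d n -> \prod_(x <- t_ ty d H) u x = tau (tor_of ty d H).
Proof. by move=> hH; rewrite torus_word (tword_sum hd). Qed.

Lemma t_pow_word H k : H \in @lattice ty d n ->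
  \prod_(x <- t_pow ty d H k) u x = tau (tor_of ty d H *+ k).
Proof.
move=> hH; rewrite /t_pow; elim: k => [|k IHk]; first by rewrite big_nil mulr0n tau0.
by rewrite /= big_cat IHk mulrS tauD t_word.
Qed.

Lemma common_holds v w :
    (forall i v, u (Xi d i) * tau v = tau (act (s i) v) * u (Xi d i)) ->
    (forall i j, i != j -> \prod_(k <- alt i j (m i j)) u (Xi d k) =
       \prod_(k <- alt j i (m i j)) u (Xi d k)) ->
  common_rel v w -> holds v w.
Proof.
move=> uA uB; rewrite /holds; case=> [v' w' vw|i x|i j k hk].
- by rewrite !torus_word (trel_sum hd vw).
- rewrite big_cat /= t_word; last first.
    by rewrite -(sreflE hn) (weyl_lattice hd) ?tval_lattice.
  rewrite big_cons !big_seq1 u_tau uA /tgen_elt (wact_of hd) ?tval_lattice //.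
- have [<-//|ij] := eqVneq i j.
  have [k0 kX kmin] := hk; have [m0 mX mmin] := weyl_has_order hn ij.
  have -> : k = m i j.
    apply/eqP; rewrite eqn_leq; apply/andP; split; rewrite leqNgt; apply/negP => lt.
      by case: (kmin (m i j)); rewrite ?m0.
    by case: (mmin k); rewrite ?k0.
  by rewrite !alternating_alt !big_map uB.
Qed.

End Evaluation.

Lemma common_tau (B : pzRingType) (u : gen -> B) :
    (forall v w, common_rel v w -> holds u v w) ->
  exists tau : T -> B, [/\ tau 0 = 1, forall v w, tau (v + w) = tau v * tau w,
    forall x, u (Tg x) = tau (tgen_elt x),
    forall i v, u (Xi d i) * tau v = tau (act (s i) v) * u (Xi d i) &
    forall i j, i != j -> \prod_(k <- alt i j (m i j)) u (Xi d k) =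
      \prod_(k <- alt j i (m i j)) u (Xi d k)].
Proof.
move=> hu.
have [|tau [t0 tD tE]] := torus_tau hd (t := fun x => u (Tg x)).
  by move=> v w /(RelTorus)/hu; rewrite /holds !big_map.
exists tau; split=> // [i v|i j ij]; last first.
  have := hu _ _ (RelBraid d (weyl_has_order hn ij)).
  by rewrite /holds !alternating_alt !big_map.
have h := wact_torus ty hn hd.
rewrite -(tor_liftK hd v) -(tword_sum hd) ?tor_lift_lattice //.
elim: (tword _ _) => [|x w IHw]; first by rewrite big_nil (act0 h) t0 mulr1 mul1r.
rewrite big_cons (actD h) !tD mulrA.
have : u (Xi d i) * tau (tgen_elt x) = tau (act (s i) (tgen_elt x)) * u (Xi d i).
  have := hu _ _ (RelAct i x); rewrite /holds big_cat big_cons !big_seq1 tE /= => ->.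
  rewrite (t_word t0 tD tE); last by rewrite -(sreflE hn) (weyl_lattice hd) ?tval_lattice.
  by rewrite /tgen_elt (wact_of hd) ?tval_lattice // sreflE.
by move=> ->; rewrite -mulrA IHw mulrA.
Qed.

Lemma aeval_aword_prod (R : comNzRingType) (B : pzRingType) (g : {rmorphism R -> B})
    (u : gen -> B) w : aeval g u (aword R w) = \prod_(x <- w) u x.
Proof. by elim: w => [|x w IHw] /=; rewrite ?big_nil ?rmorph1 // big_cons IHw. Qed.

Lemma aeval_sum (R : comNzRingType) (B : pzRingType) (g : {rmorphism R -> B})
    (u : gen -> B) I (r : seq I) (F : I -> aterm R gen) :
  aeval g u (\big[@AAdd R gen/ACst 0]_(k <- r) F k) = \sum_(k <- r) aeval g u (F k).
Proof. by elim: r => [|k r IHr]; rewrite ?big_nil /= ?rmorph0 // !big_cons /= IHr. Qed.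

End Words.

(** * The presented algebras are free *)

Lemma aeval_pi (R : comNzRingType) (X : Type) (rel : aterm R X -> aterm R X -> Prop) t :
  aeval (@alg_cst R (palg rel)) (palg_gen rel) t = pi_alg rel t.
Proof.
by elim: t => [x|c|t IHt t' IHt'|t IHt t' IHt'] //=; rewrite IHt IHt' (pi_algD, pi_algM).
Qed.

Section Presentation.
Variables (ty : ctype) (d n : nat) (hn : (2 <= n)%N).
Hypotheses (hd : (1 < d)%N) (d_even : ~~ odd d).
Local Notation l := (nb_simple ty n).
Local Notation W := (weyl ty hn).
Local Notation T := (tor ty d n).
Local Notation gen := (Defs.gen ty d n).

Variables (R : comNzRingType) (p q r : R).
Variables (rel : aterm R gen -> aterm R gen -> Prop) (Q : 'I_l -> aterm R gen).

(** The common form of the presentations of Y and Z, which differ by the right-hand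
    sides [Q i] of the quadratic relations. *)
Record presents : Prop := {
  pres_common : forall v w, common_rel v w -> rel (aword R v) (aword R w);
  pres_quad : forall i, rel (aword R [:: Xi d i; Xi d i]) (Q i);
  pres_inv : forall s t, rel s t ->
    (exists v w, [/\ common_rel v w, s = aword R v & t = aword R w]) \/
    (exists i, s = aword R [:: Xi d i; Xi d i] /\ t = Q i);
  pres_eval : forall (B : pzRingType) (g : {rmorphism R -> B}) (u : gen -> B) i,
    aeval g u (Q i) = g p * \prod_(x <- h_ d i) u x + g q +
      g r * (\sum_(1 <= k < d.+1) \prod_(x <- t_pow ty d (coroot n ty i) k) u x) * u (Xi d i)
}.
Hypothesis hrel : presents.
Local Notation A := (palg rel).
Local Notation xi := (fun i => palg_gen rel (Xi d i)).

Lemma eval_quad_word (B : pzRingType) (g : {rmorphism R -> B}) (u : gen -> B) (tau : T -> B) i :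
    tau 0 = 1 -> (forall v w, tau (v + w) = tau v * tau w) ->
    (forall x, u (Tg x) = tau (tgen_elt x)) ->
  aeval g u (Q i) = g p * tau (@hgam ty d n i) + g q +
    g r * (\sum_(1 <= k < d.+1) tau (@gam ty d n i *+ k)) * u (Xi d i).
Proof.
move=> t0 tD tE; rewrite (pres_eval hrel); congr (_ * _ + _ + _ * _ * _).
  by rewrite (t_pow_word hd t0 tD tE) // coroot_lattice.
by apply: eq_bigr => k _; rewrite (t_pow_word hd t0 tD tE) // coroot_lattice.
Qed.

Lemma presented_rep : exists tau : T -> A,
  quad_rep hn p q r tau xi /\ forall x, palg_gen rel (Tg x) = tau (tgen_elt x).
Proof.
have pi_word w : \prod_(x <- w) palg_gen rel x = pi_alg rel (aword R w).
  by rewrite -aeval_pi aeval_aword_prod.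
have [v w vw|tau [t0 tD tE tA tB]] := common_tau hn hd (u := palg_gen rel).
  by rewrite /holds !pi_word; apply/pi_alg_eq/acong_rel/(pres_common hrel).
exists tau; split=> //; split=> // i.
rewrite -(eval_quad_word _ _ t0 tD tE) aeval_pi.
rewrite -(pi_alg_eq (acong_rel (pres_quad hrel i))) -pi_word.
by rewrite big_cons big_seq1.
Qed.

Lemma presented_free (tau : T -> A) N (e : 'I_N -> T * W) :
    quad_rep hn p q r tau xi -> (forall x, palg_gen rel (Tg x) = tau (tgen_elt x)) ->
    bijective e ->
  exists co, coordinates (gen_basis (weyl_coxeter ty hn) tau xi e) co.
Proof.
move=> hA tE e_bij; have [t0 tD _ _ _] := hA.
have hcb := @quad_good ty d n hn hd d_even R p q r.
have h := wact_torus ty hn hd; pose cox := weyl_coxeter ty hn.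
pose M := model T R W.
pose g : {rmorphism R -> endo M} := @alg_cst R (endo M).
pose mt (v : T) : endo M := scal W (conv_delta R v).
pose mx i : endo M := lmul (@srefl ty n hn) (@wpos ty n hn) (@wact ty d n hn)
  (quad_c d p q) (quad_b d r) i.
have hM : quad_rep hn p q r mt mx by apply/quad_repP; exact: (model_rep cox h hcb).
have [mt0 mtD mtA mtB mtQ] := hM.
pose u (x : gen) : endo M := match x with Tg x => mt (tgen_elt x) | Xi i => mx i end.
have u_rel s t : rel s t -> aeval g u s = aeval g u t.
  case/(pres_inv hrel) => [[v [w [vw -> ->]]]|[i [-> ->]]].
    rewrite !aeval_aword_prod.
    exact: (@common_holds ty d n hn hd _ u mt mt0 mtD (fun x => erefl) v w mtA mtB vw).
  rewrite aeval_aword_prod big_cons big_seq1 (eval_quad_word _ _ mt0 mtD) //.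
  exact: mtQ.
pose rho : A -> endo M := palg_lift g u.
have gC : forall a b, g a * b = b * g a by exact: alg_cstC.
have rhoB : zmod_morphism rho := palg_lift_zmod_morphism gC u_rel.
have rhoM : monoid_morphism rho := palg_lift_monoid_morphism gC u_rel.
have rho_gen x : rho (palg_gen rel x) = u x := palg_lift_gen gC u_rel x.
have tau_word v : tau v = \prod_(x <- tword (torus_of n ty d) (tor_lift v)) palg_gen rel (Tg x).
  rewrite -[v in LHS](tor_liftK hd) -(tword_sum hd) ?tor_lift_lattice //.
  by rewrite (tau_sum t0 tD); apply: eq_bigr => x _; rewrite tE.
apply: (generic_free cox h (proj1 (quad_repP _ _ _ _ _ _) hA) _ rhoB rhoM _ _ _ e_bij).
- move=> P Pc Pt Px PD PM; elim/palg_gen_ind => // -[x|i]; last exact: Px.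
  by rewrite tE; exact: Pt.
- by move=> k; exact: (palg_lift_pi gC u_rel (ACst k)).
- move=> v; rewrite tau_word (big_morph rho rhoM.2 rhoM.1).
  transitivity (mt (\sum_(x <- tword (torus_of n ty d) (tor_lift v)) tgen_elt x)).
    by rewrite (tau_sum mt0 mtD); apply: eq_bigr => x _; rewrite rho_gen.
  apply: (congr1 mt); rewrite (tword_sum hd (tor_lift_lattice hd v)); exact: tor_liftK.
- by move=> i; rewrite rho_gen.
Qed.

End Presentation.

Section Instances.
Variables (ty : ctype) (d n : nat) (R : comNzRingType) (u dinv : R).
Local Notation l := (nb_simple ty n).

Lemma Y_presents : presents u 0 ((1 - u) * dinv) (@Y_rel ty d n R u dinv)
  (fun i => AAdd (AMul (ACst u) (aword R (h_ d i)))
            (AMul (AMul (ACst (1 - u)) (e_ d dinv i)) (AVar (Xi d i)))).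
Proof.
split=> [v w|i|s t|B g x i].
- exact: YCommon.
- exact: YQuad.
- by case=> [v w vw|i]; [left; exists v, w | right; exists i].
- rewrite /= aeval_aword_prod aeval_sum rmorph0 addr0 rmorphM -!mulrA; congr (_ + _ * (_ * (_ * _))).
  by apply: eq_bigr => k _; rewrite aeval_aword_prod.
Qed.

Lemma Z_presents : presents u (1 - u) 0 (@Z_rel ty d n R u)
  (fun i => AAdd (AMul (ACst u) (aword R (h_ d i))) (ACst (1 - u))).
Proof.
split=> [v w|i|s t|B g x i].
- exact: ZCommon.
- exact: ZQuad.
- by case=> [v w vw|i]; [left; exists v, w | right; exists i].
- by rewrite /= aeval_aword_prod rmorph0 !mul0r addr0.
Qed.

End Instances.

(** * The four specializations *)

Lemma finType_bij (X : finType) (x : X) : exists N (e : 'I_N.+1 -> X), bijective e.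
Proof.
have E : #|X|.-1.+1 = #|X| by rewrite prednK //; apply/card_gt0P; exists x.
exists #|X|.-1, (fun i => enum_val (cast_ord E i)).
exists (fun y => cast_ord (esym E) (enum_rank y)) => y.
  by rewrite enum_valK cast_ordK.
by rewrite cast_ordKV enum_rankK.
Qed.

Section Deformations.
Variables (ty : ctype) (d n : nat) (hn : (2 <= n)%N).
Hypotheses (hd : (1 < d)%N) (d_even : ~~ odd d).
Local Notation l := (nb_simple ty n).
Local Notation W := (weyl ty hn).
Local Notation T := (tor ty d n).
Local Notation gen := (Defs.gen ty d n).

Variables (R : comNzRingType) (p q r : R).
Variables (rel : aterm R gen -> aterm R gen -> Prop) (Q : 'I_l -> aterm R gen).
Hypothesis hrel : presents p q r rel Q.
Local Notation A := (palg rel).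
Variables (F : numClosedFieldType) (f : {rmorphism R -> F}).

Definition has_fibers (B : pzAlgType F) (sp : A -> B) : Prop :=
  forall N (b : 'I_N.+1 -> A) co, coordinates b co ->
  exists coB, fiber b co f sp coB.

(** The basis is the family of the products tau v * lift w; over F it is again such
    a family, of a generic representation with specialized coefficients, whose
    trace form is nondegenerate by positivity. *)
Theorem presented_bijective (K : fieldType) (j : {rmorphism R -> K})
    (theta : {rmorphism integral_closure j -> F}) (B : pzAlgType F) (sp : A -> B) :
    (forall a, theta (to_integral_closure j a) = f a) ->
    (forall k, (k.+1%:R : K) != 0) -> split_algebra (base_change j A) ->
    has_fibers sp ->
    [/\ 0 < f p, f q = 0 & (f r)^* = f r] \/ [/\ f p = 0, 0 < f q & f r = 0] ->
  spec_bijective theta sp.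
Proof.
move=> thetaE K0 Ks spF pqr.
have [tau [hA tE]] := presented_rep hn hd hrel.
have [N [e e_bij]] := finType_bij ((0, 1%g) : T * W).
have [co bco] := presented_free hd d_even hrel hA tE e_bij.
have [coK hK] := base_change_fiber j bco.
have [coF hF] := spF _ _ _ bco.
have hB := quad_rep_fiber bco hF hA.
have F0 k : (k.+1%:R : F) != 0 by rewrite pnatr_eq0.
apply: (deformation thetaE bco hK hF K0 F0 Ks); first exact: split_closed.
set bas := (fun i => _); have basE : bas = gen_basis (weyl_coxeter ty hn) (sp \o tau)
    (sp \o (fun i => palg_gen rel (Xi d i))) e.
  by apply/funext => k; rewrite /bas (fiberM hF) /lift (fiber_prod hF).
have hco : coordinates bas coF := fiber_coord hF.
move: hco; rewrite basE => hco; case: pqr => -[p0 q0 r0]; rewrite ?p0 ?q0 ?r0 in hB.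
  exact: (quad_gram_unit hd d_even e_bij hco p0 r0 hB).
exact: (quad_gram_unit0 hd d_even e_bij hco q0 hB).
Qed.

Lemma geval_word (B : pzRingType) (u v : gen -> B) w :
  (geval u v (gword w)).1 = \prod_(x <- w) u x.
Proof. by elim: w => [|x w IHw]; rewrite ?big_nil // big_cons /= IHw. Qed.

(** When the squares of the generators become elements of the torus, the
    generators become invertible, so that the specialized algebra is a group
    algebra. *)
Lemma group_fibers (grel : gterm gen -> gterm gen -> Prop) (hw : 'I_l -> seq gen)
    (h : 'I_l -> T) :
    (forall s t, rel s t ->
       aeval (@alg_cst F (group_algebra F (pgrp grel)) \o f)
         (fun x => to_group_algebra F (pgrp_gen grel x)) s =
       aeval (@alg_cst F (group_algebra F (pgrp grel)) \o f)
         (fun x => to_group_algebra F (pgrp_gen grel x)) t) ->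
    (forall s t, grel s t ->
       (exists v w, [/\ common_rel v w, s = gword v & t = gword w]) \/
       (exists i, s = gword [:: Xi d i; Xi d i] /\ t = gword (hw i))) ->
    (forall i, h i + h i = 0) -> (forall i, wact (@srefl ty n hn i) (h i) = h i) ->
    (forall (B : pzRingType) (u : gen -> B) (tau : T -> B) i, tau 0 = 1 ->
       (forall v w, tau (v + w) = tau v * tau w) ->
       (forall x, u (Tg x) = tau (tgen_elt x)) -> \prod_(x <- hw i) u x = tau (h i)) ->
    (forall (B : pzAlgType F) (tau : T -> B) xi i,
       quad_rep hn (f p) (f q) (f r) tau xi -> xi i * xi i = tau (h i)) ->
  has_fibers (fun a : A => spec_to_group grel (to_base_change f a)).
Proof.
move=> rel_grel grel_inv h2 h_fix hwE quadE N b co bco.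
have [coB hB] := base_change_fiber f bco.
have [tau [hA tE]] := presented_rep hn hd hrel.
pose sp : A -> base_change f A := @to_base_change _ _ f A.
have hBr := quad_rep_fiber bco hB hA; have [t0 tD tA _ _] := hBr.
have xi2 i : sp (palg_gen rel (Xi d i)) * sp (palg_gen rel (Xi d i)) = sp (tau (h i)).
  exact: (quadE _ _ _ i hBr).
have tC v w : sp (tau v) * sp (tau w) = sp (tau w) * sp (tau v).
  by have := tD v w; rewrite addrC => /= <-; exact: tD.
pose iv x := match x with
  | Tg x => sp (tau (- tgen_elt x))
  | Xi i => sp (palg_gen rel (Xi d i)) * sp (tau (h i))
  end.
have th2 i : sp (tau (h i)) * sp (tau (h i)) = 1.
  by have /= <- := tD (h i) (h i); rewrite h2; exact: t0.
have rel_holds v w : common_rel v w ->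
    \prod_(x <- v) sp (palg_gen rel x) = \prod_(x <- w) sp (palg_gen rel x).
  move=> vw; rewrite -!(fiber_prod hB); congr sp.
  rewrite -!(aeval_aword_prod (@alg_cst R A)) !aeval_pi.
  exact/pi_alg_eq/acong_rel/(pres_common hrel).
apply: (group_fiber rel_grel (invB := iv) _ _ _ bco).
- case=> [x|i] /=.
    by rewrite tE; have /= <- := tD (tgen_elt x) (- tgen_elt x); rewrite subrr; exact: t0.
  by rewrite mulrA [X in X * _]xi2 th2.
- case=> [x|i] /=.
    by rewrite tE; have /= <- := tD (- tgen_elt x) (tgen_elt x); rewrite addNr; exact: t0.
  have /= E := tA i (h i); rewrite h_fix in E.
  by rewrite -mulrA -[X in _ * X]E mulrA [X in X * _]xi2 th2.
- move=> s t /grel_inv[[v [w [vw -> ->]]]|[i [-> ->]]].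
    by rewrite !geval_word; exact: rel_holds.
  rewrite !geval_word big_cons big_seq1 [LHS]xi2.
  apply: esym; apply: (hwE _ _ (sp \o tau) i t0 tD) => x.
  by rewrite tE.
Qed.

End Deformations.

Lemma fracfield_char0 (F : numFieldType) (K : splittingFieldType {fraction {poly F}}) k :
  (k.+1%:R : K) != 0.
Proof.
rewrite -(rmorph_nat (in_alg K)) fmorph_eq0 -(rmorph_nat (@FracField.tofrac {poly F})).
by rewrite tofrac_eq0 -polyC_natr polyC_eq0 pnatr_eq0.
Qed.

Lemma odd_prime_power_pred q : odd_prime_power q -> (1 < q.-1)%N /\ ~~ odd q.-1.
Proof.
case=> q_odd [p [k [p_pr k0 qE]]].
have q1 : (1 < q)%N by rewrite qE -(exp1n k) ltn_exp2r // prime_gt1.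
by case: q q_odd q1 {qE} => [|[|[|q]]] //= /negPn.
Qed.

Lemma Y_alg ty d n (F : fieldType) : (Y_algebra ty d n F : pzAlgType (laurent F)) =
  palg (@Y_rel ty d n _ (laurent_of_poly 'X) (laurent_of_poly (d%:R^-1 : F)%:P))
    :> pzAlgType (laurent F).
Proof. by []. Qed.

Lemma KY_alg (F : fieldType) (K : splittingFieldType {fraction {poly F}}) ty d n :
  (KY K ty d n : pzAlgType K) = base_change (laurent_in K) (Y_algebra ty d n F) :> pzAlgType K.
Proof. by []. Qed.

Lemma Z_alg ty d n (F : fieldType) : (Z_algebra ty d n F : pzAlgType {poly F}) =
  palg (@Z_rel ty d n _ ('X : {poly F})) :> pzAlgType {poly F}.
Proof. by []. Qed.

Lemma KZ_alg (F : fieldType) (K : splittingFieldType {fraction {poly F}}) ty d n :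
  (KZ K ty d n : pzAlgType K) = base_change (poly_in K) (Z_algebra ty d n F) :> pzAlgType K.
Proof. by []. Qed.

Section Specializations.
Variables (F : numClosedFieldType) (ty : ctype) (d n : nat) (hn : (2 <= n)%N).
Hypotheses (hd : (1 < d)%N) (d_even : ~~ odd d).
Variable K : splittingFieldType {fraction {poly F}}.
Local Notation h := (@hgam ty d n).
Local Notation wfix := (fun i => hgam_conj hd d_even (erefl (srefl hn i * srefl hn i)%g)).

Let Y_pres := @Y_presents ty d n (laurent F) (laurent_of_poly 'X)
  (laurent_of_poly (d%:R^-1 : F)%:P).
Let Z_pres := @Z_presents ty d n {poly F} 'X.

Lemma h_word_eval (B : pzRingType) (u : gen ty d n -> B) (tau : tor ty d n -> B) i :
    tau 0 = 1 -> (forall v w, tau (v + w) = tau v * tau w) ->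
    (forall x, u (Tg x) = tau (tgen_elt x)) -> \prod_(x <- h_ d i) u x = tau (h i).
Proof.
by move=> t0 tD tE; rewrite (t_pow_word hd t0 tD tE) // coroot_lattice.
Qed.

Lemma N_inv s t : @N_rel ty d n s t ->
  (exists v w, [/\ common_rel v w, s = gword v & t = gword w]) \/
  (exists i, s = gword [:: Xi d i; Xi d i] /\ t = gword (h_ d i)).
Proof. by case=> [v w vw|i]; [left; exists v, w | right; exists i]. Qed.

Lemma S_inv s t : @S_rel ty d n s t ->
  (exists v w, [/\ common_rel v w, s = gword v & t = gword w]) \/
  (exists i, s = gword [:: Xi d i; Xi d i] /\ t = gword [::]).
Proof. by case=> [v w vw|i]; [left; exists v, w | right; exists i]. Qed.

Lemma quad_N (p q r : F) (B : pzAlgType F) (tau : tor ty d n -> B) xi i :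
  p = 1 -> q = 0 -> r = 0 -> quad_rep hn p q r tau xi -> xi i * xi i = tau (h i).
Proof.
move=> -> -> -> [_ _ _ _ ->].
by rewrite rmorph1 rmorph0 !mul0r mul1r !addr0.
Qed.

Lemma quad_S (p q r : F) (B : pzAlgType F) (tau : tor ty d n -> B) xi (i : 'I_(nb_simple ty n)) :
  p = 0 -> q = 1 -> r = 0 -> quad_rep hn p q r tau xi -> xi i * xi i = tau 0.
Proof.
move=> -> -> -> [-> _ _ _ ->].
by rewrite rmorph1 rmorph0 !mul0r add0r addr0.
Qed.

Lemma Y_bijective c (c0 : c != 0)
    (theta : {rmorphism integral_closure (laurent_in K) -> F}) (B : pzAlgType F)
    (sp : Y_algebra ty d n F -> B) :
    (forall a, theta (to_integral_closure _ a) = laurent_eval c0 a) ->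
    split_algebra (KY K ty d n) -> 0 < c ->
    has_fibers (laurent_eval c0) sp ->
  spec_bijective theta sp.
Proof.
move=> thetaE Ks cpos spF.
have Ks' : split_algebra (base_change (laurent_in K)
    (palg (@Y_rel ty d n _ (laurent_of_poly 'X) (laurent_of_poly (d%:R^-1 : F)%:P)))).
  by rewrite -Y_alg -KY_alg.
apply: (presented_bijective hn hd d_even Y_pres thetaE (@fracfield_char0 F K) Ks' spF).
left; split.
- by rewrite /= laurent_eval_poly hornerX.
- exact: rmorph0.
- have cR : c^* = c by apply: conj_Creal; exact: gtr0_real.
  have E : laurent_eval c0 ((1 - laurent_of_poly 'X) * laurent_of_poly (d%:R^-1)%:P) =
      (1 - c) * d%:R^-1.
    by rewrite [LHS]rmorphM rmorphB rmorph1 /= !laurent_eval_poly hornerX hornerC.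
  apply: (eq_trans (congr1 Num.conj E) (eq_trans _ (esym E))).
  by rewrite rmorphM rmorphB rmorph1 /= cR fmorphV rmorph_nat.
Qed.

Lemma Y_to_N_fibers : has_fibers (laurent_eval (oner_neq0 F))
  (fun y : Y_algebra ty d n F => Y1_to_N (to_base_change _ y)).
Proof.
have fibers := @group_fibers ty d n hn hd _ _ _ _ _ _ Y_pres F (laurent_eval (oner_neq0 F))
  (@N_rel ty d n) (@h_ ty d n) h (@Y1_to_N_rel ty d n F) (@N_inv).
apply: fibers.
- exact: (hgam2 hd d_even).
- exact: wfix.
- exact: h_word_eval.
- move=> B tau xi i; apply: quad_N.
  + by rewrite /= laurent_eval_poly hornerX.
  + exact: rmorph0.
  + by rewrite rmorphM rmorphB rmorph1 /= laurent_eval_poly hornerX subrr mul0r.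
Qed.

Lemma Z_bijective c
    (theta : {rmorphism integral_closure (poly_in K) -> F}) (B : pzAlgType F)
    (sp : Z_algebra ty d n F -> B) :
    (forall a, theta (to_integral_closure _ a) = horner_eval c a) ->
    split_algebra (KZ K ty d n) -> c = 1 \/ c = 0 ->
    has_fibers (horner_eval c) sp ->
  spec_bijective theta sp.
Proof.
move=> thetaE Ks c01 spF.
have Ks' : split_algebra (base_change (poly_in K) (palg (@Z_rel ty d n _ ('X : {poly F})))).
  by rewrite -Z_alg -KZ_alg.
apply: (presented_bijective hn hd d_even Z_pres thetaE (@fracfield_char0 F K) Ks' spF).
rewrite rmorphB rmorph1 rmorph0 /= /horner_eval hornerX; case: c01 => ->; [left | right].
  by rewrite ltr01 subrr conjC0.
by rewrite subr0 ltr01.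
Qed.

Lemma Z_to_N_fibers : has_fibers (horner_eval (1 : F))
  (fun z : Z_algebra ty d n F => Z1_to_N (to_base_change _ z)).
Proof.
have fibers := @group_fibers ty d n hn hd _ _ _ _ _ _ Z_pres F (horner_eval (1 : F))
  (@N_rel ty d n) (@h_ ty d n) h (@Z1_to_N_rel ty d n F) (@N_inv).
apply: fibers.
- exact: (hgam2 hd d_even).
- exact: wfix.
- exact: h_word_eval.
- move=> B tau xi i; apply: quad_N.
  + by rewrite /= /horner_eval hornerX.
  + by rewrite rmorphB rmorph1 /= /horner_eval hornerX subrr.
  + exact: rmorph0.
Qed.

Lemma Z_to_S_fibers : has_fibers (horner_eval (0 : F))
  (fun z : Z_algebra ty d n F => Z0_to_S (to_base_change _ z)).
Proof.
have fibers := @group_fibers ty d n hn hd _ _ _ _ _ _ Z_pres F (horner_eval (0 : F))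
  (@S_rel ty d n) (fun=> [::]) (fun=> 0) (@Z0_to_S_rel ty d n F) (@S_inv).
apply: fibers.
- by move=> i; rewrite addr0.
- by move=> i; rewrite (act0 (wact_torus ty hn hd)).
- by move=> B u tau i t0 _ _; rewrite big_nil t0.
- move=> B tau xi i; apply: quad_S.
  + by rewrite /= /horner_eval hornerX.
  + by rewrite rmorphB rmorph1 /= /horner_eval hornerX subr0.
  + exact: rmorph0.
Qed.

End Specializations.

Theorem mainTheorem1 (R : realType) (q : nat) (hq : odd_prime_power q)
    (ty : ctype) (n : nat) (hn : (2 <= n)%N)
    (K : splittingFieldType {fraction {poly R[i]}})
    (K_galois : galois 1 {:K})
    (KY_split : split_algebra (KY K ty q.-1 n))
    (KZ_split : split_algebra (KZ K ty q.-1 n))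
    (phiq phi1 : {rmorphism integral_closure (laurent_in K) -> R[i]})
    (tau1 tau0 : {rmorphism integral_closure (poly_in K) -> R[i]})
    (phiqE : forall a : laurent R[i], phiq (to_integral_closure _ a) =
       laurent_eval (odd_prime_power_invr_neq0 R[i] hq) a)
    (phi1E : forall a : laurent R[i], phi1 (to_integral_closure _ a) =
       laurent_eval (oner_neq0 R[i]) a)
    (tau1E : forall p : {poly R[i]}, tau1 (to_integral_closure _ p) =
       horner_eval 1 p)
    (tau0E : forall p : {poly R[i]}, tau0 (to_integral_closure _ p) =
       horner_eval 0 p) :
  let N := N_group ty q.-1 n in
  let S := S_group ty q.-1 n in
  let H := H_algebra R[i] ty n hq in
  let to_H : Y_algebra ty q.-1 n R[i] -> H := @to_base_change _ _ _ _ in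
  let Y_to_N : Y_algebra ty q.-1 n R[i] -> group_algebra R[i] N :=
    fun y => Y1_to_N (to_base_change _ y) in
  let Z_to_N : Z_algebra ty q.-1 n R[i] -> group_algebra R[i] N :=
    fun z => Z1_to_N (to_base_change _ z) in
  let Z_to_S : Z_algebra ty q.-1 n R[i] -> group_algebra R[i] S :=
    fun z => Z0_to_S (to_base_change _ z) in
  let d_phiq := spec_map phiq to_H in
  let d_phi1 := spec_map phi1 Y_to_N in
  let d_tau1 := spec_map tau1 Z_to_N in
  let d_tau0 := spec_map tau0 Z_to_S in
  [/\ spec_bijective phiq to_H, spec_bijective phi1 Y_to_N,
      spec_bijective tau1 Z_to_N, spec_bijective tau0 Z_to_S &
      set_bij (Irr H) (Irr (group_algebra R[i] S))
        (d_tau0 \o 'pinv_(fun=> fun=> 0) (Irr (KZ K ty q.-1 n)) d_tau1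
         \o d_phi1 \o 'pinv_(fun=> fun=> 0) (Irr (KY K ty q.-1 n)) d_phiq)].
Proof.
move=> N S H to_H Y_to_N Z_to_N Z_to_S d_phiq d_phi1 d_tau1 d_tau0.
have [hd d_even] := odd_prime_power_pred hq.
have q0 : (0 < q%:R^-1 :> R[i]).
  by rewrite lt0r (odd_prime_power_invr_neq0 _ hq) invr_ge0 ler0n.
have bq : spec_bijective phiq to_H.
  apply: (Y_bijective hn hd d_even phiqE KY_split q0) => N' b co bco.
  exact: base_change_fiber.
have b1 : spec_bijective phi1 Y_to_N.
  by apply: (Y_bijective hn hd d_even phi1E KY_split ltr01); exact: Y_to_N_fibers.
have c1 : spec_bijective tau1 Z_to_N.
  by apply: (Z_bijective hn hd d_even tau1E KZ_split); [left | exact: Z_to_N_fibers].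
have c0 : spec_bijective tau0 Z_to_S.
  by apply: (Z_bijective hn hd d_even tau0E KZ_split); [right | exact: Z_to_S_fibers].
have gq := bijpinv_bij (fun=> fun=> 0) bq.2.
have g1 := bijpinv_bij (fun=> fun=> 0) c1.2.
split; [exact: bq | exact: b1 | exact: c1 | exact: c0 |].
exact: (set_bij_comp gq (set_bij_comp b1.2 (set_bij_comp g1 c0.2))).
Qed.
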